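(* For every $\varepsilon>0$ there exists $\delta>0$ such that for every $C>0$ there exists $L$ with the following property. Let $J$ be a graph with $\mathsf{v}(J)\le C$, let $\ell\ge L$ be an integer, and let $H$ be a graph such that, for some $F\subseteq E(H)$ with $|F|\le\delta\,\mathsf{v}(H)$, the graph $H\setminus F$ is a subgraph of $\ell J$. Then $c(H)\le(1+\varepsilon)\,\ell\, c_f(J)$.
   Context: All graphs are finite and simple; $\ell J$ is the disjoint union of $\ell$ copies of $J$; $H\setminus F$ is $H$ with the edges of $F$ deleted. $\mathsf{d}(G)=\mathsf{e}(G)/\mathsf{v}(G)$. For $\mathsf{v}(H)\ge2$, $c(H)$ is the supremum of $\mathsf{d}(G)$ over non-null graphs $G$ with no $H$ minor. A jumbled model of $J$ in $G$ is a map $\mu$ from $V(J)$ to subsets of $V(G)$ such that each $G[\mu(v)]$ is connected (and nonempty) and for every edge $uv\in E(J)$ some edge of $G$ joins $\mu(u)$ and $\mu(v)$ (overlaps allowed); $\mu^{\#}(x)=|\{v:x\in\mu(v)\}|$. $\mathrm{Vol}_J(G)$ is the supremum of $\sum_i\alpha_i$ over finitely many reals $\alpha_i\ge0$ and jumbled models $\mu_i$ of $J$ in $G$ with $\sum_i\alpha_i\mu_i^{\#}(x)\le1$ for all $x$. $c_f(J)=\sup_G\mathsf{d}(G)/\mathrm{Vol}_J(G)$ over non-null graphs $G$. *)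

(* Defs.v *)
From HB Require Import structures.
From mathcomp Require Import all_boot all_order all_algebra.
From mathcomp Require Import boolp classical_sets reals constructive_ereal ereal.

Set Implicit Arguments.
Unset Strict Implicit.
Unset Printing Implicit Defensive.

Import Order.TTheory GRing.Theory Num.Theory.

Local Open Scope ring_scope.

Record sgraph := SGraph {
  vertex :> finType;
  adj : rel vertex;
  adj_sym : symmetric adj;
  adj_irrefl : irreflexive adj
}.

Definition nverts (G : sgraph) : nat := #|vertex G|.

Definition edges (G : sgraph) : {set {set G}} :=
  [set [set p.1; p.2] | p : G * G & adj p.1 p.2].

Definition nedges (G : sgraph) : nat := #|edges G|.

Definition density (R : realType) (G : sgraph) : R :=
  (nedges G)%:R / (nverts G)%:R.

Definition del_adj (H : sgraph) (F : {set {set H}}) : rel H :=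
  fun x y => adj x y && ([set x; y] \notin F).

Lemma del_adj_sym (H : sgraph) (F : {set {set H}}) : symmetric (del_adj F).
Proof. by move=> x y; rewrite /del_adj adj_sym finset.setUC. Qed.

Lemma del_adj_irrefl (H : sgraph) (F : {set {set H}}) :
  irreflexive (del_adj F).
Proof. by move=> x; rewrite /del_adj adj_irrefl. Qed.

Definition del_edges (H : sgraph) (F : {set {set H}}) : sgraph :=
  SGraph (@del_adj_sym H F) (@del_adj_irrefl H F).

Definition copies_adj (l : nat) (J : sgraph) : rel ('I_l * J)%type :=
  fun p q => (p.1 == q.1) && adj p.2 q.2.

Lemma copies_adj_sym (l : nat) (J : sgraph) : symmetric (@copies_adj l J).
Proof. by move=> p q; rewrite /copies_adj eq_sym adj_sym. Qed.

Lemma copies_adj_irrefl (l : nat) (J : sgraph) :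
  irreflexive (@copies_adj l J).
Proof. by move=> p; rewrite /copies_adj adj_irrefl andbF. Qed.

Definition copies (l : nat) (J : sgraph) : sgraph :=
  SGraph (@copies_adj_sym l J) (@copies_adj_irrefl l J).

(* Subgraphs are taken up to isomorphism. *)
Definition is_subgraph (G K : sgraph) : Prop :=
  exists2 f : G -> K, injective f & forall x y, adj x y -> adj (f x) (f y).

(* The induced subgraph G[S] is connected; in particular S is nonempty. *)
Definition connected_in (G : sgraph) (S : {set G}) : Prop :=
  S != finset.set0 /\
  forall x y : G, x \in S -> y \in S ->
    connect [rel u v | [&& u \in S, v \in S & adj u v]] x y.

Definition jumbled_model (J G : sgraph) (mu : J -> {set G}) : Prop :=
  (forall v, connected_in (mu v)) /\
  (forall u v, adj u v ->
     exists x y, [/\ x \in mu u, y \in mu v & adj x y]).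

(* H is a minor of G exactly when G has a model of H, that is, a jumbled model
   whose branch sets are pairwise disjoint. *)
Definition is_minor (H G : sgraph) : Prop :=
  exists2 mu : H -> {set G}, jumbled_model mu &
    forall u v, u != v -> [disjoint mu u & mu v].

(* The number of branch sets containing x, written mu^#(x). *)
Definition multiplicity (J G : sgraph) (mu : J -> {set G}) (x : G) : nat :=
  #|[set v | x \in mu v]|.

Local Open Scope classical_set_scope.

Definition minor_density (R : realType) (H : sgraph) : \bar R :=
  ereal_sup [set s | exists G : sgraph,
               [/\ (0 < nverts G)%N, ~ is_minor H G & s = (density R G)%:E]].

Definition fractional_packing (R : realType) (J G : sgraph) (n : nat)
    (alpha : 'I_n -> R) (mu : 'I_n -> J -> {set G}) : Prop :=
  [/\ forall i, 0 <= alpha i,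
      forall i, jumbled_model (mu i) &
      forall x, \sum_(i < n) alpha i * (multiplicity (mu i) x)%:R <= 1].

(* This supremum is +oo when J has no vertices. *)
Definition Vol (R : realType) (J G : sgraph) : \bar R :=
  ereal_sup [set s | exists n (alpha : 'I_n -> R) (mu : 'I_n -> J -> {set G}),
               fractional_packing alpha mu /\
               s = (\sum_(i < n) alpha i)%:E].

(* The quotient is taken in \bar R, where 0^-1 = +oo, +oo^-1 = 0 and
   0 * +oo = 0.  Vol J G = 0 happens only if G has no edge (while J has one);
   the quotient is then 0 / 0 = 0, which does not affect the supremum. *)
Definition frac_minor_density (R : realType) (J : sgraph) : \bar R :=
  ereal_sup [set s | exists2 G : sgraph, (0 < nverts G)%N &
               s = ((density R G)%:E / Vol R J G)%E].

(* Main.v *)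
(* Let c = c_f(J) and D = (1 + eps) l c; a graph G of density more than D must be shown to contain H.
   A minor G' of G that is minimal among the minors with at least D vertices and many edges has minimum degree
   more than D, at least D - 1 common neighbours at the ends of each edge, fewer than 2 D v(G') edges, and
   connectivity proportional to D.  Hence either G' has a subgraph on O(D) vertices which still has
   density almost D, or it contains a large constant number of disjoint pieces on O(D) vertices whose densities
   add up to more than l c.  Pieces can be chosen highly connected; Menger's theorem links them, and contracting
   the linking sets makes the union of the pieces a robustly connected graph on O(D) vertices.
   By the definition of c_f, a graph tau of density d has a fractional packing of jumbled models of J of weight
   about d / c; in a large blow-up of tau it becomes an integral family of pairwise disjoint models.  As long as
   a graph has many edges it contains blow-ups of fixed size, so each piece, being of density d and on O(D)
   vertices, contains about d / c - o(D) disjoint models of J, which makes l models in all.  The deleted edges F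
   are restored by disjoint bounded connected sets inside a small random reserve of vertices set aside
   beforehand. *)

Require Import Defs.
From mathcomp Require Import all_boot all_order all_algebra.
From mathcomp Require Import boolp reals constructive_ereal ereal.
From mathcomp Require Import zify ring lra.

Set Implicit Arguments.
Unset Strict Implicit.
Unset Printing Implicit Defensive.

Import Order.TTheory GRing.Theory Num.Theory.

(** Since [delta] may not depend on [C], the number of deleted edges can be a fixed fraction of [D]
    whatever [J] is, so the cost of restoring one edge must be bounded in terms of [eps] alone. This
    dictates the order of quantifiers throughout: the size of connectors and the factor [th] are
    fixed before [C], while everything that depends on [C] (blow-up sizes, the additive loss of a
    packing) only raises the lower bound on the connectivity [k], which is proportional to [D]. The
    packing of models of [J] is not under control and could block every short connection; hence the
    reserve is taken out of the pieces before they are packed. Its existence rests on a second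
    moment bound, too weak for a union bound over all pairs of vertices, so a few bad vertices are
    discarded too. The bounds v(J)/4 <= c <= 2 v(J) make the estimates uniform: the lower one
    compares v(H) with [D], the upper one keeps rounding losses independent of [J]. The upper one
    uses the freedom of jumbled models: a single edge can serve as every branch set. *)

(** * Connectivity inside a vertex set *)

Definition conn (T : finType) (r : rel T) (S : {set T}) : rel T :=
  connect [rel u v | [&& u \in S, v \in S & r u v]].

(** The empty set qualifies, unlike in [connected_in]. As [conn] is reflexive also outside [S],
    membership of the ends in [S] is asked for separately. *)
Definition connset (T : finType) (r : rel T) (S : {set T}) : Prop :=
  {in S &, forall x y, conn r S x y}.

Section Connectivity.
Variables (T : finType) (r : rel T).
Hypothesis r_sym : symmetric r.
Implicit Types (S P R : {set T}) (x y z : T).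

Lemma conn_sub (r' : rel T) S S' x y :
  S \subset S' -> subrel r r' -> conn r S x y -> conn r' S' x y.
Proof.
move=> /subsetP sS rr'; apply: connect_sub => u v /= /and3P[uS vS ruv].
by apply: connect1; rewrite /= !sS // rr'.
Qed.

Lemma connS S S' x y : S \subset S' -> conn r S x y -> conn r S' x y.
Proof. by move=> sS; apply: conn_sub. Qed.

Lemma conn_sym S x y : conn r S x y = conn r S y x.
Proof.
apply: sym_connect_sym => u v /=.
by rewrite r_sym andbA (andbC (u \in S)) -andbA.
Qed.

Lemma conn_trans S y x z : conn r S x y -> conn r S y z -> conn r S x z.
Proof. exact: connect_trans. Qed.

Lemma conn1 S x y : x \in S -> y \in S -> r x y -> conn r S x y.
Proof. by move=> xS yS rxy; apply: connect1; rewrite /= xS yS. Qed.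

Lemma conn_in S x y : x \in S -> conn r S x y -> y \in S.
Proof.
move=> xS /connectP[p]; elim: p x xS => [|z p IH] x xS /= => [_ -> //|].
by case/andP=> /and3P[_ zS _]; apply: IH.
Qed.

Lemma connset1 x : connset r [set x].
Proof. by move=> y z /set1P-> /set1P->; apply: connect0. Qed.

Lemma connset_from S x : {in S, forall y, conn r S x y} -> connset r S.
Proof.
by move=> h y z yS zS; apply: (@conn_trans _ x); [rewrite conn_sym|]; apply: h.
Qed.

Lemma connsetU S S' x y : connset r S -> connset r S' ->
  x \in S -> y \in S' -> (x == y) || r x y -> connset r (S :|: S').
Proof.
move=> cS cS' xS yS' xy.
have xyc : conn r (S :|: S') x y.
  case/orP: xy => [/eqP->|rxy]; first exact: connect0.
  by apply: conn1; rewrite // inE ?xS ?yS' ?orbT.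
apply: (@connset_from _ x) => z /setUP[zS|zS'].
  exact: connS (subsetUl _ _) (cS _ _ xS zS).
exact: conn_trans xyc (connS (subsetUr _ _) (cS' _ _ yS' zS')).
Qed.

Lemma connset_bigcup (I : finType) (e : rel I) (K : {set I}) (B : I -> {set T}) :
  connset e K -> (forall i, connset r (B i)) -> (forall i, B i != set0) ->
  (forall i j, i \in K -> j \in K -> e i j ->
     exists x y, [/\ x \in B i, y \in B j & r x y]) ->
  connset r (\bigcup_(i in K) B i).
Proof.
move=> cK cB nB eB x y /bigcupP[i iK xi] /bigcupP[j jK yj].
have sub k : k \in K -> B k \subset \bigcup_(i in K) B i.
  by move=> kK; apply: bigcup_sup.
suff h : forall i' x', conn e K i i' -> i' \in K -> x' \in B i' ->
    conn r (\bigcup_(i in K) B i) x x' by apply: (h j) => //; apply: cK.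
move=> i' x' /connectP[p pp ->] {i'}.
elim: p i x iK xi pp => [|k p IH] i x iK xi /= => [_ _ x'i|].
  exact: connS (sub _ iK) (cB _ _ _ xi x'i).
case/andP=> /and3P[_ kK eik] pp lK x'l.
have [u [v [ui vk ruv]]] := eB _ _ iK kK eik.
apply: conn_trans (IH k v kK vk pp lK x'l).
apply: (@conn_trans _ u); first exact: connS (sub _ iK) (cB _ _ _ xi ui).
by apply: conn1 ruv; apply/bigcupP; [exists i|exists k].
Qed.

(** The prefix of a path up to its first vertex in [P]. The last clause records that earlier
    vertices are reached from [x] off [P], which later keeps parts of a linkage on one side of a
    separator. *)
Lemma first_hit S P x y : conn r S x y -> x \in S -> y \in P ->
  exists a R, [/\ a \in P, R \subset S, (x \in R) && (a \in R), connset r R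
    & forall z, z \in R -> z != a -> z \notin P /\ conn r (S :\: P) x z].
Proof.
move=> /connectP[p pp ->] xS; elim: p x xS pp => [|x1 p IH] x xS /= pp yP.
  exists x, [set x]; rewrite !inE eqxx sub1set; split=> //.
    exact: connset1.
  by move=> z /set1P->; rewrite eqxx.
have [xP|xP] := boolP (x \in P).
  exists x, [set x]; rewrite !inE eqxx sub1set; split=> //.
    exact: connset1.
  by move=> z /set1P->; rewrite eqxx.
case/andP: pp => /and3P[_ x1S rx] pp.
have [a [R [aP RS /andP[x1R aR] cR Rz]]] := IH x1 x1S pp yP.
exists a, (x |: R); split=> //.
- by rewrite subUset sub1set xS.
- by rewrite setU11 inE aR orbT.
- by apply: (@connsetU _ _ x x1) => //; rewrite ?set11 ?rx ?orbT //; apply: connset1.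
move=> z /setU1P[->|zR] za; first by split=> //; apply: connect0.
have [zP cz] := Rz z zR za; split=> //.
have [E|nE] := eqVneq x1 z.
  by rewrite -E; apply: conn1; rewrite // !inE ?xP ?xS // E zP -E.
have x1a : x1 != a.
  apply: contra_neq nE => E; move: cz; rewrite E => /connectP[[|w q]] //=.
  by rewrite !inE aP.
have [x1P _] := Rz x1 x1R x1a.
apply: conn_trans cz; apply: conn1; rewrite // !inE ?xP ?x1P //.
Qed.

End Connectivity.

(** * Menger's theorem, after Goring *)

Lemma conn_closed (T : finType) (r : rel T) (S W : {set T}) x y :
  (forall u v, u \in W -> u \in S -> v \in S -> r u v -> v \in W) ->
  x \in W -> conn r S x y -> y \in W.
Proof.
move=> cl xW /connectP[p]; elim: p x xW => [|z p IH] x xW /= => [_ -> //|].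
by case/andP=> /and3P[xS zS rxz]; apply: IH; apply: cl rxz.
Qed.

Section Goring.
Variables (T : finType) (r : rel T).
Hypothesis r_sym : symmetric r.
Implicit Types (A B S X : {set T}) (x y z : T).

Definition cut_rel x y : rel T := fun u v => r u v && ([set u; v] != [set x; y]).

(** The vertices on the [A] side of the separator [S]. *)
Definition reach (q : rel T) A S z := [exists a in A :\: S, conn q (~: S) a z].

Lemma cut_rel_sym x y : symmetric (cut_rel x y).
Proof. by move=> u v; rewrite /cut_rel r_sym setUC. Qed.

Lemma cut_relC x y : cut_rel x y =2 cut_rel y x.
Proof. by move=> u v; rewrite /cut_rel (setUC [set x]). Qed.

Lemma cut_rel_sub x y : subrel (cut_rel x y) r.
Proof. by move=> u v /andP[]. Qed.

Lemma cut_relE x y u v : r u v -> u != x -> u != y -> cut_rel x y u v.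
Proof.
move=> ruv ux uy; rewrite /cut_rel ruv /=; apply/eqP => E.
by have := set21 u v; rewrite E !inE (negPf ux) (negPf uy).
Qed.

Lemma reach_notin q A S z : reach q A S z -> z \notin S.
Proof.
case/exists_inP=> a; rewrite inE => /andP[aS _] c.
by have := conn_in _ c; rewrite !inE; apply.
Qed.

(** Suppose [X] separates [A] from [x |: S] once the edge xy is cut. A path from [A] off [X] then
    stays off [x] and [S], and it cannot be at [y], which is not on the [A] side; so it never uses
    xy and, by the choice of [S], never reaches [B]. Hence [X] separates [A] from [B] even with xy
    present. *)
Lemma separator_extend A B S x y (k : nat) :
  (forall X, #|X| < k -> exists a b,
     [/\ a \in A :\: X, b \in B :\: X & conn r (~: X) a b]) ->
  (forall a b, a \in A :\: S -> b \in B :\: S ->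
     ~~ conn (cut_rel x y) (~: S) a b) ->
  ~~ reach (cut_rel x y) A S y ->
  forall X, #|X| < k -> exists a b,
     [/\ a \in A :\: X, b \in (x |: S) :\: X & conn (cut_rel x y) (~: X) a b].
Proof.
move=> sep nsep yA X ltXk; have [a [b [aX bX cab]]] := sep X ltXk.
have := aX; have := bX; rewrite !inE => /andP[bnX bB] /andP[anX aA].
case: (pickP [pred s in (x |: S) :\: X | conn (cut_rel x y) (~: X) a s]) => [s|none].
  by case/andP=> sS cs; exists a, s.
have out z : conn (cut_rel x y) (~: X) a z -> z \notin x |: S.
  move=> cz; apply/negP => zS; have /negP[] := negbT (none z).
  rewrite /= cz andbT inE zS andbT.
  by have := conn_in _ cz; rewrite !inE; apply.
have aS : a \notin x |: S by apply: out; apply: connect0.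
have aS' : a \in A :\: S by move: aS; rewrite !inE negb_or aA => /andP[_ ->].
pose W := [set z | conn (cut_rel x y) (~: X) a z && conn (cut_rel x y) (~: S) a z].
have bW : b \in W.
  apply: (@conn_closed _ r (~: X) W a) cab; last by rewrite inE; apply/andP; split; apply: connect0.
  move=> u v; rewrite [u \in W]inE => /andP[ca cS] uX vX ruv.
  have := out _ ca; rewrite !inE negb_or => /andP[ux uS].
  have uy : u != y.
    by apply: contraNneq yA => uy; apply/exists_inP; exists a; rewrite // -[y in conn _ _ _ y]uy.
  have ruv' := cut_relE ruv ux uy.
  have cv : conn (cut_rel x y) (~: X) a v by apply: conn_trans ca _; apply: conn1.
  rewrite cv /=; apply: conn_trans cS _; apply: conn1; rewrite ?inE //.
  by have := out _ cv; rewrite !inE negb_or => /andP[].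
move: bW; rewrite inE => /andP[cb1 cb2].
have := out _ cb1; rewrite !inE negb_or => /andP[_ bS].
have bS' : b \in B :\: S by rewrite inE bS.
by case/negP: (nsep a b aS' bS').
Qed.

(** There are [k] disjoint sets and at most [k] vertices in [x |: S]. Once each set is cut at its
    first vertex there, the ends [s i] exhaust [x |: S], so that two such linkages match up end to
    end. *)
Lemma trim_linkage A S x y (k : nat) (R : 'I_k -> {set T}) :
  #|S| < k ->
  (forall i, connset (cut_rel x y) (R i)) ->
  (forall i, exists a b, [/\ a \in A, b \in x |: S, a \in R i & b \in R i]) ->
  (forall i j, i != j -> [disjoint R i & R j]) ->
  exists (s : 'I_k -> T) (Q : 'I_k -> {set T}),
   [/\ forall i, [/\ s i \in Q i, connset (cut_rel x y) (Q i)
         & exists2 a, a \in A & a \in Q i],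
       injective s, forall z, z \in x |: S -> exists i, s i = z,
       forall i j, i != j -> [disjoint Q i & Q j]
     & forall i, s i \in x |: S /\ forall z, z \in Q i -> z != s i ->
         z \notin x |: S /\ reach (cut_rel x y) A S z].
Proof.
move=> ltSk cR ABR dR.
have /fin_all_exists2[s Ps Ps'] i : exists2 s, s \in x |: S & exists Q : {set T},
   [/\ Q \subset R i, s \in Q, connset (cut_rel x y) Q, exists2 a, a \in A & a \in Q
     & forall z, z \in Q -> z != s -> z \notin x |: S /\ reach (cut_rel x y) A S z].
  have [a [b [aA bS aR bR]]] := ABR i.
  have [s [Q [sS QR /andP[aQ sQ] cQ zQ]]] :=
    first_hit (@cut_rel_sym x y) (cR i a b aR bR) aR bS.
  exists s => //; exists Q; split=> //; first by exists a.
  move=> z zq zs; have [zS cz] := zQ z zq zs; split=> //.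
  have aRS : a \in R i :\: (x |: S).
    have := cz; rewrite conn_sym; last exact: cut_rel_sym.
    by apply: conn_in; rewrite inE zS (subsetP QR).
  apply/exists_inP; exists a.
    by move: aRS; rewrite !inE negb_or aA => /andP[/andP[_ ->]].
  apply: connS cz; apply/subsetP => w.
  by rewrite !inE negb_or => /andP[/andP[_ ->]].
have {Ps'}/fin_all_exists[Q PQ] := Ps'.
have dQ i j : i != j -> [disjoint Q i & Q j].
  move=> ij; have [Qi _ _ _ _] := PQ i; have [Qj _ _ _ _] := PQ j.
  exact: disjointWl Qi (disjointWr Qj (dR i j ij)).
have sI : injective s.
  move=> i j E; apply/eqP; apply: contraT => /dQ /disjoint_setI0 /setP/(_ (s i)).
  by have [_ si _ _ _] := PQ i; have [_ sj _ _ _] := PQ j; rewrite !inE si E sj.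
have sE : [set s i | i : 'I_k] = x |: S.
  apply/eqP; rewrite eqEcard; apply/andP; split.
    by apply/subsetP => _ /imsetP[i _ ->].
  rewrite card_imset // card_ord (leq_trans (leq_card_setU _ _)) //.
  by rewrite cards1.
exists s, Q; split=> //.
- by move=> i; have [] := PQ i.
- by move=> z; rewrite -sE => /imsetP[i _ ->]; exists i.
- by move=> i; split=> //; have [] := PQ i.
Qed.

End Goring.

Lemma menger (T : finType) (k : nat) (r : rel T) (A B : {set T}) :
  symmetric r ->
  (forall X : {set T}, #|X| < k -> exists a b,
     [/\ a \in A :\: X, b \in B :\: X & conn r (~: X) a b]) ->
  exists R : 'I_k -> {set T},
    [/\ forall i, connset r (R i),
        forall i, exists a b, [/\ a \in A, b \in B, a \in R i & b \in R i]
      & forall i j, i != j -> [disjoint R i & R j]].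
Proof.
have [n] := ubnP #|[pred p : T * T | r p.1 p.2]|.
elim: n r A B => // n IH r A B ltn r_sym sep.
case: (pickP [pred p : T * T | r p.1 p.2 && (p.1 != p.2)]) => [[x y]|noedge]; last first.
  have triv S u v : conn r S u v -> u = v.
    case/connectP=> p; elim: p u => [|w p IHp] u /= => [_ -> //|].
    case/andP=> /and3P[_ _ ruw] pp; have := noedge (u, w).
    by rewrite /= ruw /= => /negbFE/eqP E; rewrite E; apply: IHp.
  have kAB : k <= #|A :&: B|.
    rewrite leqNgt; apply/negP => /sep[a [b [aA bB /triv E]]].
    by move: aA bB; rewrite !inE -E; case: (a \in A); case: (a \in B).
  pose f (i : 'I_k) := enum_val (widen_ord kAB i).
  have fP i : f i \in A :&: B by apply: enum_valP.
  have fI : injective f by move=> i j /enum_val_inj/(congr1 val)/= /val_inj.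
  exists (fun i => [set f i]); split.
  - by move=> i; apply: connset1.
  - move=> i; exists (f i), (f i); have := fP i; rewrite !inE eqxx.
    by case/andP.
  - by move=> i j ij; rewrite disjoints1 inE (inj_eq fI).
rewrite /= => /andP[rxy nxy].
have ltn' u v : r u v -> #|[pred p : T * T | cut_rel r u v p.1 p.2]| < n.
  move=> ruv; rewrite ltnS in ltn; apply: leq_trans ltn; apply: proper_card.
  apply/properP; split; first by apply/subsetP => p; apply: cut_rel_sub.
  by exists (u, v) => //; rewrite !inE /cut_rel /= eqxx andbF.
have cS := cut_rel_sym r_sym.
(* Either the edge xy can be deleted without harm and induction applies, or some [S] with fewer than
   [k] vertices separates [A] from [B] in its absence. *)
have [sep'|] := EM (forall X : {set T}, #|X| < k -> exists a b,
     [/\ a \in A :\: X, b \in B :\: X & conn (cut_rel r x y) (~: X) a b]).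
  have [R [cR ABR dR]] := IH _ A B (ltn' x y rxy) (@cS x y) sep'.
  exists R; split=> // i u v uR vR.
  by apply: conn_sub (cR i u v uR vR) => //; apply: cut_rel_sub.
move=> /existsNP[S /not_implyP[ltSk nS]].
have nsep a b : a \in A :\: S -> b \in B :\: S -> ~~ conn (cut_rel r x y) (~: S) a b.
  by move=> aA bB; apply/negP => cab; apply: nS; exists a, b.
have [a [b [aA bB cab]]] := sep S ltSk.
(* A path that leaves the [A'] side of [q] must do so at [x] or [y], since every other edge of [r]
   is still in [q]. *)
have hit q A' a' b' : symmetric q -> subrel q r -> a' \in A' :\: S -> 
    (forall u v, r u v -> u != x -> u != y -> q u v) ->
    conn r (~: S) a' b' -> ~~ reach q A' S b' -> reach q A' S x || reach q A' S y.
  move=> qs qr aA' hq c; apply: contraR; rewrite negb_or => /andP[nx ny].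
  have : b' \in [set z | reach q A' S z].
    apply: (conn_closed _ _ c); last first.
      by rewrite inE; apply/exists_inP; exists a' => //; apply: connect0.
    move=> u v; rewrite !inE => ru uS vS ruv.
    have quv : q u v.
      by apply: hq => //; [apply: contraNneq nx => <-|apply: contraNneq ny => <-].
    case/exists_inP: ru => a0 a0A c0; apply/exists_inP; exists a0 => //.
    by apply: conn_trans c0 _; apply: conn1; rewrite ?inE.
  by rewrite inE.
have disj x0 y0 z : (forall u v, cut_rel r x0 y0 u v = cut_rel r x y u v) ->
    reach (cut_rel r x0 y0) A S z -> ~~ reach (cut_rel r x0 y0) B S z.
  move=> E /exists_inP[a0 a0A c1]; apply/negP => /exists_inP[b0 b0B c2].
  have /negP[] := nsep a0 b0 a0A b0B.
  apply: (@conn_sub _ (cut_rel r x0 y0) _ (~: S)) => //; first by move=> u v; rewrite E.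
  apply: conn_trans c1 _; rewrite conn_sym //; exact: cS.
have xyA : reach (cut_rel r x y) A S x || reach (cut_rel r x y) A S y.
  apply: (hit _ A a b) => //; [exact: cut_rel_sub|by move=> u v; apply: cut_relE|].
  apply: contraTN bB => /(disj x y _ (fun _ _ => erefl)); apply: contraNN => bB.
  by apply/exists_inP; exists b => //; apply: connect0.
have xyB : reach (cut_rel r x y) B S x || reach (cut_rel r x y) B S y.
  apply: (hit _ B b a) => //; [exact: cut_rel_sub|by move=> u v; apply: cut_relE| |].
    by rewrite conn_sym.
  apply: (disj x y a (fun _ _ => erefl)).
  by apply/exists_inP; exists a => //; apply: connect0.
(* The edge is oriented so that it leads from the [A] side of [S] to its [B] side. *)
have [x0 [y0 [rxy0 nxy0 E xA yB]]] : exists x0 y0, [/\ r x0 y0, x0 != y0,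
   forall u v, cut_rel r x0 y0 u v = cut_rel r x y u v,
   reach (cut_rel r x0 y0) A S x0 & reach (cut_rel r x0 y0) B S y0].
  have E : cut_rel r y x =2 cut_rel r x y by apply: cut_relC.
  have E' : cut_rel r y x = cut_rel r x y by apply/funext => u; apply/funext => v; apply: E.
  have dx := disj x y x (fun _ _ => erefl).
  have dy := disj x y y (fun _ _ => erefl).
  case: (boolP (reach (cut_rel r x y) A S x)) xyA => [xA _|_ /= yA].
    exists x, y; split=> //; move: xyB; by rewrite (negbTE (dx xA)).
  exists y, x; split; rewrite ?E' //; [by rewrite r_sym|by rewrite eq_sym|].
  by move: xyB; rewrite (negbTE (dy yA)) orbF.
have dj z := disj x0 y0 z E.
have nsep0 a' b' : a' \in A :\: S -> b' \in B :\: S -> ~~ conn (cut_rel r x0 y0) (~: S) a' b'.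
  move=> aA' bB'; apply: contra (nsep a' b' aA' bB').
  by apply: conn_sub => // u v; rewrite E.
have yA : ~~ reach (cut_rel r x0 y0) A S y0.
  by apply: contraTN yB => /dj.
have xB := dj _ xA.
have sepA := separator_extend sep nsep0 yA.
have sepB : forall X : {set T}, #|X| < k -> exists a b,
     [/\ a \in B :\: X, b \in (y0 |: S) :\: X & conn (cut_rel r y0 x0) (~: X) a b].
  have E' : cut_rel r y0 x0 = cut_rel r x0 y0.
    by apply/funext => u; apply/funext => v; apply: cut_relC.
  apply: (@separator_extend _ r B A); rewrite ?E' //.
  - move=> X /sep[a' [b' [aA' bB' c]]]; exists b', a'; split=> //.
    by rewrite conn_sym.
  - move=> b' a' bB' aA'; rewrite conn_sym; last exact: cS.
    exact: nsep0.
have [R1 [cR1 AR1 dR1]] := IH _ A (x0 |: S) (ltn' x0 y0 rxy0) (@cS x0 y0) sepA.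
have ryx0 : r y0 x0 by rewrite r_sym.
have [R2 [cR2 BR2 dR2]] := IH _ B (y0 |: S) (ltn' y0 x0 ryx0) (@cS y0 x0) sepB.
have [s1 [Q1 [P1 s1I s1S dQ1 Q1P]]] := trim_linkage r_sym ltSk cR1 AR1 dR1.
have [s2 [Q2 [P2 s2I s2S dQ2 Q2P]]] := trim_linkage r_sym ltSk cR2 BR2 dR2.
have xS := reach_notin xA; have yS := reach_notin yB.
(* The two linkages share the ends in [S]; the one ending at [x0] continues through the edge to the
   one starting at [y0]. *)
pose phi s := if s == x0 then y0 else s.
have phiS i : phi (s1 i) \in y0 |: S.
  have [] := Q1P i; rewrite /phi !inE; case: eqP => [_ _ _|_ /= -> _]; first by rewrite eqxx.
  by rewrite orbT.
have /fin_all_exists[j Pj] i := s2S _ (phiS i).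
have phiI i i' : phi (s1 i) = phi (s1 i') -> i = i'.
  have [+ _] := Q1P i; have [+ _] := Q1P i'; rewrite /phi !inE.
  case: eqP => [e1|n1] /=; case: eqP => [e2|n2] //= h1 h2.
  - by move=> _; apply: s1I; rewrite e1 e2.
  - by move=> e; case/negP: yS; rewrite -e.
  - by move=> e; case/negP: yS; rewrite e.
  - exact: s1I.
have E' : cut_rel r y0 x0 = cut_rel r x0 y0.
  by apply/funext => u; apply/funext => v; apply: cut_relC.
exists (fun i => Q1 i :|: Q2 (j i)); split.
- move=> i; have [s1Q cQ1 _] := P1 i; have [s2Q cQ2 _] := P2 (j i).
  apply: (@connsetU _ r r_sym _ _ (s1 i) (s2 (j i))) => //.
  + by move=> u v uQ vQ; apply: conn_sub (cQ1 u v uQ vQ) => //; apply: cut_rel_sub.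
  + by move=> u v uQ vQ; apply: conn_sub (cQ2 u v uQ vQ) => //; apply: cut_rel_sub.
  + by rewrite Pj /phi; have [->|_] := eqVneq (s1 i) x0; rewrite ?rxy0 ?orbT ?eqxx.
- move=> i; have [_ _ [a0 a0A a0Q]] := P1 i; have [_ _ [b0 b0B b0Q]] := P2 (j i).
  by exists a0, b0; rewrite !inE a0Q b0Q orbT.
(* A vertex common to the two linkages that is an inner vertex of both would lie on both sides of
   [S]; the remaining cases concern the ends. *)
have cross i i' : i != i' -> [disjoint Q1 i & Q2 (j i')].
  move=> ii'; apply/pred0P => z; apply/negbTE/negP => /= /andP[z1 z2].
  have [s1i z1P] := Q1P i; have [s2i z2P] := Q2P (j i').
  have [e1|n1] := eqVneq z (s1 i); have [e2|n2] := eqVneq z (s2 (j i')).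
  - move: e2; rewrite Pj e1 => e2; move: (ii'); rewrite -(inj_eq s1I).
    move: e2 s1i; rewrite /phi; case: eqP => [e3 e4|_ ->]; last by rewrite eqxx.
    by rewrite e4 !inE (negbTE yS) orbF eq_sym (negbTE nxy0).
  - have [zS zB] := z2P z z2 n2; move: s1i; rewrite -e1 !inE => /orP[/eqP zx|zS'].
      by move: zB; rewrite zx E' (negbTE xB).
    by move: zS; rewrite !inE zS' orbT.
  - have [zS zA] := z1P z z1 n1; move: s2i; rewrite -e2 !inE => /orP[/eqP zy|zS'].
      by move: zA; rewrite zy (negbTE yA).
    by move: zS; rewrite !inE zS' orbT.
  - have [_ zA] := z1P z z1 n1; have [_ ] := z2P z z2 n2.
    by rewrite E' (negbTE (dj _ zA)).
move=> i i' ii'; have ji : j i != j i'.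
  by apply: contra_neq ii' => e; apply: phiI; rewrite -!Pj e.
rewrite disjoints_subset; apply/subsetP => z; rewrite !inE negb_or => /orP[z1|z2].
  by rewrite (disjointFr (dQ1 _ _ ii') z1) (disjointFr (cross _ _ ii') z1).
rewrite (disjointFr (dQ2 _ _ ji) z2) andbT.
by rewrite eq_sym in ii'; rewrite (disjointFl (cross _ _ ii') z2).
Qed.

(** * Minors, degrees and robust connectivity *)

Section Minors.
Implicit Types G H K : sgraph.

Lemma connected_inE G (S : {set G}) :
  connected_in S <-> S != set0 /\ connset (@adj G) S.
Proof. by split=> -[S0 cS]; split=> // x y xS yS; apply: cS. Qed.

Lemma minor_trans H G K : is_minor H G -> is_minor G K -> is_minor H K.
Proof.
move=> [mu [muC muE] muD] [nu [nuC nuE] nuD].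
exists (fun v => \bigcup_(x in mu v) nu x); first split.
- move=> v; have /connected_inE[/set0Pn[x xv] cv] := muC v; apply/connected_inE; split.
    have /connected_inE[/set0Pn[y yx] _] := nuC x.
    by apply/set0Pn; exists y; apply/bigcupP; exists x.
  apply: (connset_bigcup cv).
  + by move=> i; have /connected_inE[] := nuC i.
  + by move=> i; have /connected_inE[] := nuC i.
  + by move=> i j _ _ /nuE.
- move=> u v /muE[x [y [xu yv /nuE[x' [y' [xx' yy' a]]]]]]; exists x', y'; split=> //.
    by apply/bigcupP; exists x.
  by apply/bigcupP; exists y.
move=> u v /muD d; rewrite disjoints_subset; apply/subsetP => z.
case/bigcupP=> x xu zx; rewrite inE; apply/bigcupP => -[y yv zy].
have xy : x != y by apply: contraTneq xu => ->; rewrite (disjointFl d yv).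
by have := disjointFr (nuD _ _ xy) zx; rewrite zy.
Qed.

Section Quotient.
Variables (G : sgraph) (I : finType) (B : I -> {set G}).

(** Adjacency after each [B i] is contracted and all other vertices are deleted; the test [i != j]
    removes loops. *)
Definition quot_adj : rel I :=
  fun i j => (i != j) && [exists x in B i, exists y in B j, adj x y].

Lemma quot_adj_sym : symmetric quot_adj.
Proof.
move=> i j; rewrite /quot_adj eq_sym; congr (_ && _).
by apply/idP/idP => /exists_inP[x xi /exists_inP[y yj a]];
  apply/exists_inP; exists y => //; apply/exists_inP; exists x; rewrite // adj_sym.
Qed.

Lemma quot_adj_irrefl : irreflexive quot_adj.
Proof. by move=> i; rewrite /quot_adj eqxx. Qed.

Definition quot := SGraph quot_adj_sym quot_adj_irrefl.

Lemma quot_adjI (i j : quot) x y :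
  i != j -> x \in B i -> y \in B j -> adj x y -> adj i j.
Proof.
move=> ij xi yj a; rewrite /adj /= /quot_adj ij.
by apply/exists_inP; exists x => //; apply/exists_inP; exists y.
Qed.

Lemma quot_minor : (forall i, connected_in (B i)) ->
  (forall i j, i != j -> [disjoint B i & B j]) -> is_minor quot G.
Proof.
move=> cB dB; exists B; last exact: dB; split=> // i j /andP[_].
by case/exists_inP=> x xi /exists_inP[y yj a]; exists x, y.
Qed.

End Quotient.

Lemma connected_in1 G (x : G) : connected_in [set x].
Proof.
apply/connected_inE; split; last exact: connset1.
by apply/set0Pn; exists x; rewrite set11.
Qed.

Lemma connected_in2 G (x y : G) : adj x y -> connected_in [set x; y].
Proof.
move=> a; apply/connected_inE; split.
  by apply/set0Pn; exists x; rewrite set21.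
apply: (connsetU (@adj_sym G) (x := x) (y := y)); rewrite ?set11 ?a ?orbT //; exact: connset1.
Qed.

End Minors.

Section Degrees.
Variable G : sgraph.
Implicit Types (U V X S : {set G}) (x y z : G).

Definition nbrs U x := [set y in U | adj x y].
(** Ordered pairs are counted: this is twice the number of edges of G[U], so the density of G[U] is
    [arcs U] divided by 2 |U|. *)
Definition arcs U := \sum_(x in U) #|nbrs U x|.
(** Together with [k.+2 <= #|U|] this is (k+1)-connectivity of G[U]; the size condition is kept
    apart because cliques of any size satisfy the definition. *)
Definition rconn U k := forall X, #|X| <= k -> connset (@adj G) (U :\: X).

Lemma arcs_sum U : arcs U = \sum_(x in U) \sum_(y in U) adj x y.
Proof.
apply: eq_bigr => x _; rewrite -sum1_card big_mkcond [RHS]big_mkcond /=.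
by apply: eq_bigr => y _; rewrite inE; case: (y \in U); case: adj.
Qed.

Lemma arcs_nedges : arcs setT = (2 * nedges G)%N.
Proof.
have -> : arcs setT = #|[set p : G * G | adj p.1 p.2]|.
  rewrite arcs_sum (eq_bigl xpredT) => [|x]; last by rewrite inE.
  rewrite (eq_bigr (fun x => \sum_y (adj x y : nat))) => [|x _]; last first.
    by apply: eq_bigl => y; rewrite inE.
  rewrite pair_big /= -sum1_card [RHS]big_mkcond /=.
  by apply: eq_bigr => p _; rewrite inE; case: adj.
rewrite -sum1_card (partition_big_imset (fun p => [set p.1; p.2])) /=.
have -> : [set [set p.1; p.2] | p in [set p : G * G | adj p.1 p.2]] = edges G.
  by apply/setP => e; apply/imsetP/imsetP => -[p]; rewrite ?inE => a ->; exists p; rewrite ?inE.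
rewrite (eq_bigr (fun _ => 2)) => [|e]; first by rewrite sum_nat_const mulnC.
case/imsetP=> -[x y]; rewrite inE /= => a ->.
have xy : x != y by apply: contraTneq a => ->; rewrite adj_irrefl.
rewrite sum1dep_card -[RHS](_ : #|[set (x, y); (y, x)]| = 2); last first.
  by rewrite cards2 xpair_eqE negb_and xy.
apply: eq_card => -[u v]; rewrite !inE /= !xpair_eqE.
apply/andP/orP => [[auv /eqP E]|[] /andP[/eqP-> /eqP->]]; last 2 first.
- by rewrite a eqxx.
- by rewrite adj_sym a setUC eqxx.
have uE : u \in [set x; y] by rewrite -E set21.
have vE : v \in [set x; y] by rewrite -E set22.
have uv : u != v by apply: contraTneq auv => ->; rewrite adj_irrefl.
move: uE vE uv; rewrite !inE.
by case/orP=> /eqP->; case/orP=> /eqP->; rewrite ?eqxx //; [left|right].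
Qed.

Lemma nbrsS U V x : U \subset V -> nbrs U x \subset nbrs V x.
Proof. by move/subsetP=> s; apply/subsetP => y; rewrite !inE => /andP[/s-> ->]. Qed.

Lemma arcs_le U : arcs U <= #|U| * #|U|.-1.
Proof.
rewrite -sum_nat_const; apply: leq_sum => x xU.
rewrite (cardsD1 x U) xU /=; apply: subset_leq_card; apply/subsetP => y.
by rewrite !inE => /andP[-> a]; rewrite andbT; apply: contraTneq a => ->; rewrite adj_irrefl.
Qed.

Lemma nbrs_le U x : #|nbrs U x| <= #|U|.
Proof. by apply: subset_leq_card; apply/subsetP => y; rewrite inE => /andP[]. Qed.

Lemma arcsD1 U x : x \in U -> arcs U = (arcs (U :\ x) + 2 * #|nbrs U x|)%N.
Proof.
move=> xU; have E1 : #|nbrs U x| = \sum_(y in U :\ x) adj y x.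
  rewrite -sum1_card big_mkcond [RHS]big_mkcond /=; apply: eq_bigr => y _.
  rewrite !inE (adj_sym y); have [->|] := eqVneq y x; first by rewrite adj_irrefl andbF.
  by case: (y \in U); case: adj.
have E2 : \sum_(y in U :\ x) #|nbrs U y| = (arcs (U :\ x) + #|nbrs U x|)%N.
  rewrite E1 -big_split /=; apply: eq_bigr => y yU.
  rewrite (cardsD1 x (nbrs U y)) inE xU /= addnC; congr (_ + _)%N.
  by apply: eq_card => z; rewrite !inE andbA.
by rewrite {1}/arcs (big_setD1 x) //= E2; lia.
Qed.

Lemma arcsU U S V : U \subset S :|: V ->
  (forall x y, x \in U -> y \in U -> adj x y -> (x \in S) && (y \in S) || (x \in V) && (y \in V)) ->
  arcs U <= arcs S + arcs V.
Proof.
move=> sU h; rewrite !arcs_sum.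
have ext W : \sum_(x in W) \sum_(y in W) adj x y
    = \sum_x \sum_y [&& x \in W, y \in W & adj x y].
  rewrite big_mkcond; apply: eq_bigr => x _; case: (x \in W); last by rewrite big1.
  by rewrite big_mkcond; apply: eq_bigr => y _; case: (y \in W).
rewrite !ext -big_split; apply: leq_sum => x _; rewrite -big_split; apply: leq_sum => y _ /=.
have := h x y; case: (x \in U) => //; case: (y \in U) => //; case: adj => // /(_ isT isT isT).
by case/orP=> /andP[-> ->] //; rewrite addn1.
Qed.

Lemma rconn_deg U k x : rconn U k -> k.+2 <= #|U| -> x \in U -> k < #|nbrs U x|.
Proof.
move=> rU kU xU; rewrite ltnNge; apply/negP => le.
have xN : x \notin nbrs U x by rewrite inE adj_irrefl andbF.
have [y yU yx] : exists2 y, y \in U :\: nbrs U x & y != x.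
  suff /set0Pn[y] : (U :\: nbrs U x) :\ x != set0.
    by rewrite in_setD1 => /andP[yx yU]; exists y.
  rewrite -card_gt0; have := cardsD1 x (U :\: nbrs U x).
  have := cardsID (nbrs U x) U; have : #|U :&: nbrs U x| <= #|nbrs U x|.
    exact/subset_leq_card/subsetIr.
  rewrite in_setD xN xU /=; lia.
have xU' : x \in U :\: nbrs U x by rewrite inE xN.
have := rU _ le x y xU' yU; move/(@conn_closed _ _ _ [set x]).
rewrite !inE (negbTE yx) eqxx => h; suff: false by []; apply: h => //.
move=> u v /set1P-> _; rewrite !inE => /andP[nv vU] a.
by move: nv; rewrite vU a.
Qed.

Fixpoint ball S x r : {set G} :=
  if r is r'.+1 then
    ball S x r' :|: [set y in S | [exists z in ball S x r', adj z y]]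
  else [set x].

Lemma ballS S x r : ball S x r \subset ball S x r.+1.
Proof. exact: subsetUl. Qed.

Lemma ball_mono S x r r' : r <= r' -> ball S x r \subset ball S x r'.
Proof.
by move/subnK <-; elim: (r' - r)%N => // n /subset_trans; apply; apply: ballS.
Qed.

Lemma ball_conn S x r y : x \in S -> y \in ball S x r -> exists I : {set G},
  [/\ I \subset S, connset (@adj G) I, x \in I, y \in I & #|I| <= r.+1].
Proof.
move=> xS; elim: r y => [|r IH] y /=.
  move=> /set1P->; exists [set x]; rewrite sub1set xS set11 cards1; split=> //.
  exact: connset1.
case/setUP=> [/IH[I [? ? ? ? le]]|]; first by exists I; split=> //; apply: leqW.
rewrite inE => /andP[yS /exists_inP[z /IH[I [IS cI xI zI le]] a]].
exists (I :|: [set y]); split.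
- by rewrite subUset IS sub1set.
- apply: (connsetU (@adj_sym G) (x := z) (y := y)) => //; rewrite ?set11 ?a ?orbT //.
  exact: connset1.
- by rewrite inE xI.
- by rewrite inE set11 orbT.
- by rewrite (leq_trans (leq_card_setU _ _)) // cards1 addn1.
Qed.

(** A vertex at distance 3j+2 from [x] has all its neighbours at distances 3j+1 to 3j+3, so every
    three layers gain at least [k] vertices until [S] is exhausted; this can happen at most [M]
    times. *)
Lemma short_conn S k M x y : connset (@adj G) S ->
  (forall z, z \in S -> k <= #|nbrs S z|) -> 0 < k -> #|S| <= M * k ->
  x \in S -> y \in S -> exists I : {set G},
  [/\ I \subset S, connset (@adj G) I, x \in I, y \in I & #|I| <= (3 * M).+1].
Proof.
move=> cS dS k0 SM xS yS.
have bS r : ball S x r \subset S.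
  elim: r => [|r IH] /=; first by rewrite sub1set.
  by rewrite subUset IH; apply/subsetP => z; rewrite inE => /andP[].
have closed r : ball S x r.+1 \subset ball S x r -> S \subset ball S x r.
  move=> c; apply/subsetP => z zS.
  apply: (conn_closed _ _ (cS x z xS zS)); last first.
    by apply: (subsetP (@ball_mono S x 0 r _)); rewrite //= set11.
  move=> u v uB uS vS a; apply: (subsetP c); rewrite /= !inE vS orbC /=.
  by apply/orP; left; apply/exists_inP; exists u.
suff h j : S \subset ball S x (3 * j) \/ (j * k).+1 <= #|ball S x (3 * j)|.
  apply: ball_conn => //; have [/subsetP->//|le] := h M.
  by have := subset_leq_card (bS (3 * M)%N); lia.
elim: j => [|j [IH|IH]]; first by right; rewrite muln0 cards1.
  by left; apply: subset_trans IH (ball_mono _ _ _); lia.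
have [c|/subsetPn[z zB zN]] := boolP (ball S x (3 * j).+2 \subset ball S x (3 * j).+1).
  by left; apply: subset_trans (closed _ c) (ball_mono _ _ _); lia.
right; have zS := subsetP (bS _) _ zB.
have E : (3 * j.+1 = (3 * j).+3)%N by lia.
have sub : nbrs S z \subset ball S x (3 * j.+1) :\: ball S x (3 * j).
  apply/subsetP => w; rewrite [w \in nbrs _ _]inE => /andP[wS a]; rewrite inE; apply/andP; split.
    apply: contra zN => wB; rewrite /= !inE zS /=; apply/orP; right.
    by apply/exists_inP; exists w; rewrite // adj_sym.
  rewrite E [ball S x _.+3]/= inE; apply/orP; right; rewrite inE wS.
  by apply/exists_inP; exists z.
have := subset_leq_card sub; have := dS z zS.
have s2 : ball S x (3 * j) \subset ball S x (3 * j.+1) by apply: ball_mono; lia.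
rewrite cardsD (setIidPr s2); have := subset_leq_card s2; lia.
Qed.

(** Deleting [X] with |X| <= k/2 leaves minimum degree at least k/2, which doubles [M] in
    [short_conn]. *)
Lemma rconn_short U k M X x y : rconn U k -> k.+2 <= #|U| -> 2 * #|X| <= k -> 0 < k ->
  #|U| <= M * k -> x \in U :\: X -> y \in U :\: X -> exists I : {set G},
  [/\ I \subset U :\: X, connset (@adj G) I, x \in I, y \in I & #|I| <= (6 * M).+1].
Proof.
move=> rU kU Xk k0 UM xU yU.
have -> : (6 * M = 3 * (2 * M))%N by lia.
apply: (@short_conn _ (k - #|X|)) => //.
- by apply: rU; lia.
- move=> z /setDP[zU zX]; have := rconn_deg rU kU zU.
  have : nbrs U z \subset nbrs (U :\: X) z :|: X.
    by apply/subsetP => w; rewrite !inE; case: (w \in X) => //= /andP[-> ->].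
  by move/subset_leq_card => + ; have := (leq_card_setU (nbrs (U :\: X) z) X).1; lia.
- lia.
- have : #|U :\: X| <= #|U| by apply/subset_leq_card/subsetDl.
  have : k <= 2 * (k - #|X|) by lia.
  nia.
Qed.

End Degrees.

(** * A random reserve of connectors *)

Section SecondMoment.
Local Open Scope ring_scope.
Variables (F : finType) (j : nat) (E : 'I_j -> {set F}).

Definition hits f := #|[set i | f \in E i]|.

Definition mean_hits : rat := (\sum_i #|E i|)%:R / #|F|%:R.

(** Chebyshev's inequality over a uniform finite space, cleared of denominators: pairwise
    independence bounds the variance by the mean, so a count below half the mean has probability at
    most 4 / mean. *)
Lemma second_moment : (0 < #|F|)%N ->
  (forall i k, i != k -> (#|E i :&: E k| * #|F| = #|E i| * #|E k|)%N) ->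
  #|[set f | (hits f)%:R *+ 2 < mean_hits]|%:R * mean_hits <= 4 * #|F|%:R.
Proof.
move=> F0 ind; rewrite /mean_hits; set mean : rat := _ / _; set N : rat := #|F|%:R.
have N0 : 0 < N by rewrite ltr0n.
have hitsE f : (hits f)%:R = \sum_i (f \in E i)%:R :> rat.
  by rewrite /hits -sum1dep_card natr_sum big_mkcond; apply: eq_bigr => i _; case: ifP.
have card_sum (A : {set F}) : \sum_f (f \in A)%:R = #|A|%:R :> rat.
  by rewrite -sum1_card natr_sum [RHS]big_mkcond; apply: eq_bigr => i _; case: ifP.
have mE : mean * N = \sum_i #|E i|%:R by rewrite /mean natr_sum divfK // gt_eqF.
have S1 : \sum_f (hits f)%:R = mean * N.
  rewrite mE (eq_bigr _ (fun f _ => hitsE f)) exchange_big /=.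
  by apply: eq_bigr => i _; apply: card_sum.
have S2 : \sum_f (hits f)%:R ^+ 2 <= mean * N + mean ^+ 2 * N.
  have -> : mean ^+ 2 * N = (\sum_i #|E i|%:R) * (\sum_i #|E i|%:R) / N.
    by rewrite -mE; field; rewrite gt_eqF.
  rewrite [X in _ <= X + _]mE big_distrl mulr_suml -big_split /=.
  rewrite (eq_bigr (fun f => \sum_i \sum_k (f \in E i :&: E k)%:R)) => [|f _]; last first.
    rewrite hitsE expr2 big_distrl; apply: eq_bigr => i _; rewrite big_distrr.
    by apply: eq_bigr => k _ /=; rewrite inE; case: (f \in E i); case: (f \in E k);
      rewrite /= ?mulr1 ?mulr0 ?mul0r.
  rewrite exchange_big; apply: ler_sum => i _ /=; rewrite exchange_big /=.
  rewrite (eq_bigr _ (fun k _ => card_sum _)) big_distrr mulr_suml (bigD1 i) //=.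
  rewrite setIid [X in _ <= _ + X](bigD1 i) //= addrA lerD //.
    by rewrite lerDl divr_ge0 ?mulr_ge0 // ltW.
  apply: ler_sum => k ki; rewrite ler_pdivlMr // /N -!natrM ler_nat ind //.
  by rewrite eq_sym.
have var : \sum_f ((hits f)%:R - mean) ^+ 2 <= mean * N.
  rewrite (eq_bigr (fun f => (hits f)%:R ^+ 2 - 2 * mean * (hits f)%:R + mean ^+ 2)) => [|f _]; last ring.
  rewrite big_split sumrB -big_distrr /= S1 sumr_const -mulr_natr -/N; lra.
have m0 : 0 <= mean by rewrite divr_ge0.
have [->|mn0] := eqVneq mean 0; first by rewrite mulr0 mulr_ge0 // ltW.
have mp : 0 < mean by rewrite lt0r mn0.
set A := [set f | _].
have : #|A|%:R * (mean ^+ 2 / 4) <= mean * N.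
  apply: le_trans var; rewrite (bigID (fun f => f \in A)) /=.
  rewrite -[X in X <= _]addr0 lerD ?sumr_ge0 // => [|f _]; last exact: sqr_ge0.
  rewrite mulr_natl -sumr_const; apply: ler_sum => f; rewrite inE => fA.
  have h0 : 0 <= (hits f)%:R :> rat by [].
  rewrite -sqrrN; nra.
have -> : #|A|%:R * (mean ^+ 2 / 4) = (#|A|%:R * mean / 4) * mean by field.
by rewrite (mulrC mean N) ler_pM2r // => h; lra.
Qed.

End SecondMoment.

Section RandomColour.
Variables (T : finType) (q : nat).
Local Notation F := {ffun T -> 'I_q.+1}.

(** For a uniform [f] this is a random set containing each point with probability 1 / (q+1). *)
Definition zeros (f : F) := [set x | f x == ord0].

Lemma card_zeros_sup (A : {set T}) :
  (#|[set f | A \subset zeros f]| * q.+1 ^ #|A| = #|F|)%N.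
Proof.
pose P x := if x \in A then pred1 (ord0 : 'I_q.+1) else predT.
have -> : #|[set f | A \subset zeros f]| = #|family P|.
  apply: eq_card => f; rewrite !inE; apply/subsetP/familyP => h x; last first.
    by move=> xA; have := h x; rewrite /P xA !inE.
  by rewrite /P; case: ifP => // /h; rewrite !inE.
rewrite card_family card_ffun card_ord foldrE big_map big_enum /=.
rewrite -[in RHS]prod_nat_const -[(q.+1 ^ #|A|)%N]prod_nat_const [X in (_ * X)%N]big_mkcond -big_split /=.
by apply: eq_bigr => x _; rewrite /P; case: (x \in A); rewrite ?card1 ?mul1n // cardT size_enum_ord muln1.
Qed.

Lemma sum_zeros : (\sum_(f : F) #|zeros f| * q.+1 = #|T| * #|F|)%N.
Proof.
rewrite (eq_bigr (fun f => \sum_x (x \in zeros f) * q.+1)) => [|f _]; last first.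
  rewrite -big_distrl /=; congr (_ * _)%N; rewrite -sum1_card big_mkcond /=.
  by apply: eq_bigr => x _; case: (x \in zeros f).
rewrite exchange_big /=; transitivity (\sum_(x : T) #|{: F}|); last by rewrite sum_nat_const.
apply: eq_bigr => x _.
rewrite -big_distrl -(card_zeros_sup [set x]) cards1 expn1 /=; congr (_ * _)%N.
rewrite -sum1_card big_mkcond [RHS]big_mkcond /=; apply: eq_bigr => f _.
by rewrite !inE sub1set inE; case: eqP.
Qed.

(** Disjoint sets fall inside [zeros f] independently, each with probability at least 1 / (q+1)^P.
    The mean count is thus at least j / (q+1)^P, and the failure rate is O(1/j). *)
Lemma few_bad_colours j P (c : 'I_j -> {set T}) :
  (forall i k, i != k -> [disjoint c i & c k]) -> (forall i, #|c i| <= P) ->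
  (#|[set f : F | 2 * #|[set i | c i \subset zeros f]| * q.+1 ^ P < j]| * j
     <= 4 * q.+1 ^ P * #|F|)%N.
Proof.
move=> dc cP; pose E i := [set f : F | c i \subset zeros f].
have F0 : 0 < #|F| by rewrite card_ffun card_ord expn_gt0.
have EE i : (#|E i| * q.+1 ^ #|c i|)%N = #|F| by apply: card_zeros_sup.
have hitsE f : hits E f = #|[set i | c i \subset zeros f]|.
  by apply: eq_card => i; rewrite !inE.
have /(_ F0) := @second_moment F j E.
move=> /= h; have {h}/h : forall i k, i != k -> (#|E i :&: E k| * #|F| = #|E i| * #|E k|)%N.
  move=> i k ik; have : (#|E i :&: E k| * q.+1 ^ (#|c i| + #|c k|))%N = #|F|.
    have -> : #|c i| + #|c k| = #|c i :|: c k| by rewrite cardsU disjoint_setI0 ?dc // cards0 subn0.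
    rewrite -(card_zeros_sup (c i :|: c k)); congr (_ * _)%N.
    by apply: eq_card => f; rewrite !inE subUset.
  have p0 : 0 < q.+1 ^ (#|c i| + #|c k|) by rewrite expn_gt0.
  by move=> E3; apply/eqP; rewrite -(eqn_pmul2r p0) mulnAC E3 expnD mulnACA !EE eqxx.
rewrite /mean_hits; set mean := (_ / _ : rat)%R => h.
have Fp : (0 < #|F|%:R :> rat)%R by rewrite ltr0n.
have mj : (j%:R <= mean * (q.+1 ^ P)%:R)%R.
  rewrite /mean mulrAC ler_pdivlMr // -!natrM ler_nat mulnC.
  rewrite -[X in (_ * X <= _)%N]card_ord mulnC -sum_nat_const big_distrl /=; apply: leq_sum => i _.
  by rewrite -(EE i) leq_mul2l leq_pexp2l ?orbT.
have m0 : (0 <= mean)%R by rewrite divr_ge0.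
set A := [set f | _]; set A' := [set f | _] in h.
have AA' : A \subset A'.
  apply/subsetP => f; rewrite !inE hitsE => hf.
  have p0 : (0 < (q.+1 ^ P)%:R :> rat)%R by rewrite ltr0n expn_gt0.
  rewrite -(ltr_pM2r p0); apply: lt_le_trans mj.
  by rewrite -mulr_natr -!natrM ltr_nat (mulnC _ 2).
rewrite -(ler_nat rat) !natrM.
have le1 : (#|A|%:R * j%:R <= #|A'|%:R * (mean * (q.+1 ^ P)%:R) :> rat)%R.
  by rewrite ler_pM // ler_nat subset_leq_card.
apply: le_trans le1 _; rewrite mulrA [X in (_ <= X)%R]mulrAC.
by rewrite ler_wpM2r.
Qed.

End RandomColour.

Definition attached (G : sgraph) (x : G) (I : {set G}) := [exists u in I, adj x u].

Lemma disjoint_card_bigcup (T : finType) (j P : nat) (c : 'I_j -> {set T}) :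
  (forall i, #|c i| <= P) -> #|\bigcup_i c i| <= j * P.
Proof.
move=> cP; apply: leq_trans (_ : \sum_(i < j) #|c i| <= _).
  elim/big_ind2: _ => [|A a B b hA hB|//]; first by rewrite cards0.
  exact: leq_trans (leq_card_setU _ _) (leq_add hA hB).
by apply: leq_trans (leq_sum _ (fun i _ => cP i)) _; rewrite sum_nat_const card_ord.
Qed.

(** Each of [x], [y] has more than [k] neighbours, hence one off [X], and these two are joined. The
    connector is only attached to [x] and [y], so the ends may themselves lie in [X]; [reroute]
    relies on this. *)
Lemma connector_step (G : sgraph) (U : {set G}) k M (X : {set G}) (x y : G) :
  rconn U k -> k.+2 <= #|U| -> #|U| <= M * k -> 0 < k -> 2 * #|X| <= k ->
  x \in U -> y \in U ->
  exists I : {set G}, [/\ connected_in I, I \subset U :\: X, #|I| <= (6 * M).+1,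
    attached x I & attached y I].
Proof.
move=> rU kU UM k0 Xk xU yU.
have nb z : z \in U -> exists2 u, u \in U :\: X & adj z u.
  move=> zU; have h := rconn_deg rU kU zU.
  suff /set0Pn[u] : nbrs U z :\: X != set0.
    by rewrite !inE => /and3P[uX uU a]; exists u; rewrite ?inE ?uX.
  rewrite -card_gt0; have := cardsID X (nbrs U z).
  have := subset_leq_card (subsetIr (nbrs U z) X); lia.
have [u uX xu] := nb x xU; have [w wX yw] := nb y yU.
have [I [IX cI uI wI le]] := rconn_short rU kU Xk k0 UM uX wX.
exists I; split=> //.
- by apply/connected_inE; split=> //; apply/set0Pn; exists u.
- by apply/exists_inP; exists u.
- by apply/exists_inP; exists w.
Qed.

Lemma many_connectors (G : sgraph) k M (x y : G) (j : nat) :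
  rconn [set: G] k -> k.+2 <= #|G| -> #|G| <= M * k -> 0 < k ->
  2 * (j * (6 * M).+1) <= k ->
  exists c : 'I_j -> {set G}, (forall i, [/\ connected_in (c i), #|c i| <= (6 * M).+1,
     attached x (c i) & attached y (c i)]) /\
   forall i i', i != i' -> [disjoint c i & c i'].
Proof.
move=> rG kG GM k0; elim: j => [|j IH] jk.
  by exists (fun _ => set0); split=> [[]|[]].
have [|c [cP cD]] := IH; first by move: jk; rewrite mulSn; lia.
pose X := \bigcup_i c i.
have X_le : #|X| <= j * (6 * M).+1 by apply: disjoint_card_bigcup => i; have [] := cP i.
have kG' : k.+2 <= #|[set: G]| by rewrite cardsT.
have GM' : #|[set: G]| <= M * k by rewrite cardsT.
have Xk : 2 * #|X| <= k by move: jk; rewrite mulSn; lia.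
have [I [cI IX le xI yI]] := connector_step rG kG' GM' k0 Xk (in_setT x) (in_setT y).
have dI i : [disjoint c i & I].
  rewrite disjoint_sym disjoints_subset (subset_trans IX) // setTD setCS.
  exact: bigcup_sup.
exists (fun i => if unlift ord_max i is Some i' then c i' else I); split.
  by move=> i; case: unliftP => [i' _|_] //; apply: cP.
move=> i i'; case: unliftP => [a ->|->]; case: unliftP => [b ->|->] //.
- by move=> ab; apply: cD; apply: contra_neq ab => ->.
- by rewrite disjoint_sym.
- by rewrite eqxx.
Qed.

Lemma exists_le_avg (F : finType) (g : F -> nat) (B : nat) :
  0 < #|F| -> \sum_f g f <= #|F| * B -> exists f, g f <= B.
Proof.
move=> F0 le; apply/existsP; apply: contraLR le; rewrite negb_exists -ltnNge => /forallP h.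
rewrite -sum_nat_const (eq_bigl predT) //.
have [f0 _] := card_gt0P F0.
rewrite (bigD1 f0) //= [X in _ < X](bigD1 f0) //= -addSn leq_add //.
  by rewrite ltnNge h.
by apply: leq_sum => f _; rewrite ltnW // ltnNge h.
Qed.

Lemma markov_card (T : finType) (g : T -> nat) (b : nat) :
  #|[set x | b < g x]| * b <= \sum_x g x.
Proof.
rewrite mulnC -[(b * _)%N]mulnC -sum_nat_const [X in _ <= X](bigID (mem [set x | b < g x])) /=.
apply: leq_trans (leq_addr _ _); apply: leq_sum => x; rewrite inE; exact: ltnW.
Qed.

Lemma sum_card_rel (T U : finType) (e : T -> U -> bool) :
  \sum_x #|[set y | e x y]| = \sum_y #|[set x | e x y]|.
Proof.
have E (A B : finType) (r : A -> B -> bool) x : #|[set y | r x y]| = \sum_y r x y.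
  by rewrite -sum1dep_card big_mkcond; apply: eq_bigr => y _; case: (r x y).
under eq_bigr do rewrite E; rewrite exchange_big.
by apply: eq_bigr => y _; rewrite (E _ _ (fun y x => e x y)).
Qed.

(* Random-like reserve: chance only controls almost all ordered pairs (x, h), so two arbitrary vertices
   x, y are joined through an intermediate h of the reserve for which (x, h) and (h, y) are both controlled. *)
Lemma reserve (M q : nat) : exists Pl th k0 : nat, forall (G : sgraph) (k : nat),
  k0 <= k -> #|G| <= M * k -> k.+2 <= #|G| -> rconn [set: G] k ->
  exists Z Bad : {set G}, [/\ q.+1 * #|Z| <= 2 * #|G|, q.+1 * #|Bad| <= #|G| &
    forall (X : {set G}) (x y : G), th * #|X| <= k -> x \notin Bad -> y \notin Bad -> x != y ->
    exists I : {set G}, [/\ connected_in I, I \subset Z :\: X, #|I| <= Pl,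
      attached x I & attached y I]].
Proof.
set P := (6 * M).+1; set Q := (q.+1 ^ P)%N.
have Q0 : 0 < Q by rewrite expn_gt0.
(* Both |G| and the number [j] of connectors per pair are proportional to [k]. A failure rate of 4 Q
   / j per pair therefore means on average at most [c2] bad partners per vertex, a constant. [Bq] is
   the threshold at which Markov's inequality confines the exceptional vertices to a fraction 1 /
   (q+1). *)
pose c2 := (4 * Q * (M * (8 * P)))%N; pose Bq := (4 * c2 * q.+1)%N.
exists (2 * P).+1, (64 * P * Q)%N, (8 * P * (4 * Q * (2 * Bq + 4)))%N.
move=> G k k0k GM kG rG; set n := #|G|.
have P0 : 0 < P by [].
pose j := (k %/ (4 * P))%N.
have jk : 2 * (j * P) <= k by have := leq_divM k (4 * P); rewrite -/j; nia.
have kj : k <= 8 * P * j.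
  have := ltn_ceil k (_ : 0 < 4 * P)%N; rewrite -/j => /(_ isT).
  have : 0 < j by rewrite divn_gt0 //; nia.
  nia.
have k0 : 0 < k by nia.
have jbig : 4 * Q * (2 * Bq + 4) <= j.
  rewrite leq_divRL //; apply: leq_trans k0k; nia.
have /fin_all_exists[c cP] x : exists cx : G -> 'I_j -> {set G}, forall y,
   (forall i, [/\ connected_in (cx y i), #|cx y i| <= P,
     attached x (cx y i) & attached y (cx y i)]) /\
   forall i i', i != i' -> [disjoint cx y i & cx y i'].
  have /fin_all_exists[cx cxP] y := many_connectors x y rG kG GM k0 jk.
  by exists cx.
pose F := {ffun G -> 'I_q.+1}.
pose S (f : F) x y := #|[set i | c x y i \subset zeros f]|.
pose bad (f : F) x y := 2 * S f x y * Q < j.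
pose nbad f := \sum_x #|[set y | bad f x y]|.
have F0 : 0 < #|F| by rewrite card_ffun card_ord expn_gt0.
have j0 : 0 < j by apply: leq_trans jbig; rewrite !muln_gt0 Q0 addnS.
have badF x y : #|[set f | bad f x y]| * j <= 4 * Q * #|F|.
  have [cxy dxy] := cP x y; apply: few_bad_colours => // i.
  by have [] := cxy i.
have nbad_sum : \sum_f nbad f <= n * (c2 * #|F|).
  rewrite -(leq_pmul2r j0) exchange_big /= big_distrl /=.
  have -> : n * (c2 * #|F|) * j = \sum_(x : G) c2 * #|F| * j.
    by rewrite sum_nat_const -/n !mulnA.
  apply: leq_sum => x _; rewrite (sum_card_rel (fun f y => bad f x y)) big_distrl /=.
  apply: leq_trans (leq_sum _ (fun y _ => badF x y)) _.
  rewrite sum_nat_const -/n; have h : n <= M * (8 * P) * j.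
    by rewrite -mulnA; apply: leq_trans GM _; rewrite leq_mul2l kj orbT.
  apply: leq_trans (leq_mul h (leqnn _)) _.
  by have -> : M * (8 * P) * j * (4 * Q * #|F|) = c2 * #|F| * j by rewrite /c2; ring.
(* Averaging the sum of two costs controls both at once: [nbad f] is at most 2 n c2 and (q+1) |zeros
   f| is at most 2 n. *)
have [f fP] : exists f, nbad f + c2 * (q.+1 * #|zeros f|) <= 2 * n * c2.
  apply: exists_le_avg => //; rewrite big_split /= -big_distrr /=.
  under [X in _ + _ * X]eq_bigr do rewrite mulnC.
  rewrite sum_zeros -/n -/F.
  have -> : #|F| * (2 * n * c2) = n * (c2 * #|F|) + c2 * (n * #|F|) by ring.
  by rewrite leq_add2r.
have c20 : 0 < c2 \/ M = 0 by rewrite /c2; case: (M) => [|m]; [right|left; rewrite !muln_gt0 Q0].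
have c2p : 0 < c2 by case: c20 => // M0; move: GM; rewrite M0; lia.
pose deg x := #|[set y | bad f x y]| + #|[set y | bad f y x]|.
pose Bad := [set x | Bq < deg x].
have degS : \sum_x deg x <= 4 * n * c2.
  rewrite big_split /= -[X in _ + X](sum_card_rel (bad f)) -/(nbad f); lia.
exists (zeros f), Bad; split.
- rewrite -(leq_pmul2l c2p); apply: leq_trans (leq_trans (leq_addl _ _) fP) _.
  by rewrite mulnC.
- have := leq_trans (markov_card deg Bq) degS; rewrite -/Bad /Bq.
  have -> : #|Bad| * (4 * c2 * q.+1) = 4 * c2 * (q.+1 * #|Bad|) by ring.
  have -> : 4 * n * c2 = 4 * c2 * n by ring.
  by rewrite leq_pmul2l //; lia.
move=> X x y Xk xB yB xy.
(* From th = 64 P Q and k <= 8 P j follows 8 Q |X| <= j; the additive constant comes from the choice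
   of the bound on [k]. *)
have goodS a b : ~~ bad f a b -> 2 * #|X| + (2 * Bq + 4) <= S f a b.
  rewrite /bad -leqNgt => h; rewrite -(leq_pmul2r Q0).
  have : 8 * Q * #|X| <= j.
    rewrite -(@leq_pmul2l (8 * P)) //; apply: leq_trans (leq_trans _ Xk) kj.
    by have -> : 8 * P * (8 * Q * #|X|) = 64 * P * Q * #|X| by ring.
  by move: jbig h; clear; lia.
have pick a b (X' : {set G}) : ~~ bad f a b -> #|X'| < S f a b ->
    exists i, c a b i \subset zeros f :\: X'.
  move=> gab lt; have [_ dab] := cP a b.
  have [i iS idj] : exists2 i, c a b i \subset zeros f & [disjoint c a b i & X'].
    apply/exists_inP; apply: contraLR lt; rewrite negb_exists_in => /forall_inP h.
    rewrite -leqNgt.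
    have /fin_all_exists[g gP] i : exists z, (c a b i \subset zeros f) -> z \in c a b i /\ z \in X'.
      have [si|] := boolP (c a b i \subset zeros f); last by exists x.
      have := h i si; rewrite -setI_eq0 => /set0Pn[z]; rewrite inE => /andP[z1 z2].
      by exists z.
    rewrite /S -(card_in_imset (f := g)); last first.
      move=> i i'; rewrite !inE => /gP[gi _] /gP[gi' _] E; apply/eqP; apply: contraT => /dab d.
      by have := disjointFr d gi; rewrite E gi'.
    apply: subset_leq_card; apply/subsetP => z /imsetP[i iS ->].
    by move: iS; rewrite inE => /gP[].
  by exists i; rewrite subsetD iS.
have degle a : a \notin Bad -> deg a <= Bq by rewrite inE -leqNgt.
have dx := degle _ xB; have dy := degle _ yB.
have nBq : 2 * Bq + 4 <= n.
  have jn : j <= n by have := leq_div k (4 * P); move: kG; rewrite -/j -/n; lia.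
  by apply: leq_trans (leq_trans _ jbig) jn; rewrite leq_pmull // muln_gt0.
have [h0 xh0] : exists h0, ~~ bad f x h0.
  apply/existsP; rewrite -negb_forall; apply: contraL nBq => /forallP h.
  rewrite -ltnNge /n -cardsT; apply: (@leq_ltn_trans Bq); last lia.
  apply: leq_trans dx; apply: leq_trans (leq_addr _ _).
  by apply: subset_leq_card; apply/subsetP => z; rewrite inE h.
(* Otherwise a controlled pair would have more disjoint connectors inside [zeros f] than there are
   vertices, hence one avoiding all of [zeros f], that is an empty one. *)
have Zbig : #|X| + 2 * Bq + 3 <= #|zeros f|.
  rewrite leqNgt; apply/negP => lt.
  have ltZ : #|zeros f| < S f x h0 by have := goodS _ _ xh0; lia.
  have [i] := pick x h0 (zeros f) xh0 ltZ; rewrite setDv subset0 => /eqP ci.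
  by have [/(_ i)[/connected_inE[]]] := cP x h0; rewrite ci eqxx.
have [h hZ [xh hy]] : exists2 h, h \in zeros f :\: X & ~~ bad f x h /\ ~~ bad f h y.
  pose N := X :|: [set h | bad f x h] :|: [set h | bad f h y].
  have N_le : #|N| < #|zeros f|.
    have := (leq_card_setU (X :|: [set h | bad f x h]) [set h | bad f h y]).1.
    have := (leq_card_setU X [set h | bad f x h]).1.
    move: dx dy; rewrite /deg -/N; lia.
  have /subsetPn[h hZ] : ~~ (zeros f \subset N).
    by apply: contraL N_le => /subset_leq_card; rewrite -leqNgt.
  rewrite !inE !negb_or => /andP[/andP[hX xh] hy]; exists h => //.
  by rewrite inE hX.
have ltX a b : ~~ bad f a b -> #|X| < S f a b by move/goodS; clear; lia.
have [i1 I1] := pick x h X xh (ltX _ _ xh).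
have [i2 I2] := pick h y X hy (ltX _ _ hy).
have [/(_ i1)[/connected_inE[_ c1] le1 a1 b1] _] := cP x h.
have [/(_ i2)[/connected_inE[_ c2'] le2 a2 b2] _] := cP h y.
have /exists_inP[u1 u1I h1] := b1; have /exists_inP[u2 u2I h2] := a2.
have cI1 : connset (@adj G) (c x h i1 :|: [set h]).
  apply: (connsetU (@adj_sym G) (x := u1) (y := h)) => //; rewrite ?set11 // 1?adj_sym ?h1 ?orbT //.
  exact: connset1.
have cI : connset (@adj G) (c x h i1 :|: [set h] :|: c h y i2).
  apply: (connsetU (@adj_sym G) (x := h) (y := u2)) => //; rewrite ?h2 ?orbT //.
  by rewrite !inE eqxx orbT.
exists (c x h i1 :|: [set h] :|: c h y i2); split.
- by apply/connected_inE; split=> //; apply/set0Pn; exists h; rewrite !inE eqxx orbT.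
- by rewrite !subUset I1 I2 sub1set hZ.
- have := (leq_card_setU (c x h i1 :|: [set h]) (c h y i2)).1.
  have := (leq_card_setU (c x h i1) [set h]).1; rewrite cards1; move: le1 le2; clear; lia.
- by case/exists_inP: a1 => u ui a; apply/exists_inP; exists u; rewrite // !inE ui.
- by case/exists_inP: b2 => u ui a; apply/exists_inP; exists u; rewrite // !inE ui orbT.
Qed.

(** * Blow-ups in dense graphs *)

Lemma pigeonhole (T U : finType) (A : {set T}) (P : {set U}) (f : T -> U) :
  (forall a, a \in A -> f a \in P) -> 0 < #|A| ->
  exists2 p, p \in P & #|A| <= #|P| * #|[set a in A | f a == p]|.
Proof.
move=> fP A0; apply/exists_inP; apply: contraT; rewrite negb_exists_in => /forall_inP h.
have [a aA] := card_gt0P A0; have P0 := fP a aA.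
have E : #|A| = \sum_(p in P) #|[set a in A | f a == p]|.
  rewrite -sum1_card (partition_big f (mem P)) //=; apply: eq_bigr => p _.
  by rewrite sum1dep_card; apply: eq_card => x; rewrite !inE.
have : #|P| * #|A| = \sum_(p in P) #|A| by rewrite sum_nat_const.
have : \sum_(p in P) #|P| * #|[set a in A | f a == p]| < \sum_(p in P) #|A|.
  rewrite (bigD1 (f a)) //= [X in _ < X](bigD1 (f a)) //= -addSn leq_add //.
    by rewrite ltnNge h.
  by apply: leq_sum => p /andP[pP _]; rewrite ltnW // ltnNge h.
rewrite -big_distrr /= -E => + e; rewrite -e; by rewrite ltnn.
Qed.

Lemma markov_lower (T : finType) (g : T -> nat) (A : {set T}) (b : nat) (M : nat) :
  (forall x, x \in A -> g x <= M) ->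
  \sum_(x in A) g x <= #|A| * b + M * #|[set x in A | b < g x]|.
Proof.
move=> gM; rewrite (bigID (fun x => b < g x)) /= addnC leq_add //.
  rewrite -sum_nat_const [X in _ <= X](bigID (fun x => b < g x)) /=.
  apply: leq_trans (leq_addl _ _); apply: leq_sum => x /andP[_]; by rewrite -leqNgt.
rewrite mulnC -sum_nat_const big_mkcond [X in _ <= X]big_mkcond /=; apply: leq_sum => x _.
by rewrite inE; case: ifP => // /andP[xA _]; apply: gM.
Qed.

Section KST.
Variable T : finType.
Implicit Types (U : {set T}).

Definition words U m : {set {ffun 'I_m -> T}} := [set f : {ffun 'I_m -> T} | [forall i, f i \in U]].

Lemma card_words U m : #|words U m| = (#|U| ^ m)%N.
Proof.
rewrite -[in RHS](card_ord m) -card_ffun_on; apply: eq_card => f.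
by rewrite !inE; apply/forallP/ffun_onP.
Qed.

Lemma wordsP U m (f : {ffun 'I_m -> T}) : reflect (forall i, f i \in U) (f \in words U m).
Proof. by rewrite inE; apply: forallP. Qed.

Definition wcons m x (g : {ffun 'I_m -> T}) : {ffun 'I_m.+1 -> T} :=
  [ffun i => if unlift ord0 i is Some j then g j else x].

Definition wtail m (f : {ffun 'I_m.+1 -> T}) : {ffun 'I_m -> T} := [ffun i => f (lift ord0 i)].

Lemma wcons0 m x (g : {ffun 'I_m -> T}) : wcons x g ord0 = x.
Proof. by rewrite ffunE unlift_none. Qed.

Lemma wconsS m x (g : {ffun 'I_m -> T}) i : wcons x g (lift ord0 i) = g i.
Proof. by rewrite ffunE liftK. Qed.

Lemma wcons_eta m (f : {ffun 'I_m.+1 -> T}) : wcons (f ord0) (wtail f) = f.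
Proof. by apply/ffunP => i; rewrite ffunE; case: unliftP => [j ->|->] //; rewrite ffunE. Qed.

Lemma wtail_cons m x (g : {ffun 'I_m -> T}) : wtail (wcons x g) = g.
Proof. by apply/ffunP => i; rewrite ffunE wconsS. Qed.

Lemma sum_wcons U m (A : {set {ffun 'I_m.+1 -> T}}) : A \subset words U m.+1 ->
  \sum_(x in U) #|[set g | wcons x g \in A]| = #|A|.
Proof.
move=> AU; rewrite -[RHS]sum1_card (partition_big (fun f : {ffun 'I_m.+1 -> T} => f ord0) (mem U)) /=; last first.
  by move=> f /(subsetP AU)/wordsP.
apply: eq_bigr => x _; rewrite sum1dep_card -(card_imset _ (can_inj (@wtail_cons m x))).
apply: eq_card => f; rewrite !inE; apply/imsetP/andP => [[g gA ->]|[fA /eqP <-]].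
  by rewrite inE in gA; rewrite gA wcons0.
by exists (wtail f); rewrite ?inE wcons_eta.
Qed.

End KST.

(* Erdos' theorem on complete m-partite subhypergraphs of dense m-uniform hypergraphs. *)
Lemma dense_words_box (m t c : nat) : 0 < t -> exists u1 : nat, forall (T : finType) (U : {set T})
    (A : {set {ffun 'I_m -> T}}),
  u1 <= #|U| -> A \subset words U m -> #|U| ^ m <= c * #|A| ->
  exists X : 'I_m -> {set T}, (forall i, #|X i| = t) /\
    forall f : {ffun 'I_m -> T}, (forall i, f i \in X i) -> f \in A.
Proof.
move=> t0; elim: m c => [|m IH] c.
  exists 0 => T U A _ _; rewrite expn0 => cA; exists (fun=> set0); split=> [[]//|f _].
  have /card_gt0P[g gA] : 0 < #|A| by case: #|A| cA => //; rewrite muln0.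
  by have -> // : f = g by apply/ffunP => -[].
(* Over [M] vertices whose links have density at least 1/(2c), a word lies in M/(2c) = 2t links on
   average. Words in fewer than [t] links account for at most half of this, so a fraction 1/(4c) of
   all words lies in at least [t]. *)
pose M := (4 * c * t)%N; have [u1 u1P] := IH (4 * c * 2 ^ M)%N.
exists (maxn u1 (2 * c * M + 1)) => T U A; rewrite geq_max => /andP[u1U uM] AU cA.
set u := #|U| in u1U uM cA *.
have u0 : 0 < u by lia.
pose At x := [set g | wcons x g \in A].
have AtU x : At x \subset words U m.
  apply/subsetP => g; rewrite inE => /(subsetP AU)/wordsP h; apply/wordsP => i.
  by rewrite -(wconsS x g).
have At_le x : #|At x| <= u ^ m by rewrite -card_words subset_leq_card.
pose H := [set x in U | u ^ m < (2 * c * #|At x|).+1].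
have H_big : u <= 2 * c * #|H|.
  have um0 : 0 < u ^ m by rewrite expn_gt0 u0.
  have : 2 * c * #|A| <= u * u ^ m + 2 * c * u ^ m * #|H|.
    rewrite -(sum_wcons AU) big_distrr /= (bigID (mem H)) /= addnC leq_add //.
      rewrite -sum_nat_const big_mkcond [X in _ <= X]big_mkcond; apply: leq_sum => x _.
      case: (x \in U) / boolP => //= xU; rewrite inE xU /= ltnS -ltnNge; case: ifP => // lt.
      exact: ltnW.
    rewrite [X in _ <= X]mulnC -sum_nat_const big_mkcond [X in _ <= X]big_mkcond; apply: leq_sum => x _.
    by case: ifP => [/andP[_ ->]|_] //; apply: leq_mul (leqnn _) (At_le x).
  move: cA; rewrite expnS => cA h.
  have h2 : u * u ^ m <= 2 * c * #|H| * u ^ m by move: cA h; clear; lia.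
  by rewrite -(leq_pmul2r um0).
have [c0|c0] := posnP c; first by move: H_big; rewrite c0; move: u0; clear; lia.
have MH : M <= #|H|.
  by rewrite -(@leq_pmul2l (2 * c)) ?muln_gt0 //; apply: leq_trans H_big; move: uM; clear; lia.
have [S SH SM] : exists2 S : {set T}, S \subset H & #|S| = M.
  exists [set x in take M (enum H)].
    by apply/subsetP => x; rewrite inE => /mem_take; rewrite mem_enum.
  rewrite cardsE (card_uniqP _) ?take_uniq ?enum_uniq // size_take -cardE.
  by case: ltngtP MH.
pose hit (g : {ffun 'I_m -> T}) := [set x in S | g \in At x].
have M0 : 0 < M by rewrite !muln_gt0 c0.
have hit_le g : #|hit g| <= M.
  by rewrite -SM subset_leq_card //; apply/subsetP => x; rewrite inE => /andP[].
have hit_sum : M * u ^ m <= 2 * c * \sum_(g in words U m) #|hit g|.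
  have -> : \sum_(g in words U m) #|hit g| = \sum_(x in S) #|At x|.
    have E g : #|hit g| = \sum_(x in S) (g \in At x).
      by rewrite -sum1dep_card big_mkcondr; apply: eq_bigr => x _; case: (g \in At x).
    rewrite (eq_bigr _ (fun g _ => E g)) exchange_big; apply: eq_bigr => x _ /=.
    rewrite -[RHS]sum1_card [RHS]big_mkcond [LHS]big_mkcond /=; apply: eq_bigr => g _.
    by have := subsetP (AtU x) g; case: (g \in At x) => [->|_] //; case: ifP.
  rewrite -SM -sum_nat_const big_distrr; apply: leq_sum => x /(subsetP SH).
  by rewrite inE => /andP[].
pose Good := [set g in words U m | t.-1 < #|hit g|].
have Good_big : u ^ m <= 4 * c * #|Good|.
  have := @markov_lower _ (fun g => #|hit g|) (words U m) t.-1 M (fun g _ => hit_le g).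
  rewrite card_words -/u -/Good => h.
  have h1 : M * u ^ m <= 2 * c * (u ^ m * t.-1 + M * #|Good|).
    by apply: leq_trans hit_sum _; rewrite leq_mul2l h orbT.
  have h2 : 2 * c * (u ^ m * t.-1) <= 2 * c * t * u ^ m.
    by rewrite -!mulnA (mulnC t) !leq_mul2l leq_pred !orbT.
  have ct0 : 0 < 2 * c * t by rewrite !muln_gt0 c0.
  rewrite -(leq_pmul2l ct0); move: h1 h2; rewrite /M; clear; lia.
have Good0 : 0 < #|Good|.
  have : 0 < u ^ m by rewrite expn_gt0 u0.
  by move/leq_trans/(_ Good_big); rewrite muln_gt0 => /andP[].
(* Words are classified by the exact subset of [S] whose links contain them: 2^M classes, whence the
   constant handed to the induction hypothesis. The subset of the chosen class supplies the first
   coordinate. *)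
have [|S' S'S fib] := @pigeonhole _ _ Good (powerset S) hit _ Good0.
  by move=> g _; rewrite inE; apply/subsetP => x; rewrite inE => /andP[].
set A' := [set g in Good | hit g == S'] in fib.
have [||X [X_t XA]] := u1P T U A' u1U.
- by apply/subsetP => g; rewrite !inE => /andP[/andP[]].
- rewrite card_powerset SM in fib.
  by apply: leq_trans Good_big _; rewrite -[X in _ <= X]mulnA leq_mul2l fib orbT.
have /card_gt0P[g0] : 0 < #|A'|.
  by move: (leq_trans Good0 fib); rewrite muln_gt0 => /andP[].
rewrite inE => /andP[]; rewrite inE => /andP[_ t1] /eqP hg0; rewrite hg0 in t1.
have tS : t <= #|S'| by rewrite -(prednK t0).
exists (fun i => if unlift ord0 i is Some j then X j else [set x in take t (enum S')]); split.
  move=> i; case: unliftP => [j _|_] //.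
  rewrite cardsE (card_uniqP _) ?take_uniq ?enum_uniq // size_take -cardE.
  by case: ltngtP tS.
move=> f fX; rewrite -(wcons_eta f).
have gA : wtail f \in A'.
  by apply: XA => i; have := fX (lift ord0 i); rewrite liftK ffunE.
have := fX ord0; rewrite unlift_none inE => /mem_take; rewrite mem_enum.
move: gA; rewrite inE => /andP[_ /eqP <-]; rewrite inE => /andP[_].
by rewrite inE.
Qed.

Section WordCounts.
Variables (T : finType) (U : {set T}) (m : nat).

Lemma card_box (P : 'I_m -> {set T}) :
  #|[set f : {ffun 'I_m -> T} | [forall i, f i \in P i]]| = \prod_i #|P i|.
Proof.
have -> : #|[set f : {ffun 'I_m -> T} | [forall i, f i \in P i]]| = #|family P|.
  by apply: eq_card => f; rewrite !inE.
by rewrite card_family foldrE big_map big_enum.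
Qed.

Lemma sum_words1 (i : 'I_m) (w : T -> nat) :
  (\sum_(f in words U m) w (f i)) * #|U| = (\sum_(a in U) w a) * #|U| ^ m.
Proof.
have box a : a \in U -> #|[set f in words U m | f i == a]| * #|U| = #|U| ^ m.
  move=> aU; pose P k := if k == i then [set a] else U.
  have -> : [set f in words U m | f i == a] = [set f : {ffun 'I_m -> T} | [forall k, f k \in P k]].
    apply/setP => f; rewrite !inE; apply/andP/forallP => [[/forallP h /eqP fi] k|h].
      by rewrite /P; case: eqP => [->|_] //; rewrite fi set11.
    have fi : f i == a by have := h i; rewrite /P eqxx inE.
    split=> //; apply/forallP => k; have := h k; rewrite /P; case: eqP => // _.
    by rewrite inE => /eqP->.
  rewrite card_box -[in RHS](card_ord m) -prod_nat_const (bigD1 i) //= [in RHS](bigD1 i) //=.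
  rewrite /P eqxx cards1 mul1n mulnC; congr (_ * _)%N; apply: eq_bigr => k ki.
  by rewrite (negbTE ki).
rewrite (partition_big (fun f : {ffun 'I_m -> T} => f i) (mem U)) /=; last by move=> f /wordsP.
rewrite !big_distrl /=; apply: eq_bigr => a aU; rewrite -(box a aU) mulnA; congr (_ * _)%N.
rewrite (eq_bigr (fun _ => w a)) => [|f /andP[_ /eqP->]] //.
rewrite sum_nat_cond_const mulnC; congr (_ * _)%N; by apply: eq_card => f; rewrite !inE.
Qed.

Lemma sum_words2 (i j : 'I_m) (e : T -> T -> bool) : i != j ->
  (\sum_(f in words U m) e (f i) (f j)) * #|U| ^ 2 =
  (\sum_(a in U) \sum_(b in U) e a b) * #|U| ^ m.
Proof.
move=> ij.
have box a : a \in U -> #|[set f in words U m | (f i == a) && e a (f j)]| * #|U| ^ 2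
    = (\sum_(b in U) e a b) * #|U| ^ m.
  move=> aU; pose P k := if k == i then [set a] else if k == j then [set b in U | e a b] else U.
  have -> : [set f in words U m | (f i == a) && e a (f j)]
      = [set f : {ffun 'I_m -> T} | [forall k, f k \in P k]].
    apply/setP => f; rewrite !inE; apply/andP/forallP => [[/forallP h /andP[/eqP fi fj]] k|h].
      rewrite /P; case: (eqVneq k i) => [->|_]; first by rewrite fi set11.
      by case: (eqVneq k j) => [->|_] //; rewrite inE h fj.
    have fi : f i == a by have := h i; rewrite /P eqxx inE.
    have := h j; rewrite {1}/P eq_sym (negbTE ij) eqxx inE => /andP[fjU fj].
    rewrite fi fj; split=> //; apply/forallP => k; have := h k; rewrite /P.
    case: (eqVneq k i) => [_|_]; first by rewrite inE => /eqP->.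
    by case: (eqVneq k j) => [->|_].
  have ji : j != i by rewrite eq_sym.
  have -> : \sum_(b in U) e a b = #|[set b in U | e a b]|.
    by rewrite -sum1dep_card big_mkcondr; apply: eq_bigr => b _; case: (e a b).
  rewrite card_box -[in RHS](card_ord m) -prod_nat_const (bigD1 i) //= (bigD1 j) //=.
  rewrite [in RHS](bigD1 i) //= [in RHS](bigD1 j) //=.
  rewrite /P eqxx (negbTE ji) eqxx cards1 mul1n.
  have -> : \prod_(k < m | (k != i) && (k != j)) #|if k == i then [set a] else
       if k == j then [set b in U | e a b] else U| = \prod_(k < m | (k != i) && (k != j)) #|U|.
    by apply: eq_bigr => k /andP[/negbTE-> /negbTE->].
  ring.
rewrite (partition_big (fun f : {ffun 'I_m -> T} => f i) (mem U)) /=; last by move=> f /wordsP.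
rewrite !big_distrl /=; apply: eq_bigr => a aU; rewrite -(box a aU); congr (_ * _)%N.
rewrite (eq_bigr (fun f : {ffun 'I_m -> T} => e a (f j) : nat)) => [|f /andP[_ /eqP->]] //.
rewrite -sum1dep_card big_mkcond [RHS]big_mkcond; apply: eq_bigr => f _ /=.
by case: (f \in words U m) => //=; case: (f i == a) => //=; case: (e a (f j)).
Qed.

End WordCounts.

Section Pull.
Variables (G : sgraph) (m : nat) (f : {ffun 'I_m -> G}).

(** Positions are the vertices, so [f] may repeat a letter; equal letters are nonadjacent. *)
Definition pull_adj : rel 'I_m := fun i j => adj (f i) (f j).

Lemma pull_adj_sym : symmetric pull_adj.
Proof. by move=> i j; apply: adj_sym. Qed.

Lemma pull_adj_irrefl : irreflexive pull_adj.
Proof. by move=> i; apply: adj_irrefl. Qed.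

Definition pull := SGraph pull_adj_sym pull_adj_irrefl.

End Pull.

(* The vertex sets of a blow-up of a graph on m vertices: all transversals have the same adjacencies. *)
Definition is_blowup (G : sgraph) (U : {set G}) (m t : nat) (f : {ffun 'I_m -> G})
    (X : 'I_m -> {set G}) :=
  [/\ forall i, #|X i| = t, forall i, X i \subset U,
      forall i j, i != j -> [disjoint X i & X j] &
      forall i j x y, x \in X i -> y \in X j -> adj (f i) (f j) -> adj x y].

Lemma arcs_pull (G : sgraph) m (f : {ffun 'I_m -> G}) :
  arcs [set: pull f] = \sum_i \sum_j adj (f i) (f j).
Proof.
rewrite arcs_sum (eq_bigl xpredT) => [|x]; last by rewrite inE.
by apply: eq_bigr => x _; apply: eq_bigl => y; rewrite inE.
Qed.

(** Divided by 2 m |U|^2, this says that the first-order loss of density caused by deleting the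
    letters of [f], namely the sum of their degrees over |U| minus m arcs(U) / (2 |U|^2), is at most
    the density of [pull f] plus 1. *)
Definition good_word (G : sgraph) (U : {set G}) m (f : {ffun 'I_m -> G}) :=
  2 * m * #|U| * \sum_i #|nbrs U (f i)| <=
  #|U| ^ 2 * arcs [set: pull f] + m ^ 2 * arcs U + 2 * m * #|U| ^ 2.

(** On average the inequality of [good_word] holds with m |U|^2 to spare. A bad word violates it,
    while a good one contributes at most 2 m^2 |U|^2 to the sum of the right-hand sides, so the good
    words cannot be too few. *)
Lemma many_good_words (G : sgraph) (U : {set G}) m : 0 < m -> 0 < #|U| ->
  #|U| ^ m <= 2 * m.+1 * #|[set f in words U m | good_word U f]|.
Proof.
move=> m0; set u := #|U| => u0; set W := words U m.
set A := [set f in W | good_word U f].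
have cW : #|W| = u ^ m by apply: card_words.
have um0 : 0 < u ^ m by rewrite expn_gt0 u0.
have Eu : arcs U <= u ^ 2.
  by apply: leq_trans (arcs_le U) _; rewrite expnS expn1 leq_mul2l leq_pred orbT.
pose a (f : {ffun 'I_m -> G}) := u ^ 2 * arcs [set: pull f] + m ^ 2 * arcs U.
pose b (f : {ffun 'I_m -> G}) := 2 * m * u * \sum_i #|nbrs U (f i)|.
have pull_le (f : {ffun 'I_m -> G}) : arcs [set: pull f] <= m * m.-1.
  by apply: leq_trans (arcs_le _) _; rewrite cardsT card_ord.
have sb : \sum_(f in W) b f = 2 * m * m * (arcs U * u ^ m).
  rewrite /b -big_distrr exchange_big /=.
  have -> : \sum_(i < m) \sum_(f in W) #|nbrs U (f i)| = \sum_(i < m) \sum_(f in W) #|nbrs U (f i)| by [].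
  rewrite -[2 * m * u * _]mulnA [u * _]mulnC big_distrl /=.
  rewrite (eq_bigr (fun _ => arcs U * u ^ m)) => [|i _]; last exact: (sum_words1 U i (fun x => #|nbrs U x|)).
  by rewrite sum_nat_const card_ord mulnA.
have sa : \sum_(f in W) a f = m * m.-1 * (arcs U * u ^ m) + m ^ 2 * (arcs U * u ^ m).
  rewrite /a big_split /= sum_nat_const cW; congr (_ + _)%N; last by ring.
  rewrite -big_distrr /=; under eq_bigr do rewrite arcs_pull.
  rewrite exchange_big /= big_distrr /=.
  have E (i : 'I_m) : u ^ 2 * \sum_(f in W) \sum_(j < m) adj (f i) (f j) = m.-1 * (arcs U * u ^ m).
    rewrite exchange_big /= mulnC big_distrl (bigD1 i) //= big1 ?mul0n ?add0n; last first.
      by move=> f _; rewrite adj_irrefl.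
    rewrite (eq_bigr (fun _ => arcs U * u ^ m)) => [|j ji]; last first.
      by rewrite sum_words2 1?eq_sym // arcs_sum.
    by rewrite sum_nat_cond_const (eq_card (B := predC1 i)) ?cardC1 ?card_ord // => j; rewrite !inE.
  by rewrite (eq_bigr _ (fun i _ => E i)) sum_nat_const card_ord mulnA.
have sab : \sum_(f in W) b f <= \sum_(f in W) a f + m * u ^ 2 * u ^ m.
  rewrite sa sb; have h : m * (arcs U * u ^ m) <= m * u ^ 2 * u ^ m.
    by rewrite -mulnA leq_mul2l leq_mul2r Eu !orbT.
  have -> : m * m.-1 * (arcs U * u ^ m) = m * m * (arcs U * u ^ m) - m * (arcs U * u ^ m).
    by rewrite -mulnBl -[m.-1]subn1 mulnBr muln1.
  have : m * (arcs U * u ^ m) <= m * m * (arcs U * u ^ m) by rewrite -mulnA leq_pmull.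
  move: h; have -> : m ^ 2 = m * m by rewrite expnS expn1.
  by set Z := arcs U * u ^ m; set Y := m * u ^ 2 * u ^ m; clear; lia.
have low : \sum_(f in W :\: A) a f + 2 * m * u ^ 2 * #|W :\: A| <= \sum_(f in W) b f.
  rewrite mulnC -sum_nat_const -big_split /= [X in _ <= X](big_setID A) /=.
  apply: leq_trans (leq_addl _ _); apply: leq_sum => f /setDP[fW].
  by rewrite inE fW /= /good_word -ltnNge => /ltnW.
have aA : \sum_(f in A) a f <= 2 * m ^ 2 * u ^ 2 * #|A|.
  rewrite mulnC -sum_nat_const; apply: leq_sum => f _; rewrite /a.
  have h1 : u ^ 2 * arcs [set: pull f] <= u ^ 2 * m ^ 2.
    rewrite leq_mul2l; apply/orP; right; apply: leq_trans (pull_le f) _.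
    by rewrite expnS expn1 leq_mul2l leq_pred orbT.
  have h2 : m ^ 2 * arcs U <= m ^ 2 * u ^ 2 by rewrite leq_mul2l Eu orbT.
  by move: h1 h2; rewrite (mulnC (u ^ 2) (m ^ 2)) -[2 * _ * _]mulnA mul2n -addnn; lia.
have AW : A \subset W by apply/subsetP => f; rewrite inE => /andP[].
have splitW : \sum_(f in W) a f = \sum_(f in A) a f + \sum_(f in W :\: A) a f.
  by rewrite (big_setID A) /= (setIidPr AW).
have cD : #|W :\: A| + #|A| = u ^ m by rewrite -cW -(cardsID A W) (setIidPr AW) addnC.
have mu0 : 0 < m * u ^ 2 by rewrite muln_gt0 m0 expn_gt0 u0.
rewrite -(leq_pmul2l mu0).
have h3 : 2 * m * u ^ 2 * #|W :\: A| <= 2 * m ^ 2 * u ^ 2 * #|A| + m * u ^ 2 * u ^ m.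
  by move: low sab aA splitW; clear; lia.
have h4 : 2 * m * u ^ 2 * #|W :\: A| + 2 * m * u ^ 2 * #|A| = 2 * (m * u ^ 2 * u ^ m).
  by rewrite -mulnDr cD; ring.
have -> : m * u ^ 2 * (2 * m.+1 * #|A|) = 2 * m ^ 2 * u ^ 2 * #|A| + 2 * m * u ^ 2 * #|A| by ring.
by move: h3 h4; clear; lia.
Qed.

Lemma few_noninjective (T : finType) (U : {set T}) m :
  #|[set f in words U m | ~~ injectiveb f]| * #|U| <= m ^ 2 * #|U| ^ m.
Proof.
have [u0|u0] := posnP #|U|; first by rewrite u0 muln0.
pose N := [set f in words U m | ~~ injectiveb f].
have le : #|N| <= \sum_(i < m) \sum_(j < m | i != j) \sum_(f in words U m) (f i == f j).
  rewrite (eq_bigr (fun i => \sum_(f in words U m) \sum_(j < m | i != j) (f i == f j))); last first.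
    by move=> i _; rewrite exchange_big.
  rewrite exchange_big /= -sum1dep_card big_mkcondr; apply: leq_sum => f fW.
  case: ifP => // /injectivePn[i [j ij fij]].
  by rewrite (bigD1 i) //= (bigD1 j) //= fij eqxx.
rewrite -(leq_pmul2r u0) -mulnA; apply: leq_trans (leq_mul le (leqnn _)) _.
have E (i j : 'I_m) : i != j ->
    (\sum_(f in words U m) (f i == f j)) * (#|U| * #|U|) = #|U| * #|U| ^ m.
  move=> ij; have := sum_words2 U (fun a b => a == b) ij; rewrite expnS expn1 => ->.
  congr (_ * _)%N; rewrite -sum1_card; apply: eq_bigr => a aU.
  by rewrite (bigD1 a) //= eqxx big1 // => b /andP[_]; rewrite eq_sym => /negbTE->.
rewrite big_distrl /=; apply: (@leq_trans (\sum_(i < m) m * (#|U| * #|U| ^ m))).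
  apply: leq_sum => i _; rewrite big_distrl /=.
  rewrite (eq_bigr (fun _ => #|U| * #|U| ^ m)) => [|j /E] //.
  rewrite sum_nat_cond_const leq_mul2r; apply/orP; right.
  by apply: leq_trans (max_card _) _; rewrite card_ord.
by rewrite sum_nat_const card_ord; apply: eq_leq; ring.
Qed.

(** Among good injective words, one of the 2^(m*m) adjacency types is taken by a positive fraction,
    and a box all of whose transversals have that type is a blow-up. The classes are disjoint
    because every transversal is injective. *)
Lemma blowup_exists (m t : nat) : 0 < m -> 0 < t -> exists u1 : nat,
  forall (G : sgraph) (U : {set G}), u1 <= #|U| ->
  exists (f : {ffun 'I_m -> G}) (X : 'I_m -> {set G}), is_blowup U t f X /\
    2 * m * #|U| * (\sum_i \sum_(x in X i) #|nbrs U x|) <=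
    t * (#|U| ^ 2 * arcs [set: pull f] + m ^ 2 * arcs U + 2 * m * #|U| ^ 2).
Proof.
move=> m0 t0; pose c := (4 * m.+1 * 2 ^ (m * m))%N.
have [u1 u1P] := dense_words_box m c t0.
exists (maxn u1 (4 * m.+1 * m ^ 2 + 1)) => G U; rewrite geq_max => /andP[u1U uM].
have u0 : 0 < #|U| by lia.
pose A := [set f in words U m | good_word U f].
pose A1 := [set f in A | injectiveb f].
have A1_big : #|U| ^ m <= 4 * m.+1 * #|A1|.
  have h1 := many_good_words m0 u0; rewrite -/A in h1.
  have h2 := few_noninjective U m.
  have h3 : #|A| <= #|A1| + #|[set f in words U m | ~~ injectiveb f]|.
    rewrite -(cardsID A1 A) leq_add // subset_leq_card ?subsetIr //.
    apply/subsetP => f /setDP[fA fA1]; have ninj : ~~ injectiveb f.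
      by apply: contra fA1 => fi; move: fA; rewrite !inE fi andbT.
    by move: fA; rewrite !inE ninj => /andP[->].
  rewrite -(leq_pmul2r u0).
  set N := #|[set _ in _ | ~~ _]| in h2 h3.
  have h4 : 4 * m.+1 * (N * #|U|) <= #|U| ^ m * #|U|.
    apply: (@leq_trans (4 * m.+1 * (m ^ 2 * #|U| ^ m))); first by rewrite leq_mul2l h2 orbT.
    by rewrite mulnA mulnC leq_mul2l; apply/orP; right; lia.
  have h5 : #|U| ^ m * #|U| <= 2 * m.+1 * ((#|A1| + N) * #|U|).
    rewrite mulnA leq_mul2r; apply/orP; right; apply: leq_trans h1 _.
    by rewrite leq_mul2l h3 orbT.
  move: h4 h5; clear; set x := #|A1| * #|U|; rewrite mulnDl -/x -!mulnA -/x.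
  set y := N * #|U|; set z := #|U| ^ m * #|U|; rewrite !mulSn !mulnDr; lia.
have A10 : 0 < #|A1|.
  have : 0 < #|U| ^ m by rewrite expn_gt0 u0.
  by move/leq_trans/(_ A1_big); rewrite muln_gt0 => /andP[].
pose ty (f : {ffun 'I_m -> G}) := [set p : 'I_m * 'I_m | adj (f p.1) (f p.2)].
have [//|q _ fib] := @pigeonhole _ _ A1 [set: {set 'I_m * 'I_m}] ty _ A10.
rewrite -powersetT card_powerset cardsT card_prod !card_ord in fib.
set A2 := [set f in A1 | ty f == q] in fib.
have A2W : A2 \subset words U m.
  by apply/subsetP => f; rewrite !inE => /andP[/andP[/andP[]]].
have [|X [Xt XA]] := u1P G U A2 u1U A2W.
  by apply: leq_trans A1_big _; rewrite /c -[X in _ <= X]mulnA leq_mul2l fib orbT.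
have Xne i : exists x, x \in X i by apply/set0Pn; rewrite -card_gt0 Xt.
have /fin_all_exists[d dX] := Xne.
pose f := [ffun i => d i] : {ffun 'I_m -> G}.
have fA : f \in A2 by apply: XA => i; rewrite ffunE.
have through i j x y : i != j -> x \in X i -> y \in X j ->
    exists2 g, g \in A2 & g i = x /\ g j = y.
  move=> ij xi yj; exists [ffun k => if k == i then x else if k == j then y else d k].
    apply: XA => k; rewrite ffunE; case: (eqVneq k i) => [->|_] //.
    by case: (eqVneq k j) => [->|_].
  by rewrite !ffunE eqxx eq_sym (negbTE ij) eqxx.
have tyP g : g \in A2 -> forall i j, adj (g i) (g j) = adj (f i) (f j).
  move=> gA i j; have E : ty g = ty f.
    by move: gA fA; rewrite !inE => /andP[_ /eqP->] /andP[_ /eqP->].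
  by have := congr1 (fun S : {set 'I_m * 'I_m} => (i, j) \in S) E; rewrite !inE.
exists f, X; split; first split=> //.
- move=> i; apply/subsetP => x xi.
  have gA : [ffun k => if k == i then x else d k] \in A2.
    by apply: XA => k; rewrite ffunE; case: (eqVneq k i) => [->|_].
  by have /wordsP/(_ i) := subsetP A2W _ gA; rewrite ffunE eqxx.
- move=> i j ij; rewrite disjoints_subset; apply/subsetP => x xi; rewrite inE.
  apply/negP => xj; have [g + [gi gj]] := through i j x x ij xi xj.
  rewrite !inE => /andP[/andP[_ /injectiveP gI] _].
  by have := gI i j; rewrite gi gj => /(_ erefl) e; rewrite e eqxx in ij.
- move=> i j x y xi yj; have [<-|ij] := eqVneq i j; first by rewrite adj_irrefl.
  by have [g gA [gi gj]] := through i j x y ij xi yj; rewrite -(tyP g gA) gi gj.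
(* The box is cut into [t] disjoint transversals; each is a good word of the same type, and their
   [t] inequalities are added. *)
pose T (k : 'I_t) : {ffun 'I_m -> G} := [ffun i => nth (d i) (enum (X i)) k].
have TA k : T k \in A2.
  by apply: XA => i; rewrite ffunE -mem_enum mem_nth // -cardE Xt.
have -> : \sum_i \sum_(x in X i) #|nbrs U x| = \sum_(k < t) \sum_i #|nbrs U (T k i)|.
  rewrite exchange_big /=; apply: eq_bigr => i _.
  rewrite -big_enum (big_nth (d i)) -cardE Xt big_mkord; apply: eq_bigr => k _.
  by rewrite ffunE.
rewrite big_distrr /= -[X in X * (_ + _)](card_ord t) -sum_nat_const.
apply: leq_sum => k _; have := TA k.
rewrite 3!inE => /andP[/andP[/andP[_ gd] _] _].
move: gd; rewrite /good_word !arcs_pull.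
have -> : \sum_i \sum_j adj (T k i) (T k j) = \sum_i \sum_j adj (f i) (f j).
  by apply: eq_bigr => i _; apply: eq_bigr => j _; rewrite (tyP _ (TA k)).
by [].
Qed.

Lemma arcsD (G : sgraph) (U B : {set G}) :
  arcs U <= arcs (U :\: B) + 2 * \sum_(x in B) #|nbrs U x|.
Proof.
have sB : \sum_(x in B) #|nbrs U x| = \sum_(x in B) \sum_(y in U) adj x y.
  apply: eq_bigr => x _; rewrite -sum1_card big_mkcond [RHS]big_mkcond /=.
  by apply: eq_bigr => y _; rewrite inE; case: (y \in U); case: adj.
rewrite sB arcs_sum [X in X <= _](big_setID B) /= mul2n -addnn addnCA leq_add //.
  rewrite big_mkcond [X in _ <= X]big_mkcond; apply: leq_sum => x _ /=.
  by rewrite inE andbC; case: (x \in B) => //=; case: (x \in U).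
rewrite arcs_sum.
have -> : \sum_(x in B) \sum_(y in U) adj x y = \sum_(x in U) \sum_(y in B) adj x y.
  by rewrite exchange_big; apply: eq_bigr => x _; apply: eq_bigr => y _; rewrite adj_sym.
apply: (@leq_trans (\sum_(x in U :\: B) \sum_(y in U :\: B) adj x y
   + \sum_(x in U :\: B) \sum_(y in B) adj x y)).
  rewrite -big_split /=; apply: leq_sum => x _; rewrite (big_setID B) /= addnC leq_add //.
  rewrite big_mkcond [X in _ <= X]big_mkcond; apply: leq_sum => y _ /=.
  by rewrite inE andbC; case: (y \in B) => //=; case: (y \in U).
rewrite leq_add // big_mkcond [X in _ <= X]big_mkcond; apply: leq_sum => y _ /=.
by rewrite inE; case: (y \in B) => //=; case: (y \in U).
Qed.

(** * Packing models of J *)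

Section Packs.
Variable J : sgraph.

(** Disjointness is required between any two branch sets, also of the same copy, so this says that
    G[U] contains [p] disjoint copies of [J] as a minor. *)
Definition packs (G : sgraph) (U : {set G}) (p : nat) :=
  exists nu : 'I_p -> J -> {set G},
    [/\ forall i, jumbled_model (nu i), forall i v, nu i v \subset U
      & forall i v j w, (i, v) != (j, w) -> [disjoint nu i v & nu j w]].

Lemma packs_fin (G : sgraph) (U : {set G}) (T : finType) (nu : T -> J -> {set G}) :
  (forall i, jumbled_model (nu i)) -> (forall i v, nu i v \subset U) ->
  (forall i v j w, (i, v) != (j, w) -> [disjoint nu i v & nu j w]) ->
  packs U #|T|.
Proof.
move=> h1 h2 h3; exists (fun i => nu (enum_val i)); split=> // i v j w ij.
by apply: h3; move: ij; rewrite !xpair_eqE (inj_eq enum_val_inj).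
Qed.

Lemma packs_le (G : sgraph) (U V : {set G}) p q :
  q <= p -> U \subset V -> packs U p -> packs V q.
Proof.
move=> qp UV [nu [h1 h2 h3]]; exists (fun i => nu (widen_ord qp i)); split=> //.
  by move=> i v; apply: subset_trans UV.
by move=> i v j w ij; apply: h3; move: ij; rewrite !xpair_eqE.
Qed.

Lemma packs0 (G : sgraph) (U : {set G}) : packs U 0.
Proof. by exists (fun _ _ => set0); split=> [[]|[]|[]]. Qed.

Lemma packsD (G : sgraph) (U V : {set G}) p q : [disjoint U & V] ->
  packs U p -> packs V q -> packs (U :|: V) (p + q).
Proof.
move=> dUV [nu [h1 h2 h3]] [nu' [h1' h2' h3']].
have -> : p + q = #|{: 'I_p + 'I_q}| by rewrite card_sum !card_ord.
pose mu (s : 'I_p + 'I_q) := match s with inl i => nu i | inr i => nu' i end.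
have muU s v : mu s v \subset (if s is inl _ then U else V) by case: s => i; [apply: h2|apply: h2'].
apply: (@packs_fin _ _ _ mu).
- by case.
- move=> s v; apply: subset_trans (muU s v) _; case: s => _; [exact: subsetUl|exact: subsetUr].
move=> [i|i] v [j|j] w ij.
- by apply: h3.
- exact: disjointWl (h2 _ _) (disjointWr (h2' _ _) dUV).
- by rewrite disjoint_sym; apply: disjointWl (h2 _ _) (disjointWr (h2' _ _) dUV).
- by apply: h3'.
Qed.

Lemma packs_big (G : sgraph) s (V : 'I_s -> {set G}) (p : 'I_s -> nat) :
  (forall i j, i != j -> [disjoint V i & V j]) -> (forall i, packs (V i) (p i)) ->
  packs (\bigcup_i V i) (\sum_i p i).
Proof.
elim: s V p => [|s IH] V p dV pV; first by rewrite !big_ord0; apply: packs0.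
rewrite !big_ord_recl; apply: packsD => //; last first.
  by apply: IH => // i j ij; apply: dV; rewrite (inj_eq lift_inj).
apply/bigcup_disjointP => i _.
by rewrite disjoint_sym; apply: dV; rewrite eq_sym neq_lift.
Qed.

(** Each occurrence of a vertex [i] in branch set [v] of a copy [p] is a slot. A vertex has at most
    [t] slots, so each slot gets its own vertex of [X i]. Slots are indexed by [v] as well, and this
    is what turns overlapping branch sets of a jumbled model into disjoint ones. *)
Lemma blowup_packs (G : sgraph) (U : {set G}) m t (f : {ffun 'I_m -> G}) (X : 'I_m -> {set G})
    (k : {ffun J -> {set pull f}} -> nat) :
  0 < m -> 0 < t -> is_blowup U t f X ->
  (forall g, 0 < k g -> jumbled_model g) ->
  (forall i : pull f, \sum_g k g * multiplicity g i <= t) ->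
  packs (\bigcup_i X i) (\sum_g k g).
Proof.
move=> m0 t0 [Xt XU Xd Xadj] kJ kt.
pose T := {g : {ffun J -> {set pull f}} & 'I_(k g)}.
have -> : \sum_g k g = #|{: T}|.
  rewrite card_tagged sumnE big_map big_enum /=; apply: eq_bigr => g _.
  by rewrite card_ord.
pose slots (i : pull f) := [set s : T * J | i \in tag s.1 s.2].
have slots_le (i : pull f) : #|slots i| <= t.
  apply: leq_trans (kt i); rewrite -sum1dep_card.
  rewrite -(pair_big_dep xpredT (fun (p : T) (v : J) => i \in tag p v) (fun _ _ => 1)) /=.
  rewrite (eq_bigr (fun p : T => multiplicity (tag p) i)) => [|p _]; last first.
    by rewrite sum1dep_card.
  rewrite -(sig_big_dep xpredT (fun _ _ => true) (fun (g : {ffun J -> {set pull f}}) (_ : 'I_(k g)) => multiplicity g i)) /=.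
  by apply: leq_sum => g _; rewrite sum_nat_const card_ord.
have /fin_all_exists[d dX] i : exists x, x \in X i by apply/set0Pn; rewrite -card_gt0 Xt.
pose w (i : 'I_m) (s : T * J) := nth (d i) (enum (X i)) (index s (enum (slots i))).
have idx (i : pull f) s : s \in slots i -> index s (enum (slots i)) < size (enum (X i)).
  by move=> si; rewrite -cardE Xt; apply: leq_trans (slots_le i); rewrite cardE index_mem mem_enum.
have wX (i : pull f) s : s \in slots i -> w i s \in X i.
  by move=> si; rewrite -mem_enum mem_nth // idx.
have wI (i : pull f) s s' : s \in slots i -> s' \in slots i -> w i s = w i s' -> s = s'.
  move=> si s'i /eqP; rewrite nth_uniq ?enum_uniq ?idx // => /eqP E.
  by rewrite -(@nth_index _ s s (enum (slots i))) ?mem_enum // E nth_index // mem_enum.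
pose nu (p : T) (v : J) := \bigcup_(i in tag p v) [set w i (p, v)].
have nuP (p : T) (v : J) x : reflect (exists2 i : pull f, i \in tag p v & x = w i (p, v)) (x \in nu p v).
  by apply: (iffP bigcupP) => -[i iv xE]; exists i => //; [apply/set1P|rewrite xE set11].
have slotE (p : T) (v : J) (i : pull f) : i \in tag p v -> (p, v) \in slots i by rewrite inE.
have tagJ (p : T) : jumbled_model (tag p) by case: p => g i; apply: kJ; apply: leq_ltn_trans (ltn_ord i).
apply: (@packs_fin _ _ _ nu).
- move=> p; have [cp ep] := tagJ p; split.
    move=> v; have /connected_inE[/set0Pn[i iv] cv] := cp v; apply/connected_inE; split.
      by apply/set0Pn; exists (w i (p, v)); apply/nuP; exists i.
    (* [connset_bigcup] wants connected nonempty sets at all indices, hence a default off the branch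
       set. *)
    pose B (i : pull f) := if i \in tag p v then [set w i (p, v)] else [set d i].
    have -> : nu p v = \bigcup_(i in tag p v) B i.
      by apply: eq_bigr => i' i'v; rewrite /B i'v.
    apply: (connset_bigcup cv).
    + by move=> i'; rewrite /B; case: ifP => _; apply: connset1.
    + by move=> i'; rewrite /B -card_gt0; case: ifP => _; rewrite cards1.
    move=> i' j iv' jv a; rewrite /B iv' jv; exists (w i' (p, v)), (w j (p, v)).
    by rewrite !set11; split=> //; apply: (Xadj i' j) => //; apply: wX; apply: slotE.
  move=> u v /ep[i [j [iu jv a]]]; exists (w i (p, u)), (w j (p, v)); split.
  + by apply/nuP; exists i.
  + by apply/nuP; exists j.
  by apply: (Xadj i j) => //; apply: wX; apply: slotE.
- move=> p v; apply/bigcupsP => i iv; rewrite sub1set; apply/bigcupP; exists i => //.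
  by apply: wX; apply: slotE.
move=> p v q u ne; rewrite disjoints_subset; apply/subsetP => x /nuP[i iv ->].
rewrite inE; apply/negP => /nuP[j jv E].
have [ij|ij] := eqVneq i j; last first.
  have := disjointFr (Xd i j ij) (wX _ _ (slotE _ _ _ iv)).
  by rewrite E wX // slotE.
move: E; rewrite -ij => /wI E; rewrite -ij in jv.
by move: ne; rewrite E ?eqxx // slotE.
Qed.

End Packs.

Section Packing.
Variable R : realType.
Local Open Scope ring_scope.

(** A form of c_f(J) <= c free of extended reals; [xi] is there because the supremum defining the
    volume is only approximated. *)
Definition frac_bound (J : sgraph) (c : R) := forall G : sgraph, (0 < nverts G)%N ->
  forall xi : R, 0 < xi -> exists n (alpha : 'I_n -> R) (mu : 'I_n -> J -> {set G}),
    fractional_packing alpha mu /\ density R G - xi <= c * \sum_i alpha i.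

Lemma densityE (G : sgraph) : density R G = (arcs [set: G])%:R / (2 * (nverts G)%:R).
Proof.
by rewrite arcs_nedges natrM /density -mulf_div divff ?mul1r //.
Qed.

(** The number [n] of models is unbounded, but only finitely many maps from J to vertex sets exist.
    Weights of equal models are merged before rounding down, so the loss is at most the number of
    maps, independently of [n] and [t]. *)
Lemma round_packing (J G : sgraph) (t n : nat) (alpha : 'I_n -> R) (mu : 'I_n -> J -> {set G}) :
  fractional_packing alpha mu -> exists k : {ffun J -> {set G}} -> nat,
  [/\ forall g, (0 < k g)%N -> jumbled_model g,
      forall x, (\sum_g k g * multiplicity g x <= t)%N &
      t%:R * \sum_i alpha i - #|{: {ffun J -> {set G}}}|%:R <= (\sum_g k g)%:R].
Proof.
move=> [a0 muJ load]; pose fmu i := [ffun v => mu i v] : {ffun J -> {set G}}.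
have fmuE i : (fmu i : J -> {set G}) = mu i by apply/funext => v; rewrite ffunE.
pose beta g := \sum_(i | fmu i == g) alpha i.
have b0 g : 0 <= beta g by apply: sumr_ge0.
have tb0 g : 0 <= t%:R * beta g by rewrite mulr_ge0.
pose k g := Num.truncn (t%:R * beta g); have kP g := truncn_itv (tb0 g).
have sb (w : {ffun J -> {set G}} -> R) : \sum_g beta g * w g = \sum_i alpha i * w (fmu i).
  rewrite [RHS](partition_big fmu xpredT) //=; apply: eq_bigr => g _.
  by rewrite big_distrl /=; apply: eq_bigr => i /eqP->.
exists k; split.
- move=> g kg; have [i /eqP <-|none] := pickP (fun i => fmu i == g).
    by rewrite fmuE; apply: muJ.
  by move: kg; rewrite /k /beta big_pred0 // mulr0 truncn0.
- move=> x; rewrite -(ler_nat R) natr_sum.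
  apply: (@le_trans _ _ (\sum_g t%:R * beta g * (multiplicity g x)%:R)).
    apply: ler_sum => g _; rewrite natrM ler_wpM2r //.
    by have /andP[] := kP g.
  under eq_bigr do rewrite -mulrA.
  rewrite -big_distrr /= (sb (fun g => (multiplicity g x)%:R)).
  apply: le_trans (ler_wpM2l _ (_ : _ <= 1)) _; rewrite ?mulr1 //.
  apply: le_trans (load x); rewrite le_eqVlt; apply/orP; left; apply/eqP.
  by apply: eq_bigr => i _; rewrite fmuE.
rewrite natr_sum -sumr_const.
have -> : t%:R * \sum_i alpha i = \sum_g t%:R * beta g.
  rewrite -big_distrr /=; congr (_ * _); have := sb (fun _ => 1).
  rewrite (eq_bigr beta) => [->|g _]; last by rewrite mulr1.
  by apply: eq_bigr => i _; rewrite mulr1.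
rewrite -sumrB; apply: ler_sum => g _; rewrite lerBlDr.
by have /andP[_ /ltW] := kP g; rewrite -addn1 natrD.
Qed.

(* The gain t * d(tau) of a blow-up of tau pays for the drop of the density caused by deleting it. *)
Lemma packing_step (u b E E' S a t m eta c C0 p p' : R) :
  0 < m -> 0 < t -> b = t * m -> 4 <= eta * m -> 0 <= E -> 0 <= S -> S <= b * u ->
  0 < b -> b + b * m <= u ->
  2 * m * u * S <= t * (u ^+ 2 * a + m ^+ 2 * E + 2 * m * u ^+ 2) ->
  E <= E' + 2 * S ->
  E' / (2 * (u - b)) - eta * (u - b) - C0 <= p' * c ->
  t * (a / (2 * m)) - t * m * eta / 4 <= p * c ->
  E / (2 * u) - eta * u - C0 <= (p + p') * c.
Proof.
move=> m0 t0 bE etam E0 S0 Sbu b0 ub F1 F2 F5 F6.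
have u'0 : 0 < u - b by have bm := mulr_gt0 b0 m0; lra. 
have u0 : 0 < u by lra.
set x := u^-1; set y := (u - b)^-1.
have x0 : 0 < x by rewrite invr_gt0.
have y0 : 0 < y by rewrite invr_gt0.
have ux : u * x = 1 by rewrite mulfV // gt_eqF.
have uy : (u - b) * y = 1 by rewrite mulfV // gt_eqF.
have yx : y - x = b * x * y.
  have -> : y - x = (u * x) * y - ((u - b) * y) * x by rewrite ux uy; ring.
  by ring.
have by_m : b * y * m <= 1.
  by rewrite -uy mulrAC ler_pM2r //; lra.
(* The inequality of the good words, divided by 2 m u^2. *)
have F1' : S * x - b * E * x ^+ 2 / 2 - t <= t * (a / (2 * m)).
  have k0 : 0 < 2 * m * u ^+ 2 by rewrite !mulr_gt0 // exprn_gt0.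
  rewrite -(ler_pM2l k0).
  have -> : 2 * m * u ^+ 2 * (S * x - b * E * x ^+ 2 / 2 - t)
     = 2 * m * u * S * (u * x) - m * b * E * (u * x) ^+ 2 - 2 * m * u ^+ 2 * t by field.
  have -> : 2 * m * u ^+ 2 * (t * (a / (2 * m))) = t * u ^+ 2 * a by field; rewrite gt_eqF.
  rewrite ux expr1n !mulr1 bE; move: F1; lra.
have F5' : (E - 2 * S) * y / 2 - eta * (u - b) - C0 <= p' * c.
  apply: le_trans F5; rewrite lerD2r lerD2r.
  have -> : E' / (2 * (u - b)) = E' * y / 2 by rewrite /y; field; rewrite gt_eqF.
  rewrite ler_pM2r ?invr_gt0 // ler_pM2r //; lra.
have -> : E / (2 * u) = E * x / 2 by rewrite /x; field; rewrite gt_eqF.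
have yx0 : 0 <= y - x by rewrite yx !mulr_ge0 // ltW.
have T1 : 0 <= E * (b * x * (y - x)) by rewrite !mulr_ge0 // ltW.
have T2 : S * (y - x) <= t.
  have h1 : S * (y - x) <= b * u * (y - x) by rewrite ler_wpM2r.
  have h2 : b * u * (y - x) = b * (b * y).
    by rewrite yx -[RHS]mul1r -ux; ring.
  have h3 : b * (b * y) = t * (b * y * m) by rewrite {1}bE; ring.
  rewrite h2 h3 in h1; apply: le_trans h1 _; rewrite -[X in _ <= X]mulr1 ler_pM2l //.
(* Shrinking [u] by [b] releases eta b >= 4 t. A quarter of it pays for rounding; the rest covers
   [t] from the good words and [t] from the second-order term S (y - x). *)
have T3 : 4 * t <= eta * b.
  have -> : eta * b = eta * m * t by rewrite bE; ring.
  by rewrite ler_pM2r.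
have T4 : E * y / 2 - E * x / 2 - b * E * x ^+ 2 / 2 = E * (b * x * (y - x)) / 2.
  have -> : E * (b * x * (y - x)) = E * (b * x * y) - E * b * x ^+ 2 by ring.
  by rewrite -yx; field.
rewrite mulrDl.
move: F6 F1' F5' T1 T2 T3 T4.
have -> : t * m * eta / 4 = eta * b / 4 by rewrite bE; ring.
have -> : (E - 2 * S) * y / 2 = E * y / 2 - S * y by field.
rewrite mulrBr [S * (y - x)]mulrBr; lra.
Qed.

(** Blow-ups are packed and deleted until at most [u2] vertices remain; there the density is at most
    [u2], so [C0 = u2] makes the empty packing sufficient. The constant depends on [eta] and [C] but
    not on [J] or [G]. *)
Lemma packing (eta : R) (C : nat) : 0 < eta -> exists C0 : R, 0 <= C0 /\
  forall (J : sgraph) (c : R), (nverts J <= C)%N -> 0 <= c -> c <= 2 * C%:R -> frac_bound J c ->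
  forall (G : sgraph) (U : {set G}), exists p, packs J U p /\
    (arcs U)%:R / (2 * #|U|%:R) - eta * #|U|%:R - C0 <= p%:R * c.
Proof.
move=> eta0.
pose m := (Num.truncn (4 / eta)).+1.
have etam : 4 <= eta * m%:R.
  have h0 : 0 <= 4 / eta by rewrite divr_ge0 // ltW.
  by rewrite mulrC -ler_pdivrMr //; have /andP[_ /ltW] := truncn_itv h0.
(* [N] bounds the rounding loss, the number of maps from J to sets of vertices of an m-vertex graph.
   As c <= 2 C, the loss N c is at most 2 N C, below t/2 and hence below t m eta / 8. *)
pose N := ((2 ^ m) ^ C)%N; pose t := (4 * N * C).+1.
have [u1 u1P] := @blowup_exists m t isT isT.
pose b := (t * m)%N; pose u2 := maxn u1 (b + b * m).
exists u2%:R; split=> // J c JC c0 cC fb G U.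
have [n] := ubnP #|U|; elim: n U => // n IH U; rewrite ltnS => Un.
have [Usmall|Ubig] := leqP #|U| u2.
  exists 0; split; first exact: packs0.
  rewrite mul0r lerBlDr add0r; apply: le_trans (_ : #|U|%:R <= _); last by rewrite ler_nat.
  rewrite lerBlDr; apply: ler_wpDr; first by rewrite mulr_ge0 // ltW.
  have [->|U0] := posnP #|U|; first by rewrite mulr0 invr0 mulr0.
  rewrite ler_pdivrMr ?mulr_gt0 ?ltr0n // -!natrM ler_nat.
  apply: leq_trans (arcs_le U) _; rewrite leq_mul2l; apply/orP; right; lia.
have u1U : (u1 <= #|U|)%N by apply: leq_trans (ltnW Ubig); apply: leq_maxl.
have ubU : (b + b * m <= #|U|)%N by apply: leq_trans (ltnW Ubig); apply: leq_maxr.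
have [f [X [blow F1]]] := u1P G U u1U; have [Xt XU Xd _] := blow.
pose B := \bigcup_i X i.
have BU : B \subset U by apply/bigcupsP => i _; apply: XU.
have sumB (w : G -> nat) : (\sum_(x in B) w x = \sum_i \sum_(x in X i) w x)%N.
  by apply: partition_disjoint_bigcup => i j; apply: Xd.
have cB : #|B| = b.
  rewrite -sum1_card sumB (eq_bigr (fun _ => t)) => [|i _]; last by rewrite sum1_card Xt.
  by rewrite sum_nat_const card_ord mulnC.
have b0 : (0 < b)%N by [].
have cUB : (#|U :\: B| + b = #|U|)%N by rewrite -(cardsID B U) (setIidPr BU) cB addnC.
have [|p' [pp' F5]] := IH (U :\: B); first by lia.
have xi0 : 0 < m%:R * eta / 8 by rewrite !mulr_gt0 // ltr0n.
have [] := fb (pull f) _ _ xi0; first by rewrite /nverts card_ord.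
move=> n' [alpha [mu [fp dle]]].
have [k [kJ kt ksum]] := round_packing t fp.
have pB : packs J B (\sum_g k g) by apply: (blowup_packs _ _ blow kJ kt).
have F6 : t%:R * ((arcs [set: pull f])%:R / (2 * m%:R)) - t%:R * m%:R * eta / 4
    <= (\sum_g k g)%:R * c.
  have d1 := densityE (pull f); rewrite [nverts _]card_ord in d1.
  rewrite -d1.
  have NN : #|{: {ffun J -> {set pull f}}}|%:R <= N%:R :> R.
    rewrite ler_nat card_ffun -cardsT -powersetT card_powerset cardsT card_ord.
    by rewrite leq_pexp2l // expn_gt0.
  have h1 : (t%:R * (\sum_i alpha i) - N%:R) * c <= (\sum_g k g)%:R * c.
    by rewrite ler_wpM2r //; lra.
  have h2 : t%:R * (density R (pull f) - m%:R * eta / 8) <= t%:R * (c * \sum_i alpha i).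
    by rewrite ler_wpM2l.
  have h3 : N%:R * c <= N%:R * (2 * C%:R) by rewrite ler_wpM2l.
  have h4 : (4 * N%:R * C%:R) * (eta * m%:R) <= t%:R * (eta * m%:R).
    by rewrite ler_wpM2r ?(le_trans _ etam) // -!natrM ler_nat.
  have h5 : (4 * N%:R * C%:R) * 4 <= (4 * N%:R * C%:R) * (eta * m%:R) by rewrite ler_wpM2l // !mulr_ge0.
  move: h1 h2 h3 h4 h5; set NR := N%:R; set CR := C%:R; set tR := t%:R; set al := \sum_i alpha i.
  set K := (\sum_g k g)%:R; set mR := m%:R; set d := density _ _.
  move=> h1 h2 h3 h4 h5.
  have e1 : tR * (c * al) = tR * al * c by ring.
  have e2 : tR * mR * eta = tR * (eta * mR) by ring.
  rewrite e1 in h2; rewrite e2; move: h1 h2 h3 h4 h5; clearbody d; clear; lra.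
exists (\sum_g k g + p')%N; split.
  have UE : B :|: (U :\: B) = U.
    by apply/setP => x; rewrite !inE; case: (boolP (x \in B)) => //= /(subsetP BU).
  have d : [disjoint B & U :\: B].
    by rewrite disjoints_subset; apply/subsetP => x; rewrite !inE => ->.
  by have := packsD d pB pp'; rewrite UE.
pose S := (\sum_(x in B) #|nbrs U x|)%N.
have cUBr : #|U :\: B|%:R = #|U|%:R - b%:R :> R by rewrite -cUB natrD addrK.
rewrite cUBr in F5; rewrite natrD.
apply: (packing_step (m := m%:R) (t := t%:R) (b := b%:R) (S := S%:R)) F5 F6 => //.
- by rewrite -natrM.
- by rewrite -natrM ler_nat /S -cB -sum_nat_const; apply: leq_sum => x _; apply: nbrs_le.
- by rewrite -natrM -natrD ler_nat.
- by rewrite -sumB in F1; rewrite -!natrX -!natrM -!natrD -!natrM ler_nat.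
- by rewrite -natrM -natrD ler_nat arcsD.
Qed.

End Packing.

(** * Embedding H in a robustly connected dense graph *)

Section Embedding.
Local Open Scope nat_scope.

Lemma connset_star (T : finType) (r : rel T) (I : finType) (K : {set I}) (S : {set T})
    (B : I -> {set T}) (y : T) : symmetric r ->
  connset r S -> y \in S ->
  (forall i, i \in K -> connset r (B i) /\ exists2 z, z \in B i & r y z) ->
  connset r (S :|: \bigcup_(i in K) B i).
Proof.
move=> rs cS yS h; apply: (connset_from rs (x := y)) => z /setUP[zS|/bigcupP[i iK zi]].
  exact: connS (subsetUl _ _) (cS _ _ yS zS).
have [cB [u ui yu]] := h i iK.
have sub : B i \subset S :|: \bigcup_(i in K) B i.
  by rewrite subsetU // bigcup_sup ?orbT.
apply: conn_trans (connS sub (cB u z ui zi)).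
by apply: conn1 => //; [rewrite inE yS|apply: (subsetP sub)].
Qed.

(** Greedy choice: the connectors already chosen form the forbidden set [X], which the last
    hypothesis keeps within budget. The index type is arbitrary because both the edges of [F] and
    the paths in [reroute] are served. *)
Lemma link_pairs (G : sgraph) (Z : {set G}) (k Pl th : nat) (E : eqType) (a b : E -> G) (s : seq E) :
  (forall (X : {set G}) e, th * #|X| <= k -> e \in s -> exists I : {set G},
     [/\ connected_in I, I \subset Z :\: X, #|I| <= Pl, attached (a e) I & attached (b e) I]) ->
  th * (Pl * size s) <= k ->
  exists I : E -> {set G}, (forall e, e \in s -> [/\ connected_in (I e), I e \subset Z,
      #|I e| <= Pl, attached (a e) (I e) & attached (b e) (I e)]) /\
    {in s &, forall e e', e != e' -> [disjoint I e & I e']}.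
Proof.
elim: s => [|e s IH] h hk; first by exists (fun _ => set0).
have [||I [IP Id]] := IH.
- by move=> X e' Xk e's; apply: h; rewrite // inE e's orbT.
- by apply: leq_trans hk; rewrite !leq_mul2l /= leqnSn !orbT.
have [es|es] := boolP (e \in s).
  by exists I; split=> [e'|e1 e2]; rewrite ?inE;
    [case/predU1P=> [->|]|case/predU1P=> [->|?]; case/predU1P=> [->|?]]; auto.
pose X := \bigcup_(i < size s) I (nth e s i).
have X_le : #|X| <= size s * Pl.
  by apply: disjoint_card_bigcup => i; have [] := IP _ (mem_nth e (ltn_ord i)).
have IX e' : e' \in s -> I e' \subset X.
  move=> e's; have lt : index e' s < size s by rewrite index_mem.
  by have := @bigcup_sup _ _ (Ordinal lt) xpredT (fun i : 'I_(size s) => I (nth e s i)) isT;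
    rewrite /= nth_index.
have [|Ie [cIe IeZ le ae be]] := h X e _ (mem_head _ _).
  apply: leq_trans hk; rewrite leq_mul2l (leq_trans X_le) ?orbT //.
  by rewrite mulnC leq_mul2l leqnSn orbT.
have dIe e' : e' \in s -> [disjoint Ie & I e'].
  move=> e's; rewrite disjoints_subset; apply/subsetP => x /(subsetP IeZ).
  by rewrite !inE => /andP[xX _]; apply: contra xX; apply/subsetP/IX.
have ne e' : e' \in s -> (e' == e) = false by move=> e's; apply: contraNF es => /eqP<-.
exists (fun e' => if e' == e then Ie else I e'); split=> [e'|e1 e2]; rewrite ?inE.
  case/predU1P=> [->|e's]; last by rewrite ne //; apply: IP.
  by rewrite eqxx; split=> //; apply: subset_trans IeZ (subsetDl _ _).
case/predU1P=> [->|s1]; case/predU1P=> [->|s2]; rewrite ?eqxx ?ne //.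
- by move=> _; apply: dIe.
- by move=> _; rewrite disjoint_sym; apply: dIe.
- exact: Id.
Qed.

(** Every edge of [F] is oriented by [xe]. Its connector is absorbed into the branch set of the
    first end and touches a fixed vertex in the base of the second, so bases of distinct vertices
    never have to grow towards each other inside [W]. *)
Lemma minor_of_packs (G J H : sgraph) (W Z : {set G}) (k Pl th l : nat) (F : {set {set H}}) :
  packs J W l -> [disjoint W & Z] ->
  (forall (X : {set G}) x y, th * #|X| <= k -> x \in W -> y \in W -> x != y ->
     exists I : {set G},
     [/\ connected_in I, I \subset Z :\: X, #|I| <= Pl, attached x I & attached y I]) ->
  F \subset edges H -> th * (Pl * #|F|) <= k ->
  is_subgraph (del_edges F) (copies l J) -> is_minor H G.
Proof.
move=> [nu [nuJ nuW nuD]] dWZ link FE Fk [phi phiI phiA].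
have [u0 _|none] := pickP (fun _ : H => true); last first.
  by exists (fun _ => set0); first split; move=> u; have := none u.
pose base u := nu (phi u).1 (phi u).2.
have baseD u v : u != v -> [disjoint base u & base v].
  move=> uv; apply: nuD; rewrite -!surjective_pairing.
  by apply: contra_neq uv => /phiI.
have cbase u : connected_in (base u) by case: (nuJ (phi u).1) => h _; apply: h.
have /fin_all_exists[y yP] u : exists y, y \in base u.
  by apply/set0Pn; have /connected_inE[] := cbase u.
have baseW u : base u \subset W by apply: nuW.
have yW u : y u \in W by apply: (subsetP (baseW u)).
have /fin_all_exists[xe xeP] (e : {set H}) : exists p : H * H,
    e \in F -> e = [set p.1; p.2] /\ adj p.1 p.2.
  have [eF|eF] := boolP (e \in F).
    by have /imsetP[p] := subsetP FE e eF; rewrite inE => a ->; exists p.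
  by exists (u0, u0).
have [||I [IP Id]] := @link_pairs G Z k Pl th {set H} (fun e => y (xe e).1) (fun e => y (xe e).2) (enum F).
- move=> X e Xk; rewrite mem_enum => /xeP[_ a]; apply: link => //.
  have ne : (xe e).1 != (xe e).2 by apply: contraTneq a => ->; rewrite adj_irrefl.
  by apply: contraTneq (yP (xe e).1) => ->; rewrite (disjointFl (baseD _ _ ne) (yP _)).
- by rewrite -cardE.
have {}IP e : e \in F -> [/\ connected_in (I e), I e \subset Z,
      attached (y (xe e).1) (I e) & attached (y (xe e).2) (I e)].
  by move=> eF; have := IP e; rewrite mem_enum => /(_ eF)[].
have {}Id e e' : e \in F -> e' \in F -> e != e' -> [disjoint I e & I e'].
  by move=> eF e'F; apply: Id; rewrite mem_enum.
pose mine u := [set e in F | (xe e).1 == u].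
pose mu u := base u :|: \bigcup_(e in mine u) I e.
have baseI u e : e \in F -> [disjoint base u & I e].
  by move=> /IP[_ IZ _ _]; apply: disjointWl (baseW u) (disjointWr IZ dWZ).
have mubase u : base u \subset mu u by apply: subsetUl.
have muI e : e \in F -> I e \subset mu (xe e).1.
  by move=> eF; rewrite subsetU // bigcup_sup ?orbT // inE eF eqxx.
exists mu; first split.
- move=> u; apply/connected_inE; split.
    by apply/set0Pn; exists (y u); rewrite inE yP.
  have /connected_inE[_ cb] := cbase u.
  apply: (connset_star (@adj_sym G) cb (yP u)) => e; rewrite inE => /andP[eF /eqP xu].
  have [/connected_inE[_ cI] _ at1 _] := IP e eF; split=> //.
  by move: at1; rewrite xu => /exists_inP[z zI a]; exists z.
- move=> u v auv; have [eF|eF] := boolP ([set u; v] \in F); last first.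
    have /phiA/andP[/eqP E a] : adj (u : del_edges F) v by rewrite /= /del_adj auv eF.
    have [_ /(_ _ _ a)[x [x' [xu xv axx']]]] := nuJ (phi u).1.
    exists x, x'; split=> //; apply: (subsetP (mubase _)) => //.
    by rewrite /base -E.
  have [E _] := xeP _ eF; set e := [set u; v] in eF E.
  have [_ _ at1 at2] := IP e eF.
  have key w w' : (xe e).1 = w -> (xe e).2 = w' ->
      exists x x', [/\ x \in mu w, x' \in mu w' & adj x x'].
    move=> e1 e2; move: at2; rewrite e2 => /exists_inP[z zI a].
    exists z, (y w'); split; last by rewrite adj_sym.
      by rewrite -e1; apply: (subsetP (muI e eF)).
    exact: subsetP (mubase w') _ (yP w').
  have uv : u != v by apply: contraTneq auv => ->; rewrite adj_irrefl.
  have uE : u \in [set (xe e).1; (xe e).2] by rewrite -E set21.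
  have vE : v \in [set (xe e).1; (xe e).2] by rewrite -E set22.
  move: uE vE uv; rewrite !inE => /orP[/eqP eu|/eqP eu] /orP[/eqP ev|/eqP ev]; rewrite eu ev ?eqxx // => _.
    exact: key.
  have [x [x' [h1 h2 h3]]] := key _ _ erefl erefl.
  by exists x', x; rewrite adj_sym.
move=> u v uv; rewrite disjoints_subset; apply/subsetP => x.
rewrite !inE negb_or => /orP[xu|/bigcupP[e]].
  rewrite (disjointFr (baseD _ _ uv) xu) /=; apply/bigcupP => -[e].
  by rewrite inE => /andP[eF _] xI; have := disjointFr (baseI u e eF) xu; rewrite xI.
rewrite inE => /andP[eF /eqP eu] xI; apply/andP; split.
  by rewrite (disjointFl (baseI v e eF) xI).
apply/bigcupP => -[e']; rewrite inE => /andP[e'F /eqP e'v] xI'.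
have ee' : e != e' by apply: contra_neq uv => E; rewrite -eu -e'v E.
by have := disjointFr (Id e e' eF e'F ee') xI; rewrite xI'.
Qed.

End Embedding.

Section DenseMinor.
Variable R : realType.
Local Open Scope ring_scope.

(** Each vertex of [Y] meets at most |V| edges inside [V], so at most |Y| |V| edges are lost, while
    the denominator can only decrease. *)
Lemma arcsD_density (G : sgraph) (V Y : {set G}) :
  (arcs V)%:R / (2 * #|V|%:R) - #|Y|%:R <= (arcs (V :\: Y))%:R / (2 * #|V :\: Y|%:R) :> R.
Proof.
have rhs0 : 0 <= (arcs (V :\: Y))%:R / (2 * #|V :\: Y|%:R) :> R by rewrite divr_ge0 // mulr_ge0.
have [V0|V0] := posnP #|V|.
  rewrite V0 mulr0 invr0 mulr0 sub0r; apply: le_trans rhs0; by rewrite oppr_le0.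
have dV : 0 < 2 * #|V|%:R :> R by rewrite mulr_gt0 // ltr0n.
have key : (arcs V)%:R - 2 * #|V|%:R * #|Y|%:R <= (arcs (V :\: Y))%:R :> R.
  rewrite lerBlDr -!natrM -natrD ler_nat.
  have -> : V :\: Y = V :\: (V :&: Y) by rewrite setDIr setDv set0U.
  apply: leq_trans (arcsD V (V :&: Y)) _; rewrite leq_add2l -mulnA leq_mul2l /=.
  apply: leq_trans (leq_sum _ (fun x _ => nbrs_le V x)) _.
  by rewrite sum_nat_const mulnC leq_mul2l subset_leq_card ?orbT // subsetIr.
have le1 : (arcs V)%:R / (2 * #|V|%:R) - #|Y|%:R <= (arcs (V :\: Y))%:R / (2 * #|V|%:R) :> R.
  rewrite ler_pdivlMr // mulrBl divfK ?gt_eqF // mulrC; apply: le_trans key.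
  by rewrite lexx.
apply: le_trans le1 _; have [D0|D0] := posnP #|V :\: Y|.
  have := arcs_le (V :\: Y); rewrite D0 mul0n leqn0 => /eqP->.
  by rewrite !mul0r.
rewrite ler_wpM2l // lef_pV2 ?posrE // ?mulr_gt0 ?ltr0n // ler_pM2l // ler_nat.
exact/subset_leq_card/subsetDl.
Qed.

Lemma budget (A B Y C0 P L E : R) : A - Y - B - C0 <= P -> L + E <= A ->
  Y <= E / 4 -> C0 <= E / 4 -> B <= E / 4 -> 0 <= E -> L <= P.
Proof. lra. Qed.

(** Three errors are each kept below eta k / 4: the density lost with the reserve and its bad set,
    the linear error of [packing] summed over the disjoint [V i], and s C0. Only the last involves
    [C]; it is absorbed by [k0], so [th] is free of [C]. *)
Lemma dense_minor (M s : nat) (eta : R) : 0 < eta -> exists th : nat, forall C : nat,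
  exists k0 : nat, forall (J H G : sgraph) (c : R) (k l : nat) (V : 'I_s -> {set G})
    (F : {set {set H}}),
  (nverts J <= C)%N -> 0 < c -> c <= 2 * C%:R -> frac_bound J c ->
  (k0 <= k)%N -> (#|G| <= M * k)%N -> (k.+2 <= #|G|)%N -> rconn [set: G] k ->
  (forall i j, i != j -> [disjoint V i & V j]) ->
  F \subset edges H -> (th * #|F| <= k)%N -> is_subgraph (del_edges F) (copies l J) ->
  l%:R * c + eta * k%:R <= \sum_i (arcs (V i))%:R / (2 * #|V i|%:R) ->
  is_minor H G.
Proof.
move=> eta0.
(* Reserve and bad set together have at most 3 M k / (q+1) vertices, and each of the [s] pieces may
   have to pay for all of them. *)
pose q := Num.truncn (12 * s%:R * M%:R / eta).
have [Pl [th0 [kr reserveP]]] := reserve M q.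
exists (th0 * Pl)%N => C.
pose eta' := eta / (4 * M.+1%:R).
have eta'0 : 0 < eta' by rewrite divr_gt0 // mulr_gt0 // ltr0n.
have [C0 [C00 packP]] := packing C eta'0.
exists (maxn kr (Num.truncn (4 * s%:R * C0 / eta)).+1).
move=> J H G c k l V F JC c0 cC fb; rewrite geq_max => /andP[krk k0k] GM kG rG dV FE Fk sub sumV.
have [Z [Bad [Zle Badle link]]] := reserveP G k krk GM kG rG.
pose Y := Z :|: Bad.
have /fin_all_exists[p pP] i : exists p, packs J (V i :\: Y) p /\
    (arcs (V i :\: Y))%:R / (2 * #|V i :\: Y|%:R) - eta' * #|V i :\: Y|%:R - C0 <= p%:R * c.
  by apply: packP => //; apply: ltW.
have Ysmall : s%:R * #|Y|%:R <= eta * k%:R / 4.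
  have hY : (q.+1 * #|Y| <= 3 * (M * k))%N.
    have := (leq_card_setU Z Bad).1; rewrite -/Y => h.
    apply: (@leq_trans (q.+1 * #|Z| + q.+1 * #|Bad|)); first by rewrite -mulnDr leq_mul2l h orbT.
    apply: leq_trans (leq_add Zle Badle) _; move: GM; clear; lia.
  have hq : 12 * s%:R * M%:R <= q.+1%:R * eta.
    have h0 : 0 <= 12 * s%:R * M%:R / eta by rewrite divr_ge0 ?mulr_ge0 // ltW.
    by rewrite -ler_pdivrMr //; have /andP[_ /ltW] := truncn_itv h0.
  have q0 : 0 < q.+1%:R :> R by rewrite ltr0n.
  rewrite -(ler_pM2l q0); move: hY; rewrite -(ler_nat R) !natrM => hY.
  have h1 : s%:R * (q.+1%:R * #|Y|%:R) <= s%:R * (3 * (M%:R * k%:R)) :> R.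
    by rewrite ler_wpM2l.
  have h2 : 12 * s%:R * M%:R * k%:R <= q.+1%:R * eta * k%:R by rewrite ler_wpM2r.
  move: h1 h2; set Q := q.+1%:R; set y := #|Y|%:R; clear; lra.
have k_big : s%:R * C0 <= eta * k%:R / 4.
  have h0 : 0 <= 4 * s%:R * C0 / eta by rewrite divr_ge0 ?mulr_ge0 // ltW.
  have /andP[_ /ltW h1] := truncn_itv h0.
  have h2 : 4 * s%:R * C0 / eta <= k%:R by apply: le_trans h1 _; rewrite ler_nat.
  by move: h2; rewrite ler_pdivrMr // mulrC; lra.
have disjY i j : i != j -> [disjoint V i :\: Y & V j :\: Y].
  by move=> ij; apply: disjointWl (subsetDl _ _) (disjointWr (subsetDl _ _) (dV i j ij)).
have cardV : \sum_i eta' * #|V i :\: Y|%:R <= eta * k%:R / 4.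
  rewrite -big_distrr /= -natr_sum.
  have le : (\sum_i #|V i :\: Y| <= M * k)%N.
    apply: leq_trans GM; rewrite -cardsT.
    have -> : (\sum_i #|V i :\: Y| = #|\bigcup_i (V i :\: Y)|)%N.
      rewrite -sum1_card partition_disjoint_bigcup //.
      by apply: eq_bigr => i _; rewrite sum1_card.
    exact/subset_leq_card/subsetT.
  have le' : (\sum_i #|V i :\: Y| <= M.+1 * k)%N by apply: leq_trans le _; rewrite leq_mul2r leqnSn orbT.
  apply: le_trans (ler_wpM2l (ltW eta'0) (_ : _ <= (M.+1 * k)%:R)) _; first by rewrite ler_nat.
  rewrite natrM /eta' le_eqVlt; apply/orP; left; apply/eqP; field.
  by rewrite nat1r pnatr_eq0.
have tot : l%:R * c <= (\sum_i p i)%:R * c.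
  have h : \sum_i ((arcs (V i))%:R / (2 * #|V i|%:R) - #|Y|%:R - eta' * #|V i :\: Y|%:R - C0)
      <= \sum_i (p i)%:R * c.
    apply: ler_sum => i _; have [_] := pP i; apply: le_trans.
    by rewrite !lerD2r arcsD_density.
  have cst (y : R) : \sum_(i < s) y = s%:R * y by rewrite sumr_const card_ord mulr_natl.
  rewrite !sumrB !cst -big_distrl -natr_sum /= in h.
  have ek : 0 <= eta * k%:R by rewrite mulr_ge0 // ltW.
  exact: budget h sumV Ysmall k_big cardV ek.
have lp : (l <= \sum_i p i)%N by rewrite -(ler_nat R) -(ler_pM2r c0).
have pW : packs J (\bigcup_i (V i :\: Y)) l.
  by apply: (packs_le lp (subxx _)); apply: packs_big => // i; have [] := pP i.
have WY : \bigcup_i (V i :\: Y) \subset ~: Y.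
  by apply/bigcupsP => i _; apply/subsetP => x; rewrite !inE => /andP[].
apply: (minor_of_packs (Z := Z) (k := k) (Pl := Pl) (th := th0) pW _ _ FE _ sub).
- by rewrite disjoints_subset (subset_trans WY) // setCS subsetUl.
- move=> X x y Xk xW yW xy; apply: link => //.
    by move: (subsetP WY _ xW); rewrite !inE negb_or => /andP[].
  by move: (subsetP WY _ yW); rewrite !inE negb_or => /andP[].
- by rewrite mulnA.
Qed.

End DenseMinor.

(** * Linking disjoint pieces *)

Section Reroute.
Local Open Scope nat_scope.

(** The linking sets given by Menger's theorem may use up most of [P]. Each keeps only its parts
    from either end to its first vertex in [P], joined by a short connector inside [P]: 6M+1
    vertices plus two entry vertices. Outside [P] nothing is added. *)
Lemma reroute (G : sgraph) (P : {set G}) (k M Q : nat) (R : 'I_Q -> {set G}) (a b : 'I_Q -> G) :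
  rconn P k -> k.+2 <= #|P| -> #|P| <= M * k -> 0 < k -> 4 * ((6 * M).+3 * Q) <= k ->
  (forall j, [/\ connset (@adj G) (R j), a j \in R j & b j \in R j]) ->
  (forall i j, i != j -> [disjoint R i & R j]) ->
  exists R' : 'I_Q -> {set G},
  [/\ forall j, [/\ connset (@adj G) (R' j), a j \in R' j & b j \in R' j],
      forall i j, i != j -> [disjoint R' i & R' j],
      forall j, R' j :\: P \subset R j & forall j, #|R' j :&: P| <= (6 * M).+3].
Proof.
move=> rP kP PM k0 Qk RP Rd.
have hit0 x y (S : {set G}) : connset (@adj G) S -> x \in S -> y \in S -> y \in P ->
    exists u (C : {set G}), [/\ u \in P, C \subset S, (x \in C) && (u \in C),
      connset (@adj G) C & C :&: P \subset [set u]].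
  move=> cS xS yS yP; have [u [C [uP CS xu cC Cz]]] := first_hit (@adj_sym G) (cS x y xS yS) xS yP.
  exists u, C; split=> //; apply/subsetP => z; rewrite !inE => /andP[zC zP].
  by apply: contraT => zu; have [/negP[]] := Cz z zC zu.
pose hit j := R j :&: P != set0.
have /fin_all_exists[A AP] j : exists p : G * {set G}, hit j ->
    [/\ p.1 \in P, p.2 \subset R j, (a j \in p.2) && (p.1 \in p.2),
      connset (@adj G) p.2 & p.2 :&: P \subset [set p.1]].
  have [/set0Pn[y]|] := boolP (hit j); last by exists (a j, set0).
  rewrite inE => /andP[yR yP]; have [cR aR bR] := RP j.
  by have [u [C h]] := hit0 (a j) y _ cR aR yR yP; exists (u, C).
have /fin_all_exists[B BP] j : exists p : G * {set G}, hit j ->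
    [/\ p.1 \in P, p.2 \subset R j, (b j \in p.2) && (p.1 \in p.2),
      connset (@adj G) p.2 & p.2 :&: P \subset [set p.1]].
  have [/set0Pn[y]|] := boolP (hit j); last by exists (a j, set0).
  rewrite inE => /andP[yR yP]; have [cR aR bR] := RP j.
  by have [u [C h]] := hit0 (b j) y _ cR bR yR yP; exists (u, C).
(* All entry vertices are avoided by all connectors, which keeps every connector off the retained
   parts of the other sets. *)
pose D := [set (A j).1 | j : 'I_Q] :|: [set (B j).1 | j : 'I_Q].
have D_le : #|D| <= 2 * Q.
  apply: leq_trans (leq_card_setU _ _) _; rewrite mul2n -addnn leq_add //.
    by apply: leq_trans (leq_imset_card _ _) _; rewrite card_ord.
  by apply: leq_trans (leq_imset_card _ _) _; rewrite card_ord.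
have [||I [IP Id]] := @link_pairs G (P :\: D) k (6 * M).+1 4 _ (fun j => (A j).1) (fun j => (B j).1)
    (enum hit).
- move=> X j Xk; rewrite mem_enum => hj.
  have [aP _ _ _ _] := AP j hj; have [bP _ _ _ _] := BP j hj.
  have DXk : 2 * #|D :|: X| <= k.
    have := (leq_card_setU D X).1; move: Qk Xk D_le; clear; lia.
  have [I [cI IX le xI yI]] := connector_step rP kP PM k0 DXk aP bP.
  by exists I; rewrite setDDl.
- rewrite -cardE; have : #|hit| <= Q by apply: leq_trans (max_card _) _; rewrite card_ord.
  move=> hQ; apply: leq_trans Qk; rewrite leq_mul2l /= leq_mul //; clear; lia.
have {}IP j : hit j -> [/\ connected_in (I j), I j \subset P :\: D, #|I j| <= (6 * M).+1,
    attached (A j).1 (I j) & attached (B j).1 (I j)].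
  by move=> hj; apply: IP; rewrite mem_enum.
have {}Id i j : hit i -> hit j -> i != j -> [disjoint I i & I j].
  by move=> hi hj; apply: Id; rewrite mem_enum.
pose core j := if hit j then (A j).2 :|: (B j).2 else R j.
pose seg j := if hit j then I j else set0.
have coreR j : core j \subset R j.
  rewrite /core; case: ifP => // hj; rewrite subUset.
  by have [_ -> _ _ _] := AP j hj; have [_ -> _ _ _] := BP j hj.
have coreP j : core j :&: P \subset (if hit j then [set (A j).1; (B j).1] else set0).
  rewrite /core; case: ifP => [hj|/negbFE/eqP->] //; rewrite setIUl setUSS //.
    by have [_ _ _ _ ->] := AP j hj.
  by have [_ _ _ _ ->] := BP j hj.
have corePD j : core j :&: P \subset D.
  apply: subset_trans (coreP j) _; case: ifP => _; last exact: sub0set.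
  by apply/subsetP => z /set2P[] ->; rewrite inE; apply/orP; [left|right]; apply/imsetP; exists j.
have segP j : seg j \subset P :\: D.
  by rewrite /seg; case: ifP => [/IP[]|_] //; apply: sub0set.
exists (fun j => core j :|: seg j); split.
- move=> j; rewrite /core /seg; case: ifP => hj; last by rewrite setU0; apply: RP.
  have [_ _ /andP[aA uA] cA _] := AP j hj; have [_ _ /andP[bB wB] cB _] := BP j hj.
  have [/connected_inE[_ cI] _ _ /exists_inP[x xI ux] /exists_inP[y yI wy]] := IP j hj.
  split; last 2 first.
  + by rewrite !inE aA.
  + by rewrite !inE bB orbT.
  have c1 : connset (@adj G) ((A j).2 :|: I j).
    by apply: (connsetU (@adj_sym G) (x := (A j).1) (y := x)); rewrite ?ux ?orbT.
  rewrite setUAC; apply: (connsetU (@adj_sym G) (x := y) (y := (B j).1)) => //.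
  + by rewrite inE yI orbT.
  + by rewrite adj_sym wy orbT.
- move=> i j ij.
  have cs x y : [disjoint core x & seg y].
    rewrite disjoints_subset; apply/subsetP => z zc; rewrite inE; apply/negP => /(subsetP (segP y)).
    rewrite inE => /andP[zD zP]; case/negP: zD.
    by apply: (subsetP (corePD x)); rewrite inE zc.
  have cc : [disjoint core i & core j].
    exact: disjointWl (coreR i) (disjointWr (coreR j) (Rd i j ij)).
  have ss : [disjoint seg i & seg j].
    rewrite /seg; case: ifP => hi; last by rewrite disjoints_subset sub0set.
    case: ifP => hj; last by rewrite disjoint_sym disjoints_subset sub0set.
    exact: Id.
  rewrite disjoints_subset; apply/subsetP => z; rewrite !inE negb_or => /orP[zi|zi].
    by rewrite (disjointFr cc zi) (disjointFr (cs i j) zi).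
  by rewrite (disjointFl (cs j i) zi) (disjointFr ss zi).
- move=> j; apply/subsetP => z; rewrite !inE => /andP[zP /orP[zc|zs]].
    exact: subsetP (coreR j) _ zc.
  by have := subsetP (segP j) _ zs; rewrite !inE (negbTE zP) andbF.
move=> j; rewrite setIUl; apply: leq_trans (leq_card_setU _ _) _.
have h1 : #|core j :&: P| <= 2.
  apply: leq_trans (subset_leq_card (coreP j)) _; case: ifP => _; last by rewrite cards0.
  by rewrite cards2; case: (_ != _).
have h2 : #|seg j :&: P| <= (6 * M).+1.
  apply: leq_trans (subset_leq_card (subsetIl _ _)) _; rewrite /seg.
  by case: ifP => [/IP[]|_]; rewrite ?cards0.
by rewrite -[(6 * M).+3]add2n leq_add.
Qed.

(** Rerouting through one piece adds vertices only inside it, so bounds already obtained on the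
    other, disjoint pieces persist. *)
Lemma reroute_all (G : sgraph) (s : nat) (P : 'I_s -> {set G}) (k M Q : nat)
    (R : 'I_Q -> {set G}) (a b : 'I_Q -> G) :
  (forall i, [/\ rconn (P i) k, k.+2 <= #|P i| & #|P i| <= M * k]) ->
  (forall i j, i != j -> [disjoint P i & P j]) ->
  0 < k -> 4 * ((6 * M).+3 * Q) <= k ->
  (forall j, [/\ connset (@adj G) (R j), a j \in R j & b j \in R j]) ->
  (forall i j, i != j -> [disjoint R i & R j]) ->
  exists R' : 'I_Q -> {set G},
  [/\ forall j, [/\ connset (@adj G) (R' j), a j \in R' j & b j \in R' j],
      forall i j, i != j -> [disjoint R' i & R' j] &
      forall i j, #|R' j :&: P i| <= (6 * M).+3].
Proof.
move=> hP dP k0 Qk hR dR.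
suff h n : n <= s -> exists R' : 'I_Q -> {set G},
  [/\ forall j, [/\ connset (@adj G) (R' j), a j \in R' j & b j \in R' j],
      forall i j, i != j -> [disjoint R' i & R' j] &
      forall (i : 'I_s) j, i < n -> #|R' j :&: P i| <= (6 * M).+3].
  by have [R' [h1 h2 h3]] := h s (leqnn s); exists R'; split=> // i j; apply: h3.
elim: n => [|n IH] ns; first by exists R; split.
have [R1 [h1 h2 h3]] := IH (ltnW ns); pose i0 := Ordinal ns.
have [r1 r2 r3] := hP i0.
have [R2 [g1 g2 g3 g4]] := reroute r1 r2 r3 k0 Qk h1 h2.
exists R2; split=> // i j; rewrite ltnS leq_eqVlt => /orP[/eqP ei|lt].
  by have -> : i = i0 by apply: val_inj.
apply: leq_trans (h3 i j lt); apply: subset_leq_card; apply/subsetP => z.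
rewrite !inE => /andP[zR zP]; rewrite zP andbT; apply: (subsetP (g3 j)).
rewrite inE zR andbT; have ne : i != i0 by apply: contraTneq lt => ->; rewrite ltnn.
by rewrite (disjointFr (dP _ _ ne) zP).
Qed.

Lemma conn_lift (T U : finType) (r : rel T) (e : rel U) (h : U -> T) (S : {set T}) (S' : {set U}) :
  (forall z, z \in S -> exists2 x, x \in S' & h x = z) ->
  {in S' &, injective h} ->
  {in S' &, forall x y, r (h x) (h y) -> e x y} ->
  {in S' &, forall x y, conn r S (h x) (h y) -> conn e S' x y}.
Proof.
move=> lift hI hE x y xS yS /connectP[p pp].
elim: p x xS pp => [|z p IH] x xS /=.
  by move=> _ /hI->; rewrite //; apply: connect0.
case/andP=> /and3P[_ zS rz] pp; have [w wS hw] := lift z zS.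
rewrite -hw in pp rz * => yl; apply: conn_trans (IH w wS pp yl).
by apply: conn1 => //; apply: hE.
Qed.

Lemma arcs_map (G K : sgraph) (S : {set G}) (S' : {set K}) (h : K -> G) :
  {in S' &, injective h} -> h @: S' = S ->
  {in S' &, forall x y, adj (h x) (h y) -> adj x y} ->
  arcs S <= arcs S' /\ #|S| = #|S'|.
Proof.
move=> hI <- hE; split; last by rewrite card_in_imset.
rewrite !arcs_sum big_imset //=; apply: leq_sum => x xS; rewrite big_imset //=.
by apply: leq_sum => y yS; have := hE x y xS yS; case: (adj (h x) (h y)) => // ->.
Qed.

Lemma conn_step (T : finType) (r : rel T) (S : {set T}) x y :
  conn r S x y -> x != y -> exists2 z, z \in S & r x z /\ z != x.
Proof.
move=> c xy; case: (pickP [pred z in S | r x z && (z != x)]) => [z /and3P[? ? ?]|none].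
  by exists z.
have : y \in [set x].
  apply: (conn_closed _ (set11 x) c) => u v /set1P-> _ vS rv; rewrite inE.
  by have := none v; rewrite /= vS rv /= => /negbFE.
by rewrite inE eq_sym (negbTE xy).
Qed.

End Reroute.

Section LinkPieces.

Lemma subset_of_card (T : finType) (S : {set T}) n : n <= #|S| ->
  exists2 S' : {set T}, S' \subset S & #|S'| = n.
Proof.
move=> nS; exists [set x in take n (enum S)].
  by apply/subsetP => x; rewrite inE => /mem_take; rewrite mem_enum.
rewrite cardsE (card_uniqP _) ?take_uniq ?enum_uniq // size_take -cardE.
by case: ltngtP nS.
Qed.

Lemma card_sub_bigcup (T : finType) (n P : nat) (R : 'I_n -> {set T}) (U : {set T}) :
  (forall i, #|R i :&: U| <= P) -> #|(\bigcup_i R i) :&: U| <= n * P.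
Proof.
move=> h; have -> : (\bigcup_i R i) :&: U = \bigcup_i (R i :&: U).
  by rewrite setIC big_distrr; apply: eq_bigr => i _; rewrite /= setIC.
exact: disjoint_card_bigcup.
Qed.

(* Besides the vertices of the pieces which are off the linking sets, every linking set becomes one vertex;
   it is adjacent to both pieces that it links. *)
Lemma link_pieces (G : sgraph) (s M k K q : nat) (P : 'I_s.+1 -> {set G}) :
  0 < q -> 8 * s.+1 * (6 * M).+3 * q <= k -> s * q <= K -> rconn [set: G] K ->
  (forall i, [/\ rconn (P i) k, k.+2 <= #|P i| & #|P i| <= M * k]) ->
  (forall i j, i != j -> [disjoint P i & P j]) ->
  exists (G2 : sgraph) (V : 'I_s.+1 -> {set G2}),
  [/\ is_minor G2 G, forall i j, i != j -> [disjoint V i & V j], rconn [set: G2] q.-1,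
      q < #|G2| <= s.+1 * M * k &
      forall i, exists Y : {set G}, [/\ 2 * #|Y| <= k, arcs (P i :\: Y) <= arcs (V i)
         & #|P i :\: Y| = #|V i|]].
Proof.
(* [P ord0] acts as a hub: each of the [s] other pieces gets [q] disjoint links to it, so deleting
   fewer than [q] vertices of the new graph leaves every piece linked. *)
move=> q0 qk sqK rG hP dP; pose Q := s * q.
have k0 : 0 < k by apply: leq_trans qk; rewrite !muln_gt0 q0.
have qk1 : 2 * q <= k by apply: leq_trans qk; rewrite leq_mul2r; apply/orP; right; clear; lia.
have Qk : 8 * ((6 * M).+3 * Q) <= k.
  apply: leq_trans qk; rewrite /Q.
  have -> : 8 * ((6 * M).+3 * (s * q)) = 8 * s * (6 * M).+3 * q by ring.
  by rewrite leq_mul2r leq_mul2r leq_mul2l leqnSn !orbT.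
have Qkk : 8 * Q <= k.
  apply: leq_trans Qk; rewrite leq_mul2l /= -[X in X <= _]mul1n leq_mul2r; apply/orP; right; by [].
have Pbig i : k.+2 <= #|P i| by have [] := hP i.
have /fin_all_exists2[T TP Tq] (i : 'I_s) : exists2 S : {set G}, S \subset P (lift ord0 i) & #|S| = q.
  by apply: subset_of_card; have := Pbig (lift ord0 i); lia.
have [T0 T0P T0Q] : exists2 S : {set G}, S \subset P ord0 & #|S| = Q.
  by apply: subset_of_card; have := Pbig ord0; lia.
pose A := \bigcup_i T i.
have dT i j : i != j -> [disjoint T i & T j].
  move=> ij; apply: disjointWl (TP i) (disjointWr (TP j) _).
  by apply: dP; rewrite (inj_eq lift_inj).
have AQ : #|A| = Q.
  rewrite -sum1_card partition_disjoint_bigcup //.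
  rewrite (eq_bigr (fun _ => q)) => [|i _]; last by rewrite sum1_card Tq.
  by rewrite sum_nat_const card_ord.
(* Both sides have [Q] vertices and Q <= K, so fewer than [Q] deletions leave a vertex on each side
   and a connected graph. *)
have [|R0 [cR0 AR0 dR0]] := @menger G Q (@adj G) A T0 (@adj_sym G).
  move=> X XQ.
  have [a aA] : exists a, a \in A :\: X.
    by apply/set0Pn; rewrite setD_eq0; apply: contraL XQ => /subset_leq_card; rewrite AQ leqNgt.
  have [b bT] : exists b, b \in T0 :\: X.
    by apply/set0Pn; rewrite setD_eq0; apply: contraL XQ => /subset_leq_card; rewrite T0Q leqNgt.
  exists a, b; split=> //; rewrite -setTD; apply: rG.
  + by apply: leq_trans (ltnW XQ) sqK.
  + by move: aA; rewrite !inE => /andP[->].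
  + by move: bT; rewrite !inE => /andP[->].
have /fin_all_exists[ab abP] j : exists p : G * G,
    [/\ p.1 \in A, p.2 \in T0, p.1 \in R0 j & p.2 \in R0 j].
  by have [a [b h]] := AR0 j; exists (a, b).
have hR0 j : [/\ connset (@adj G) (R0 j), (ab j).1 \in R0 j & (ab j).2 \in R0 j].
  by have [_ _ ? ?] := abP j.
have [|R [hR dR useR]] := reroute_all hP dP k0 _ hR0 dR0.
  by move: Qk; clear; lia.
pose a j := (ab j).1; pose b j := (ab j).2.
have aR j : a j \in R j by have [] := hR j.
have bR j : b j \in R j by have [] := hR j.
have aI : injective a.
  move=> i j E; apply/eqP; apply: contraT => /dR d.
  by have := disjointFr d (aR i); rewrite E aR.
have aA : [set a j | j : 'I_Q] = A.
  apply/eqP; rewrite eqEcard card_imset // card_ord AQ leqnn andbT.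
  by apply/subsetP => _ /imsetP[j _ ->]; have [] := abP j.
pose X := \bigcup_j R j.
have XP i : 2 * #|X :&: P i| + 2 * q <= k.
  have := card_sub_bigcup (fun j => useR i j).
  rewrite -/X => h; have : 2 * #|X :&: P i| + 2 * q <= 2 * (s * q * (6 * M).+3) + 2 * q.
    by rewrite leq_add2r leq_mul2l h.
  move/leq_trans; apply; apply: leq_trans qk.
  have -> : 8 * s.+1 * (6 * M).+3 * q = 8 * (s * q * (6 * M).+3) + 8 * (6 * M).+3 * q by ring.
  apply: leq_add; first by rewrite leq_mul2r orbT.
  by rewrite leq_mul2r; apply/orP; right; clear; lia.
pose UP := \bigcup_i P i.
pose I := ({z : G | z \in UP :\: X} + 'I_Q)%type.
pose B (x : I) := match x with inl z => [set val z] | inr j => R j end.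
(* One representative per branch set: a set of deleted vertices has an image in [G] that is no
   larger. Representing a link by [a j] shows which vertices of the [T i] are hit. *)
pose h (x : I) := match x with inl z => val z | inr j => a j end.
pose G2 := quot B.
have RX j : R j \subset X by apply: bigcup_sup.
have valX (z : {z : G | z \in UP :\: X}) : val z \notin X.
  by have := valP z; rewrite inE => /andP[].
have hB x : h x \in B x by case: x => [z|j] /=; rewrite ?set11.
have cB x : connected_in (B x).
  case: x => [z|j] /=; first exact: connected_in1.
  by apply/connected_inE; split; [apply/set0Pn; exists (a j)|have [] := hR j].
have dB x y : x != y -> [disjoint B x & B y].
  case: x => [z|i]; case: y => [w|j] //= ne.
  - by rewrite disjoints1 inE; apply: contra_neq ne => E; congr inl; apply: val_inj.
  - by rewrite disjoints1; apply: contra (valX z); apply/subsetP/RX.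
  - by rewrite disjoint_sym disjoints1; apply: contra (valX w); apply/subsetP/RX.
  - by apply: dR; apply: contra_neq ne => ->.
have hI : injective h.
  move=> x y E; apply/eqP; apply: contraT => /dB d.
  by have := disjointFr d (hB x); rewrite E hB.
have hadj (x y : G2) : adj (h x) (h y) -> adj x y.
  move=> axy; have ne : x != y by apply: contraTneq axy => ->; rewrite adj_irrefl.
  exact: (@quot_adjI G I B x y (h x) (h y)).
pose V i : {set G2} := [set x : I | if x is inl z then val z \in P i else false].
have VP i x : reflect (exists z, x = inl z /\ val z \in P i) (x \in V i).
  rewrite inE; case: x => [z|j]; last by constructor=> -[z []].
  by apply: (iffP idP) => [zP|[w [[->]]]] //; exists z.
have liftV i z : z \in P i -> z \notin X -> exists2 x, x \in V i & h x = z.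
  move=> zP zX; have zU : z \in UP :\: X.
    by rewrite inE zX; apply/bigcupP; exists i.
  by exists (inl (exist _ z zU)) => //; apply/VP; exists (exist _ z zU).
have dV i j : i != j -> [disjoint V i & V j].
  move=> ij; rewrite disjoints_subset; apply/subsetP => x /VP[z [-> zi]].
  by rewrite inE; apply/VP => -[w [[<-] zj]]; have := disjointFr (dP i j ij) zi; rewrite zj.
have hV i : h @: V i = P i :\: (X :&: P i).
  apply/setP => z; apply/imsetP/idP => [[x /VP[w [-> wP]] ->]|].
    by rewrite !inE wP andbT (negbTE (valX w)).
  by rewrite !inE => /andP[+ zP]; rewrite zP andbT => zX; have [x xV <-] := liftV i z zP zX; exists x.
have V_big i : q <= #|V i|.
  have := card_in_imset (f := h) (D := mem (V i)) (fun x y _ _ => @hI x y).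
  rewrite hV => <-; have := XP i; have := Pbig i; have := cardsID (X :&: P i) (P i).
  have := subset_leq_card (subsetIr (P i) (X :&: P i)); clear; lia.
have rconnG2 : rconn [set: G2] q.-1.
  move=> X' X'q.
  have X'_lt : #|X'| < q by rewrite -(prednK q0).
  have hX' : #|h @: X'| <= #|X'| by apply: leq_imset_card.
  have ne_V i : exists x, x \in V i :\: X'.
    apply/set0Pn; rewrite setD_eq0; apply: contraL X'_lt => /subset_leq_card le.
    by rewrite -leqNgt; apply: leq_trans (V_big i) le.
  (* Inside a piece, the vertices of the links and the deleted ones together number at most [k], so
     the rest of the piece stays connected. *)
  have core i x y : x \in V i :\: X' -> y \in V i :\: X' -> conn (@adj G2) ([set: G2] :\: X') x y.
    move=> xV yV; pose S := P i :\: ((X :&: P i) :|: h @: X').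
    have inS z : z \in V i :\: X' -> h z \in S.
      move=> /setDP[zV zX']; have : h z \in P i :\: (X :&: P i) by rewrite -hV imset_f.
      move=> /setDP[hzP hzX]; rewrite /S in_setD in_setU negb_or hzX hzP andbT /=.
      apply/imsetP => -[w wX' /hI E].
      by rewrite E wX' in zX'.
    apply: (connS (S := V i :\: X')); first by rewrite setSD ?subsetT.
    apply: (@conn_lift _ _ (@adj G) _ h S) => //.
    + move=> z; rewrite !inE negb_or negb_and => /andP[/andP[zX zX'] zP].
      rewrite zP orbF in zX; have [x' x'V hx] := liftV i z zP zX; exists x' => //.
      by rewrite inE x'V andbT; apply: contra zX' => x'X; apply/imsetP; exists x'.
    + by move=> u v _ _; apply: hI.
    + by move=> u v _ _; apply: hadj.
    have [rP _ _] := hP i; apply: rP; [|exact: inS|exact: inS].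
    have := (leq_card_setU (X :&: P i) (h @: X')).1; have := XP i.
    move: hX' X'_lt; clear; lia.
  (* The vertex [e] of a link is put back while all other link vertices of the piece stay deleted.
     Robust connectivity gives [e] a surviving neighbour in the piece, so the contracted link is
     adjacent to it. *)
  have touch i j e x : e \in R j -> e \in P i -> inr j \notin X' -> x \in V i :\: X' ->
      conn (@adj G2) ([set: G2] :\: X') (inr j : G2) x.
    move=> eR eP jX' xV; pose Xl := [set z | [exists w in X', if w is inl v then val v == z else false]].
    pose S := P i :\: (((X :&: P i) :\ e) :|: Xl).
    have eX : e \in X by apply: (subsetP (RX j)).
    have XlX z : z \in Xl -> z \notin X.
      by rewrite inE => /exists_inP[[v|//] _ /eqP <-]; apply: valX.
    have Xl_le : #|Xl| <= #|X'|.
      apply: leq_trans hX'; apply: subset_leq_card; apply/subsetP => z.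
      by rewrite inE => /exists_inP[[v|//] vX /eqP <-]; apply/imsetP; exists (inl v).
    have eS : e \in S.
      have eXl : e \notin Xl by apply: contraL eX => /XlX.
      by rewrite /S in_setD eP andbT in_setU negb_or eXl andbT in_setD1 eqxx.
    have hxV : h x \in P i :\: (X :&: P i) by rewrite -hV imset_f //; move: xV; rewrite inE => /andP[].
    have hxS : h x \in S.
      move: hxV xV; rewrite !inE negb_and => /andP[hxX hxP] /andP[xX' xVi].
      rewrite hxP orbF in hxX; rewrite hxP (negbTE hxX) !andbF andbT /=.
      apply/exists_inP => -[[v|//] vX /eqP vE]; case/negP: xX'.
      by have -> : x = inl v by apply: hI.
    have ehx : e != h x by apply: contraTneq hxV => <-; rewrite !inE eX eP.
    have ceS : conn (@adj G) S e (h x).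
      have [rP _ _] := hP i; apply: rP => //.
      have := (leq_card_setU ((X :&: P i) :\ e) Xl).1; have := XP i.
      have := subset_leq_card (subsetDl (X :&: P i) [set e]).
      move: Xl_le X'_lt; clear; lia.
    have [w wS [aew we]] := conn_step ceS ehx.
    move: wS; rewrite !inE we /= negb_or negb_and => /andP[/andP[wX wXl] wP].
    rewrite wP orbF in wX; have [y yV hy] := liftV i w wP wX.
    have yX' : y \notin X'.
      apply: contra wXl => yX'; apply/exists_inP; exists y => //.
      by have /VP[z [E _]] := yV; rewrite -hy E.
    have yV' : y \in V i :\: X' by rewrite inE yX'.
    apply: conn_trans (core i y x yV' xV).
    apply: conn1; rewrite ?inE ?jX' ?yX' //.
    apply: (@quot_adjI G I B (inr j) y e w) => //.
      by have /VP[z [-> _]] := yV.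
    by rewrite -hy.
  have [z0 z0V] := ne_V ord0.
  have viaR j : inr j \notin X' -> conn (@adj G2) ([set: G2] :\: X') (inr j : G2) z0.
    move=> jX'; apply: (touch ord0 j (b j)) => //.
    by apply: (subsetP T0P); have [] := abP j.
  have toz0 x : x \in [set: G2] :\: X' -> conn (@adj G2) ([set: G2] :\: X') x z0.
    rewrite !inE andbT => xX'; case: x xX' => [z|j] xX'; last exact: viaR.
    have /bigcupP[i _ zi] : val z \in UP by have := valP z; rewrite inE => /andP[].
    have xV : (inl z : G2) \in V i :\: X' by rewrite inE xX'; apply/VP; exists z.
    case: (unliftP ord0 i) => [i' Ei|Ei]; last by apply: (core ord0 _ _ _ z0V); rewrite -Ei.
    (* The [q] links starting in [T i'] cannot all be among the fewer than [q] deleted vertices. *)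
    have [t tT tX] : exists2 j, a j \in T i' & inr j \notin X'.
      have sub : T i' \subset [set a j | j : 'I_Q] by rewrite aA; apply: bigcup_sup.
      apply/exists_inP; apply: contraT; rewrite negb_exists_in => /forall_inP all_in.
      have : T i' \subset h @: X'.
        apply/subsetP => t tT; have /imsetP[j _ tj] := subsetP sub t tT.
        apply/imsetP; exists (inr j) => //; apply/negPn/all_in.
        by rewrite -tj.
      move/subset_leq_card; rewrite Tq; move: hX' X'_lt; clear; lia.
    apply: conn_trans (viaR t tX); rewrite conn_sym; last exact: adj_sym.
    apply: (touch i t (a t)) => //.
    by rewrite Ei; apply: (subsetP (TP i')).
  by apply: (connset_from (@adj_sym G2) (x := z0)) => x xS; rewrite conn_sym ?toz0 //; apply: adj_sym.
exists G2, V; split=> //.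
- exact: quot_minor.
- have cG2 : #|G2| = #|UP :\: X| + Q by rewrite card_sum card_ord card_sig.
  have AX : A \subset UP :&: X.
    apply/subsetP => t tA; rewrite inE; apply/andP; split.
      have /bigcupP[i _ ti] := tA; apply/bigcupP; exists (lift ord0 i) => //.
      exact: (subsetP (TP i)).
    by move: tA; rewrite -aA => /imsetP[j _ ->]; apply: (subsetP (RX j)).
  have := subset_leq_card AX; rewrite AQ => AX_le.
  have := cardsID X UP => cU.
  have UPk : #|UP| <= s.+1 * (M * k) by apply: disjoint_card_bigcup => i; have [] := hP i.
  apply/andP; split; last by rewrite -mulnA; move: cG2 AX_le cU UPk; clear; lia.
  have sub : P ord0 :\: (X :&: P ord0) \subset UP :\: X.
    apply/subsetP => z; rewrite !inE negb_and => /andP[zX zP]; rewrite zP orbF in zX.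
    by rewrite zX; apply/bigcupP; exists ord0.
  have := subset_leq_card sub; have := XP ord0; have := Pbig ord0.
  have := cardsID (X :&: P ord0) (P ord0).
  have := subset_leq_card (subsetIr (P ord0) (X :&: P ord0)); move: cG2 q0; clear; lia.
move=> i; exists (X :&: P i); have [||le eq] := @arcs_map G G2 (P i :\: (X :&: P i)) (V i) h _ (hV i).
- by move=> x y _ _; apply: hI.
- by move=> x y _ _; apply: hadj.
by split=> //; have := XP i; clear; lia.
Qed.

End LinkPieces.

(** * Minimal minors and dense pieces *)

Lemma exists_minimal (T : Type) (P : T -> Prop) (f : T -> nat) :
  (exists x, P x) -> exists2 x, P x & forall y, P y -> f x <= f y.
Proof.
move=> [x Px]; have [n] := ubnP (f x); elim: n x Px => // n IH x Px; rewrite ltnS => xn.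
have [h|] := EM (exists2 y, P y & f y < f x).
  by have [y Py yx] := h; apply: (IH y Py); apply: leq_trans yx xn.
move=> none; exists x => // y Py; rewrite leqNgt; apply/negP => yx.
by apply: none; exists y.
Qed.

Section Rich.
Variable R : realType.
Local Open Scope ring_scope.

(** Mader's condition e(U) > d (|U| - a d). The subtracted a d makes small separators incompatible
    with minimality. *)
Definition rich (d a : R) (G : sgraph) (U : {set G}) :=
  d <= #|U|%:R /\ 2 * d * (#|U|%:R - a * d) < (arcs U)%:R.

(** A separator of [k] vertices yields two proper subsets covering all edges with |A| + |B| <= |U| +
    k. The minimum degree gives both at least [d] vertices, so neither is rich, and e(U) <= d (|U| +
    k - 2 a d), a contradiction when k <= a d. *)
Lemma rich_min (d a : R) (G : sgraph) (U : {set G}) :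
  0 < d -> 0 <= a -> a <= 1 / 2 -> rich d a U ->
  (forall U' : {set G}, U' \proper U -> ~ rich d a U') ->
  (forall x, x \in U -> d < #|nbrs U x|%:R) /\ forall k, k%:R <= a * d -> rconn U k.
Proof.
move=> d0 a0 a2 [dU EU] min.
have nr (U' : {set G}) : U' \proper U -> d <= #|U'|%:R ->
    (arcs U')%:R <= 2 * d * (#|U'|%:R - a * d).
  by move=> pU dU'; rewrite leNgt; apply/negP => h; apply: (min U' pU).
have U0 : (0 < #|U|)%N by rewrite -(ltr_nat R); apply: lt_le_trans dU.
(* Room for deleting a vertex: on fewer than d + 1 vertices not even a clique has enough edges,
   because a <= 1/2. *)
have U1 : d + 1 <= #|U|%:R.
  rewrite leNgt; apply/negP => lt.
  have h1 : (arcs U)%:R <= #|U|%:R * (#|U|%:R - 1) :> R.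
    have -> : #|U|%:R - 1 = #|U|.-1%:R :> R by rewrite -{1}(prednK U0) -addn1 natrD addrK.
    by rewrite -natrM ler_nat arcs_le.
  have h2 : #|U|%:R * (#|U|%:R - 1) <= #|U|%:R * d :> R by rewrite ler_wpM2l //; lra.
  have h3 : a * d <= 1 / 2 * #|U|%:R.
    by apply: le_trans (ler_wpM2r (ltW d0) a2) _; rewrite ler_pM2l //; lra.
  have h4 : d * (a * d) <= d * (1 / 2 * #|U|%:R) by rewrite ler_pM2l.
  move: EU h1 h2 h4; clear; lra.
have deg x : x \in U -> d < #|nbrs U x|%:R.
  move=> xU; have c1 : #|U|%:R = #|U :\ x|%:R + 1 :> R.
    by rewrite (cardsD1 x U) xU addnC natrD.
  have := nr (U :\ x) (properD1 xU); rewrite c1 in U1 EU.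
  have -> : d <= #|U :\ x|%:R by lra.
  move=> /(_ isT) h; move: EU; rewrite (arcsD1 xU) natrD natrM => EU.
  by move: EU h; clear; lra.
split=> // k ka X Xk x y xU yU; apply: contraT => nc.
pose C := [set z in U :\: X | conn (@adj G) (U :\: X) x z].
have CU : C \subset U by apply/subsetP => z; rewrite !inE => /andP[/andP[]].
have xC : x \in C by rewrite inE xU; apply: connect0.
have yC : y \notin C by rewrite inE yU.
have nb z w : z \in C -> w \in U -> adj z w -> w \in C :|: (U :&: X).
  move=> zC wU azw; rewrite !inE wU; have [wX|wX] := boolP (w \in X); first by rewrite orbT.
  rewrite orbF /=; move: zC; rewrite inE => /andP[zU cz].
  by apply: conn_trans cz _; apply: conn1; rewrite // inE wX.
have xU' : x \in U by move: xU; rewrite inE => /andP[].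
have [yX yU'] : y \notin X /\ y \in U by move: yU; rewrite inE => /andP[].
have pA : C :|: (U :&: X) \proper U.
  apply/properP; split; first by rewrite subUset CU subsetIl.
  by exists y => //; rewrite in_setU negb_or yC /= in_setI negb_and yX orbT.
have pB : U :\: C \proper U.
  by apply/properP; split; [apply: subsetDl|exists x => //; rewrite inE xC].
have dA : d <= #|C :|: (U :&: X)|%:R.
  apply: le_trans (ltW (deg x xU')) _; rewrite ler_nat subset_leq_card //.
  by apply/subsetP => w; rewrite [w \in nbrs _ _]inE => /andP[wU a']; apply: nb a'.
have dB : d <= #|U :\: C|%:R.
  apply: le_trans (ltW (deg y yU')) _; rewrite ler_nat subset_leq_card //.
  apply/subsetP => w; rewrite [w \in nbrs _ _]inE => /andP[wU a'].
  rewrite in_setD wU andbT; apply/negP => wC; have := nb w y wC yU'.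
  by rewrite adj_sym => /(_ a'); rewrite in_setU (negbTE yC) inE (negbTE yX) andbF.
have sA := nr _ pA dA; have sB := nr _ pB dB.
have tot : (arcs U)%:R <= (arcs (C :|: (U :&: X)))%:R + (arcs (U :\: C))%:R :> R.
  rewrite -natrD ler_nat; apply: arcsU.
    by apply/subsetP => z zU; rewrite !in_setU in_setD zU andbT; case: (z \in C); rewrite ?orbT.
  move=> u v uU vU auv; rewrite !in_setD uU vU !andbT.
  have [uC|uC] := boolP (u \in C).
    by rewrite (nb u v uC vU auv) in_setU uC.
  have [vC|vC] := boolP (v \in C); last by rewrite orbT.
  by rewrite adj_sym in auv; rewrite (nb v u vC uU auv) /= in_setU vC.
have cc : #|C :|: (U :&: X)|%:R + #|U :\: C|%:R <= #|U|%:R + k%:R :> R.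
  rewrite -!natrD ler_nat; have := (leq_card_setU C (U :&: X)).1.
  have := subset_leq_card (subsetIr U X); have := cardsID C U; rewrite (setIidPr CU).
  by move: Xk; clear; lia.
have h1 : d * (#|C :|: (U :&: X)|%:R + #|U :\: C|%:R) <= d * (#|U|%:R + k%:R) by rewrite ler_pM2l.
have h2 : d * k%:R <= d * (a * d) by rewrite ler_pM2l.
by exfalso; move: sA sB tot h1 h2 EU; clear; lra.
Qed.

(** A smallest rich subset works: being rich with at least [d] vertices forces density at least d (1
    - a). Only subsets are minimised over, so the result stays inside [U]. *)
Lemma rich_sub (d a : R) (G : sgraph) (U : {set G}) :
  0 < d -> 0 < a -> a <= 1 / 2 -> (0 < #|U|)%N -> 2 * d * #|U|%:R <= (arcs U)%:R ->
  exists U' : {set G}, [/\ U' \subset U, d * (1 - a) <= (arcs U')%:R / (2 * #|U'|%:R),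
    d + 1 < #|U'|%:R & forall k, k%:R <= a * d -> rconn U' k].
Proof.
move=> d0 a0 a2 U0 EU; have Up : 0 < #|U|%:R :> R by rewrite ltr0n.
have rU : rich d a U.
  split; last by apply: lt_le_trans EU; rewrite ltr_pM2l ?mulr_gt0 // gtrBl mulr_gt0.
  have h1 : (arcs U)%:R <= #|U|%:R * #|U|%:R :> R.
    by rewrite -natrM ler_nat (leq_trans (arcs_le U)) // leq_mul2l leq_pred orbT.
  have : 2 * d * #|U|%:R <= #|U|%:R * #|U|%:R by apply: le_trans EU h1.
  by rewrite ler_pM2r //; lra.
have [U' [sU r] min] := @exists_minimal {set G} (fun V => V \subset U /\ rich d a V)
   (fun V => #|V|) (ex_intro _ U (conj (subxx U) rU)).
have [|deg conn] := rich_min d0 (ltW a0) a2 r.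
  move=> V VU rV; have := proper_card VU; rewrite ltnNge min //; split=> //.
  by apply: subset_trans (proper_sub VU) sU.
have U'0 : (0 < #|U'|)%N by rewrite -(ltr_nat R); apply: lt_le_trans d0 _; case: r.
have [x xU'] := card_gt0P U'0; have [dU' EU'] := r.
have Up' : 0 < #|U'|%:R :> R by rewrite ltr0n.
exists U'; split=> //.
  rewrite ler_pdivlMr ?mulr_gt0 //.
  have h1 : d * (a * d) <= d * (a * #|U'|%:R) by rewrite ler_pM2l // ler_pM2l.
  by move: EU' h1; clear; lra.
have := deg x xU'; have : (#|nbrs U' x|.+1 <= #|U'|)%N.
  rewrite (cardsD1 x U') xU' add1n ltnS subset_leq_card //; apply/subsetP => z.
  by rewrite !inE => /andP[-> axz]; rewrite andbT; apply: contraTneq axz => ->; rewrite adj_irrefl.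
by rewrite -(ler_nat R) -addn1 natrD; clear; lra.
Qed.

End Rich.

Section MinimalMinor.

Lemma induced_minor (G : sgraph) (U : {set G}) :
  exists G' : sgraph, [/\ is_minor G' G, #|G'| = #|U| & arcs U <= arcs [set: G']].
Proof.
pose B (z : {z : G | z \in U}) : {set G} := [set val z].
have inj : {in [set: quot B] &, injective (fun z : quot B => val z)}.
  by move=> x y _ _; apply: val_inj.
have [||le _] := @arcs_map G (quot B) U setT (fun z => val z) inj.
- apply/setP => z; apply/imsetP/idP => [[w _ ->]|zU]; first exact: valP.
  by exists (exist _ z zU).
- move=> x y _ _ a; apply: (@quot_adjI G _ B x y (val x) (val y)); rewrite ?set11 //.
  by apply: contraTneq a => ->; rewrite adj_irrefl.
exists (quot B); split=> //; last by rewrite card_sig; apply: eq_card.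
apply: quot_minor => [z|z w zw]; first exact: connected_in1.
by rewrite disjoints1 inE.
Qed.

(** The edge xy disappears and the two edges to each common neighbour merge; nothing else is lost.
    The vertex [y] leaves the index type and [x] stands for the merged vertex. *)
Lemma contraction_minor (G : sgraph) (x y : G) : adj x y ->
  exists G' : sgraph, [/\ is_minor G' G, #|G'|.+1 = #|G| &
    arcs [set: G] <= arcs [set: G'] + 2 + 2 * #|nbrs (nbrs setT x) y|].
Proof.
move=> axy; have xy : x != y by apply: contraTneq axy => ->; rewrite adj_irrefl.
pose I := {z : G | z != y}.
pose B (z : I) : {set G} := if val z == x then [set x; y] else [set val z].
pose G' := quot B.
pose x' : G' := exist _ x xy.
have Bx' : B x' = [set x; y] by rewrite /B /= eqxx.
have BE (z : G') : z != x' -> B z = [set val z].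
  by move=> zx; rewrite /B; case: eqP => // E; case/eqP: zx; apply: val_inj.
have inj (S : {set G'}) : {in S &, injective (fun z : G' => val z)}.
  by move=> u v _ _; apply: val_inj.
have [||le _] := @arcs_map G G' ((setT :\ y) :\ x) (setT :\ x') (fun z => val z) (inj _).
- apply/setP => z; apply/imsetP/idP => [[w wx ->]|].
    rewrite !inE andbT (valP w) andbT; move: wx; rewrite !inE andbT.
    by apply: contra => /eqP E; apply/eqP; apply: val_inj.
  rewrite !inE andbT => /andP[zx zy]; exists (exist _ z zy) => //.
  by rewrite !inE andbT; apply: contra zx => /eqP/(congr1 val)/= ->.
- move=> u v; rewrite !inE !andbT => ux vx a.
  apply: (@quot_adjI G _ B u v (val u) (val v)) => //.
  + by apply: contraTneq a => ->; rewrite adj_irrefl.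
  + by rewrite BE // set11.
  + by rewrite BE // set11.
pose Nx := nbrs [set: G] x; pose Ny := nbrs [set: G] y.
have degx : #|(Nx :\ y) :|: (Ny :\ x)| <= #|nbrs [set: G'] x'|.
  rewrite -(card_in_imset (f := fun z : G' => val z) (inj _)) subset_leq_card //.
  apply/subsetP => z zN; have [zx zy] : z != x /\ z != y.
    move: zN; rewrite !inE => /orP[/andP[-> a]|/andP[-> a]]; split=> //.
      by apply: contraTneq a => ->; rewrite adj_irrefl.
    by apply: contraTneq a => ->; rewrite adj_irrefl.
  apply/imsetP; exists (exist _ z zy) => //; rewrite inE in_setT /=.
  have zx' : (exist _ z zy : G') != x' by apply: contra zx => /eqP/(congr1 val)/= ->.
  have : adj x z || adj y z.
    by move: zN; rewrite !inE /= => /orP[/andP[_ ->]|/andP[_ ->]]; rewrite ?orbT.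
  case/orP=> a.
    apply: (@quot_adjI G _ B _ _ x z) => //; rewrite 1?eq_sym ?Bx' ?BE ?set11 //.
    by rewrite set21.
  apply: (@quot_adjI G _ B _ _ y z) => //; rewrite 1?eq_sym ?Bx' ?BE ?set11 //.
  by rewrite set22.
have cI : (Nx :\ y) :&: (Ny :\ x) \subset nbrs (nbrs setT x) y.
  by apply/subsetP => z; rewrite !inE => /andP[/andP[_ ->] /andP[_ ->]].
have cU : #|(Nx :\ y) :|: (Ny :\ x)| + #|(Nx :\ y) :&: (Ny :\ x)| = #|Nx :\ y| + #|Ny :\ x|.
  by rewrite cardsU subnK // (leq_trans (subset_leq_card (subsetIl _ _))) // leq_addr.
have e1 := arcsD1 (in_setT y); have e2 : arcs (setT :\ y) = _ := arcsD1 (_ : x \in setT :\ y).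
have xS : x \in [set: G] :\ y by rewrite !inE xy.
have {}e2 := arcsD1 xS; have e3 := arcsD1 (in_setT x').
have e4 : nbrs (setT :\ y) x = Nx :\ y by apply/setP => z; rewrite !inE andbT.
have e5 : #|Ny| = #|Ny :\ x| + 1 by rewrite (cardsD1 x Ny) !inE adj_sym axy addnC.
have cI' := subset_leq_card cI.
exists G'; split.
- apply: quot_minor => [z|z w zw].
    rewrite /B; case: ifP => _; [exact: connected_in2|exact: connected_in1].
  have [zx|zx] := eqVneq z x'; have [wx|wx] := eqVneq w x'.
  + by rewrite zx wx eqxx in zw.
  + rewrite zx Bx' BE // disjoint_sym disjoints1 !inE negb_or (valP w) andbT.
    by apply: contra wx => /eqP E; apply/eqP; apply: val_inj.
  + rewrite wx Bx' BE // disjoints1 !inE negb_or (valP z) andbT.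
    by apply: contra zx => /eqP E; apply/eqP; apply: val_inj.
  + by rewrite !BE // disjoints1 inE; apply: contra zw => /eqP E; apply/eqP; apply: val_inj.
- rewrite card_sig; transitivity (#|predC1 y|.+1); first by congr _.+1; apply: eq_card.
  by rewrite cardC1 prednK //; apply/card_gt0P; exists y.
rewrite e4 in e2; rewrite -/Ny in e1.
move: e1 e2 e3 e5 le degx cU cI'; clear; lia.
Qed.

Local Open Scope ring_scope.

(** One vertex fewer lowers the threshold on [arcs] by 2 d. A contraction must destroy richness,
    hence lose more than 2 d arcs, which forces more than d - 1 common neighbours. *)
Lemma minimal_minor (R : realType) (d a : R) (G : sgraph) :
  3 <= d -> 0 <= a -> a <= 1 / 2 -> rich d a [set: G] ->
  exists G' : sgraph, [/\ is_minor G' G, rich d a [set: G'],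
    (forall x : G', d < #|nbrs setT x|%:R) /\ (forall k, k%:R <= a * d -> rconn [set: G'] k),
    forall x y : G', adj x y -> d - 1 < #|nbrs (nbrs setT x) y|%:R
    & (arcs [set: G'])%:R <= 4 * d * #|G'|%:R].
Proof.
move=> d3 a0 a2 rG; have d0 : 0 < d by lra.
have idm : is_minor G G.
  exists (fun v => [set v]); first split.
  - by move=> v; apply: connected_in1.
  - by move=> u v a'; exists u, v; rewrite !set11.
  - by move=> u v; rewrite disjoints1 inE.
have [G' [mG' rG'] min] := @exists_minimal sgraph (fun K => is_minor K G /\ rich d a [set: K])
   (fun K => #|K|) (ex_intro _ G (conj idm rG)).
have small (K : sgraph) : is_minor K G' -> (#|K| < #|G'|)%N -> ~ rich d a [set: K].
  by move=> mK lt rK; move: lt; rewrite ltnNge min //; split=> //; apply: minor_trans mK mG'.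
have nr (U : {set G'}) : U \proper [set: G'] -> ~ rich d a U.
  move=> pU [dU EU]; have [K [mK cK aK]] := induced_minor U.
  apply: (small K mK); first by rewrite cK -cardsT proper_card.
  by split; rewrite cardsT cK //; apply: lt_le_trans EU _; rewrite ler_nat.
have [deg conn] := rich_min d0 a0 a2 rG' nr.
have degT x : d < #|nbrs [set: G'] x|%:R by apply: deg; rewrite inE.
have nG' : #|[set: G']| = #|G'| by rewrite cardsT.
have [dG EG] := rG'; rewrite nG' in dG EG.
have [x0 _] : exists x0 : G', x0 \in [set: G'].
  by apply/set0Pn; rewrite -card_gt0 nG' -(ltr_nat R); apply: lt_le_trans d0 dG.
have bigG : d + 1 <= #|G'|%:R.
  have lt : (#|nbrs [set: G'] x0|.+1 <= #|G'|)%N.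
    rewrite -nG' (cardsD1 x0 [set: G']) inE add1n ltnS subset_leq_card //; apply/subsetP => z.
    by rewrite !inE => /= axz; rewrite andbT; apply: contraTneq axz => ->; rewrite adj_irrefl.
  by move: lt (degT x0); rewrite -(ler_nat R) -addn1 natrD; clear; lra.
exists G'; split=> //.
  move=> x y axy; have [K [mK cK aK]] := contraction_minor axy.
  have cKr : #|G'|%:R = #|K|%:R + 1 :> R by rewrite -cK -addn1 natrD.
  have : ~~ (2 * d * (#|K|%:R - a * d) < (arcs [set: K])%:R).
    apply/negP => EK; apply: (small K mK); first by rewrite -cK.
    by split; rewrite cardsT //; lra.
  have aKr : (arcs [set: G'])%:R <= (arcs [set: K])%:R + 2 + 2 * #|nbrs (nbrs setT x) y|%:R :> R.
    by rewrite -natrM -!natrD ler_nat.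
  rewrite -leNgt; move: aKr; rewrite cKr in EG; move: EG; clear; lra.
(* Deleting [x] leaves a graph that is not rich, so [arcs] is at most 2 d |G'| + 2 deg x. With at
   least d + 1 >= 4 vertices and [x] of minimum degree, 2 deg x is at most half of [arcs]. *)
pose x := [arg min_(x < x0) #|nbrs [set: G'] x|].
have minx y : (#|nbrs [set: G'] x| <= #|nbrs [set: G'] y|)%N.
  by rewrite /x; case: arg_minnP => // z _; apply.
have sumdeg : (#|G'| * #|nbrs [set: G'] x| <= arcs [set: G'])%N.
  by rewrite -nG' -sum_nat_const; apply: leq_sum => y _; apply: minx.
have pD : [set: G'] :\ x \proper [set: G'] by apply: properD1.
have cD : #|[set: G'] :\ x|%:R + 1 = #|G'|%:R :> R.
  by rewrite -nG' (cardsD1 x [set: G']) inE addnC natrD.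
have : ~~ (2 * d * (#|[set: G'] :\ x|%:R - a * d) < (arcs ([set: G'] :\ x))%:R).
  by apply/negP => E; apply: (nr _ pD); split=> //; lra.
rewrite -leNgt => h1.
have h2 := arcsD1 (in_setT x : x \in [set: G']).
have h2r : (arcs [set: G'])%:R = (arcs ([set: G'] :\ x))%:R + 2 * #|nbrs [set: G'] x|%:R :> R.
  by rewrite h2 natrD natrM.
have h3 : 4 * #|nbrs [set: G'] x|%:R <= (arcs [set: G'])%:R :> R.
  apply: (@le_trans _ _ (#|G'|%:R * #|nbrs [set: G'] x|%:R)).
    by rewrite ler_wpM2r //; lra.
  by rewrite -natrM ler_nat.
have h4 : 0 <= d * (a * d) by rewrite !mulr_ge0 // ltW.
have h5 : d * #|[set: G'] :\ x|%:R <= d * #|G'|%:R by rewrite ler_pM2l //; lra.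
by move: h1 h2r h3 h4 h5; clear; lra.
Qed.

End MinimalMinor.

Lemma sum_setU (T : finType) (A B : {set T}) (F : T -> nat) : [disjoint A & B] ->
  \sum_(x in A :|: B) F x = \sum_(x in A) F x + \sum_(x in B) F x.
Proof. by move=> d; rewrite -bigU //; apply: eq_bigl => x; rewrite inE. Qed.

Section Pieces.
Variable R : realType.
Local Open Scope ring_scope.

(* Outside W, a vertex v of moderate degree either sends almost D edges to W, or every neighbour of v outside W
   has many common neighbours with v outside W. *)
Lemma piece_or_dense (G : sgraph) (D e : R) (W : {set G}) (w : R) (sig : nat) :
  0 < D -> 0 < e -> e <= 1 ->
  (forall x : G, D < #|nbrs setT x|%:R) ->
  (forall x y : G, adj x y -> D - 1 < #|nbrs (nbrs setT x) y|%:R) ->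
  (arcs [set: G])%:R <= 4 * D * #|G|%:R ->
  #|W|%:R <= w -> w <= e * sig%:R -> 2 * (sig%:R + w) <= #|G|%:R ->
  (exists U : {set G}, [/\ (sig <= #|U|)%N, #|U|%:R <= w + sig%:R &
     2 * (D * (1 - e) ^+ 2) * #|U|%:R <= (arcs U)%:R]) \/
  exists Q : {set G}, [/\ [disjoint Q & W], (0 < #|Q|)%N, #|Q|%:R <= 8 * D &
    forall x, x \in Q -> e * D - 1 < #|nbrs Q x|%:R].
Proof.
move=> D0 e0 e1 deg codeg aG Ww wsig sigG.
pose A := [set v in ~: W | #|nbrs setT v|%:R <= 8 * D].
(* If [v] sends fewer than (1-e) D edges to [W], its neighbourhood off [W] is the new piece: of the
   more than D - 1 common neighbours of [v] and [x], more than e D - 1 remain. *)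
case: (pickP [pred v in A | #|nbrs W v|%:R < (1 - e) * D]) => [v|all_dense].
  case/andP; rewrite !inE => /andP[vW vdeg] vN; right.
  have splitN : #|nbrs setT v|%:R = #|nbrs W v|%:R + #|nbrs setT v :\: W|%:R :> R.
    rewrite -natrD -(cardsID W (nbrs setT v)); congr ((_ + _)%:R).
    by apply: eq_card => z; rewrite !inE andbC.
  have eD : 0 < e * D by rewrite mulr_gt0.
  exists (nbrs setT v :\: W); split.
  - by rewrite disjoints_subset; apply/subsetP => z; rewrite !inE => /andP[].
  - by rewrite -(ltr_nat R); have := deg v; rewrite splitN; move: vN eD; clear; lra.
  - by apply: le_trans vdeg; rewrite splitN lerDr.
  move=> x; rewrite !inE /= => /andP[xW avx].
  have := codeg v x avx.
  have -> : #|nbrs (nbrs setT v) x| = (#|nbrs (nbrs setT v) x :&: W| + #|nbrs (nbrs setT v :\: W) x|)%N.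
    rewrite -(cardsID W (nbrs (nbrs setT v) x)); congr (_ + _)%N.
    by apply: eq_card => z; rewrite !inE andbA.
  have le : (#|nbrs (nbrs setT v) x :&: W| <= #|nbrs W v|)%N.
    by apply: subset_leq_card; apply/subsetP => z; rewrite !inE /= => /andP[/andP[a1 _] a2]; rewrite ?a1 ?a2.
  by move: le; rewrite -(ler_nat R) natrD; move: vN; clear; lra.
left; have many v : v \in A -> (1 - e) * D <= #|nbrs W v|%:R.
  by move=> vA; rewrite leNgt; apply/negP => lt; have := all_dense v; rewrite /= vA lt.
pose Hi := [set v : G | 8 * D < #|nbrs setT v|%:R].
(* The mean degree is at most 4 D, so at most half of the vertices have degree above 8 D. *)
have Hi_small : 2 * #|Hi|%:R <= #|G|%:R :> R.
  have h : #|Hi|%:R * (8 * D) <= (arcs [set: G])%:R.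
    apply: (@le_trans _ _ (\sum_(v in Hi) #|nbrs [set: G] v|%:R)).
      by rewrite mulr_natl -sumr_const; apply: ler_sum => v; rewrite inE => /ltW.
    rewrite -natr_sum ler_nat /arcs big_mkcond [X in (_ <= X)%N]big_mkcond.
    by apply: leq_sum => v _; rewrite in_setT; case: ifP.
  have h2 : 4 * D * (2 * #|Hi|%:R) <= 4 * D * #|G|%:R.
    have -> : 4 * D * (2 * #|Hi|%:R) = #|Hi|%:R * (8 * D) by ring.
    exact: le_trans h aG.
  by rewrite ler_pM2l ?mulr_gt0 // in h2.
have A_big : (sig <= #|A|)%N.
  have cov : (#|G| <= #|A| + #|W| + #|Hi|)%N.
    rewrite -cardsT; have -> : [set: G] = A :|: W :|: Hi.
      apply/setP => v; rewrite !inE; case: (v \in W) => //=; rewrite ?orbT //.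
      by rewrite orbF; case: (leP _ (8 * D)).
    by rewrite (leq_trans (leq_card_setU _ _)) // leq_add2r leq_card_setU.
  rewrite -(ler_nat R); move: cov; rewrite -(ler_nat R) !natrD.
  by move: Hi_small Ww sigG; clear; lra.
(* Only the edges between [W] and [S] are counted: at least (1-e) D sig of them on at most (1+e) sig
   vertices. *)
have [S SA Ssig] := subset_of_card A_big.
have dSW : [disjoint W & S].
  rewrite disjoint_sym disjoints_subset; apply/subsetP => z /(subsetP SA).
  by rewrite !inE => /andP[].
have cU : #|W :|: S| = (#|W| + sig)%N by rewrite cardsU disjoint_setI0 // cards0 subn0 Ssig.
exists (W :|: S); split.
- by rewrite cU leq_addl.
- by rewrite cU natrD; lra.
have aU : (2 * \sum_(v in S) #|nbrs W v| <= arcs (W :|: S))%N.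
  have E1 : (\sum_(v in S) #|nbrs W v| = \sum_(v in S) \sum_(y in W) adj v y)%N.
    apply: eq_bigr => v _; rewrite -sum1_card big_mkcond [RHS]big_mkcond /=.
    by apply: eq_bigr => y _; rewrite inE; case: (y \in W); case: adj.
  have E2 : (\sum_(v in S) \sum_(y in W) adj v y = \sum_(y in W) \sum_(v in S) adj y v)%N.
    by rewrite exchange_big; apply: eq_bigr => y _; apply: eq_bigr => v _; rewrite adj_sym.
  have sub x : (\sum_(y in W) adj x y <= \sum_(y in W :|: S) adj x y)%N
      /\ (\sum_(y in S) adj x y <= \sum_(y in W :|: S) adj x y)%N.
    by rewrite (sum_setU _ dSW); split; [apply: leq_addr|apply: leq_addl].
  rewrite mul2n -addnn arcs_sum (sum_setU _ dSW) /= {1}E1 E2 E1 leq_add //.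
    by apply: leq_sum => y _; have [] := sub y.
  by apply: leq_sum => y _; have [] := sub y.
have aUr : 2 * ((1 - e) * D * sig%:R) <= (arcs (W :|: S))%:R.
  apply: le_trans (_ : _ <= (2 * \sum_(v in S) #|nbrs W v|)%:R) _; last by rewrite ler_nat.
  rewrite natrM ler_pM2l // natr_sum -Ssig mulr_natr -sumr_const.
  by apply: ler_sum => v /(subsetP SA); apply: many.
apply: le_trans aUr; rewrite cU natrD.
have sizeU : (1 - e) * (#|W|%:R + sig%:R) <= sig%:R.
  have h1 : (1 - e) * #|W|%:R <= #|W|%:R by rewrite mulrBl mul1r gerBl mulr_ge0 // ltW.
  have := wsig; move: h1 Ww; clear; lra.
have h : (1 - e) * D * ((1 - e) * (#|W|%:R + sig%:R)) <= (1 - e) * D * sig%:R.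
  by rewrite ler_wpM2l // mulr_ge0 ?subr_ge0 // ltW.
by move: h; clear; lra.
Qed.

(** [W] is the union of the pieces found so far, of size at most 8 D s <= w. *)
Lemma pieces_or_dense (G : sgraph) (D e : R) (s : nat) (w : R) (sig : nat) :
  0 < D -> 0 < e -> e <= 1 ->
  (forall x : G, D < #|nbrs setT x|%:R) ->
  (forall x y : G, adj x y -> D - 1 < #|nbrs (nbrs setT x) y|%:R) ->
  (arcs [set: G])%:R <= 4 * D * #|G|%:R ->
  8 * D * s%:R <= w -> w <= e * sig%:R -> 2 * (sig%:R + w) <= #|G|%:R ->
  (exists U : {set G}, [/\ (sig <= #|U|)%N, #|U|%:R <= w + sig%:R &
     2 * (D * (1 - e) ^+ 2) * #|U|%:R <= (arcs U)%:R]) \/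
  exists Q : 'I_s -> {set G}, (forall i j, i != j -> [disjoint Q i & Q j]) /\
    forall i, [/\ (0 < #|Q i|)%N, #|Q i|%:R <= 8 * D &
      forall x, x \in Q i -> e * D - 1 < #|nbrs (Q i) x|%:R].
Proof.
move=> D0 e0 e1 deg codeg aG; elim: s => [|s IH] sw wsig sigG.
  by right; exists (fun _ => finset.set0); split=> [[]|[]].
have D8 : 0 <= 8 * D by rewrite mulr_ge0 // ltW.
have [||| |[Q [dQ QP]]] := IH => //; first by apply: le_trans sw; rewrite ler_wpM2l // ler_nat.
  by left.
pose W := \bigcup_i Q i.
have Ww : #|W|%:R <= w.
  apply: le_trans (_ : _ <= \sum_(i < s) 8 * D) _.
    rewrite -sum1_card partition_disjoint_bigcup // natr_sum.
    by apply: ler_sum => i _; rewrite sum1_card; have [] := QP i.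
  have -> : \sum_(i < s) 8 * D = 8 * D * s%:R by rewrite sumr_const card_ord mulr_natr.
  apply: le_trans sw.
  by rewrite ler_wpM2l // ler_nat.
have [|[Q' [dQ' Q'0 Q'8 Q'd]]] := piece_or_dense D0 e0 e1 deg codeg aG Ww wsig sigG; first by left.
have dI i : [disjoint Q i & Q'].
  rewrite disjoint_sym; apply: disjointWr dQ'; exact: bigcup_sup.
right; exists (fun i => if unlift ord_max i is Some j then Q j else Q'); split.
  move=> i j; case: unliftP => [i' ->|->]; case: unliftP => [j' ->|->] //.
  - by move=> ij; apply: dQ; apply: contra_neq ij => ->.
  - by rewrite disjoint_sym.
  - by rewrite eqxx.
by move=> i; case: unliftP => [j _|_].
Qed.

End Pieces.

(** * Bounds on the fractional density *)

Section FractionalDensity.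
Variable R : realType.
Local Open Scope ring_scope.

Lemma matching (G : sgraph) (U : {set G}) : exists n (m : 'I_n -> G * G),
  [/\ forall i, adj (m i).1 (m i).2, forall i, [set (m i).1; (m i).2] \subset U,
      forall i j, i != j -> [disjoint [set (m i).1; (m i).2] & [set (m j).1; (m j).2]]
    & (arcs U <= 4 * n * #|G|)%N].
Proof.
have [k] := ubnP #|U|; elim: k U => // k IH U; rewrite ltnS => Uk.
case: (pickP [pred p : G * G | [&& p.1 \in U, p.2 \in U & adj p.1 p.2]]) => [[x y]|none]; last first.
  have m0 : 'I_0 -> G * G by case.
  exists 0, m0; split=> [[]|[]|[]|] //.
  rewrite muln0 mul0n leqn0 /arcs; apply/eqP/big1 => x xU; apply/eqP.
  rewrite cards_eq0 -subset0; apply/subsetP => y; rewrite inE => /andP[yU axy].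
  by have := none (x, y); rewrite /= xU yU axy.
case/and3P=> /= xU yU axy; have xy : x != y by apply: contraTneq axy => ->; rewrite adj_irrefl.
pose e := [set x; y]; have eU : e \subset U by rewrite subUset !sub1set xU.
have ce : #|e| = 2%N by rewrite cards2 xy.
have [|n [m [m1 m2 m3 m4]]] := IH (U :\: e).
  by rewrite cardsD (setIidPr eU) ce; have := subset_leq_card eU; rewrite ce; move: Uk; clear; lia.
have de i : [disjoint [set (m i).1; (m i).2] & e].
  by rewrite disjoints_subset (subset_trans (m2 i)) //; apply/subsetP => z; rewrite !inE => /andP[].
exists n.+1, (fun i => if unlift ord_max i is Some j then m j else (x, y)); split.
- by move=> i; case: unliftP => [j _|_].
- by move=> i; case: unliftP => [j _|_] //=; apply: subset_trans (m2 j) (subsetDl _ _).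
- move=> i j; case: unliftP => [i' ->|->]; case: unliftP => [j' ->|->] //=.
  + by move=> ij; apply: m3; apply: contra_neq ij => ->.
  + by rewrite disjoint_sym.
  + by rewrite eqxx.
apply: leq_trans (arcsD U e) _.
have h : (\sum_(z in e) #|nbrs U z| <= 2 * #|G|)%N.
  rewrite -ce -sum_nat_const; apply: leq_sum => z _.
  by apply: leq_trans (nbrs_le U z) _; rewrite -cardsT subset_leq_card ?subsetT.
rewrite mulnS mulnDl addnC leq_add //.
by rewrite (leq_trans (leq_mul (leqnn 2) h)) // mulnA.
Qed.

(** All branch sets are mapped to the same edge, which is a jumbled model of multiplicity v(J); each
    edge of a maximal matching gets weight 1 / v(J). *)
Lemma matching_packing (J G : sgraph) : (0 < nverts J)%N -> (0 < nverts G)%N ->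
  exists n (alpha : 'I_n -> R) (mu : 'I_n -> J -> {set G}),
  fractional_packing alpha mu /\ density R G <= 2 * (nverts J)%:R * \sum_i alpha i.
Proof.
move=> J0 G0; have [n [m [m1 _ m3 m4]]] := matching [set: G].
have v0 : 0 < (nverts J)%:R :> R by rewrite ltr0n.
exists n, (fun _ => (nverts J)%:R^-1), (fun i _ => [set (m i).1; (m i).2]); split.
  split.
  - by move=> i; rewrite invr_ge0 ltW.
  - move=> i; split=> [v|u v _]; first by apply: connected_in2.
    by exists (m i).1, (m i).2; rewrite set21 set22.
  move=> x; rewrite -big_distrr /= mulrC ler_pdivrMr // mul1r -natr_sum ler_nat.
  case: (pickP [pred i | x \in [set (m i).1; (m i).2]]) => [i /= xi|none].
    rewrite (bigD1 i) //= big1 ?addn0 => [|j ji]; first exact: max_card.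
    rewrite /multiplicity (_ : [set _ | _] = finset.set0) ?cards0 //.
    apply/setP => v; rewrite !inE; have := disjointFl (m3 j i ji) xi.
    by rewrite !inE.
  rewrite big1 // => i _; rewrite /multiplicity (_ : [set _ | _] = finset.set0) ?cards0 //.
  by apply/setP => v; rewrite !inE; have := none i; rewrite /= !inE.
rewrite sumr_const card_ord densityE.
have -> : (nverts J)%:R^-1 *+ n = (nverts J)%:R^-1 * n%:R :> R by rewrite mulr_natr.
have -> : 2 * (nverts J)%:R * ((nverts J)%:R^-1 * n%:R) = 2 * n%:R :> R by field; rewrite gt_eqF.
rewrite ler_pdivrMr ?mulr_gt0 ?ltr0n //.
move: m4; rewrite -(ler_nat R) !natrM /nverts; clear; lra.
Qed.

Lemma packing_le (J G : sgraph) n (alpha : 'I_n -> R) (mu : 'I_n -> J -> {set G}) :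
  fractional_packing alpha mu -> (nverts J)%:R * \sum_i alpha i <= (nverts G)%:R.
Proof.
move=> [a0 muJ load].
have -> : (nverts G)%:R = \sum_(x : G) (1 : R) by rewrite sumr_const.
apply: le_trans (ler_sum _ (fun x _ => load x)); rewrite exchange_big big_distrr /=.
apply: ler_sum => i _; rewrite -big_distrr /= mulrC ler_wpM2l // -natr_sum ler_nat.
rewrite /multiplicity (sum_card_rel (fun x v => x \in mu i v)) /nverts -sum1_card.
apply: leq_sum => v _; have [/(_ v)[ne _] _] := muJ i.
by rewrite (_ : [set x | _] = mu i v) ?card_gt0 //; apply/setP => x; rewrite inE.
Qed.

Lemma Vol_finite (J G : sgraph) : (0 < nverts J)%N -> (0 < nverts G)%N ->
  exists r : R, [/\ Vol R J G = r%:E, density R G <= 2 * (nverts J)%:R * r,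
    (nverts J)%:R * r <= (nverts G)%:R &
    forall s, s < r -> exists n (alpha : 'I_n -> R) (mu : 'I_n -> J -> {set G}),
      fractional_packing alpha mu /\ s < \sum_i alpha i].
Proof.
move=> J0 G0; have v0 : 0 < (nverts J)%:R :> R by rewrite ltr0n.
have up : (Vol R J G <= ((nverts G)%:R / (nverts J)%:R)%:E)%E.
  apply/ereal_supP => _ [n [alpha [mu [fp ->]]]]; rewrite lee_fin ler_pdivlMr // mulrC.
  exact: packing_le fp.
have [n [alpha [mu [fp dle]]]] := matching_packing J0 G0.
have low : ((\sum_i alpha i)%:E <= Vol R J G)%E.
  by apply: ereal_sup_ubound; exists n, alpha, mu.
have [r rE] : exists r, Vol R J G = r%:E.
  by move: up low; case: (Vol R J G) => [r| |] //; exists r.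
rewrite rE !lee_fin in up low; exists r; split=> //.
- by apply: le_trans dle _; rewrite ler_pM2l // mulr_gt0.
- by move: up; rewrite ler_pdivlMr // mulrC.
move=> s sr; have [//|none] := pselect (exists n (alpha : 'I_n -> R) (mu : 'I_n -> J -> {set G}),
      fractional_packing alpha mu /\ s < \sum_i alpha i).
have : (Vol R J G <= s%:E)%E.
  apply/ereal_supP => _ [n' [alpha' [mu' [fp' ->]]]]; rewrite lee_fin leNgt; apply/negP => lt.
  by apply: none; exists n', alpha', mu'.
by rewrite rE lee_fin leNgt sr.
Qed.

(** K2 has density 1/2, and a packing in it has weight at most 2 / v(J) by double counting; this
    gives the lower bound v(J)/4 on c_f(J). *)
Definition K2_adj : rel bool := fun x y => x != y.
Lemma K2_sym : symmetric K2_adj. Proof. by case; case. Qed.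
Lemma K2_irrefl : irreflexive K2_adj. Proof. by case. Qed.
Definition K2 : sgraph := SGraph K2_sym K2_irrefl.

Lemma density_K2 : density R K2 = 1 / 2.
Proof.
have n2 : nverts K2 = 2%N by rewrite /nverts card_bool.
have a2 : arcs [set: K2] = 2%N.
  rewrite /arcs (eq_bigr (fun _ => 1%N)) => [|x _]; first by rewrite sum1_card cardsT card_bool.
  rewrite (_ : nbrs _ _ = [set (~~ x : K2)]) ?cards1 //; apply/setP => y; rewrite !inE.
  by case: x; case: y.
by rewrite densityE n2 a2; field.
Qed.

Lemma frac_minor_density_finite (J : sgraph) : (0 < nverts J)%N ->
  exists c : R, [/\ frac_minor_density R J = c%:E, (nverts J)%:R / 4 <= c,
    c <= 2 * (nverts J)%:R & frac_bound J c].
Proof.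
move=> J0; have v0 : 0 < (nverts J)%:R :> R by rewrite ltr0n.
have d0 (G : sgraph) : 0 <= density R G by rewrite /density divr_ge0.
(* For r = 0 the density is 0 too, and the extended quotient 0 * +oo = 0 agrees with the real
   convention x / 0 = 0. *)
have ratio (G : sgraph) (r : R) : density R G <= 2 * (nverts J)%:R * r ->
    ((density R G)%:E / r%:E = (density R G / r)%:E)%E /\ 0 <= r.
  move=> dr; have r0 : 0 <= r.
    by have := le_trans (d0 G) dr; rewrite pmulr_rge0 // mulr_gt0.
  split=> //; rewrite inver; case: eqP => [re|_]; last by [].
  have -> : density R G = 0 by apply/eqP; rewrite eq_le d0 andbT; move: dr; rewrite re mulr0.
  by rewrite mul0e mul0r.
have up : (frac_minor_density R J <= (2 * (nverts J)%:R)%:E)%E.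
  apply/ereal_supP => _ [G G0 ->]; have [r [-> dr _ _]] := Vol_finite J0 G0.
  have [-> r0] := ratio G r dr; rewrite lee_fin.
  have [->|rn0] := eqVneq r 0; first by rewrite invr0 mulr0 mulr_ge0 // ltW.
  by rewrite ler_pdivrMr // lt0r rn0.
have low : (((nverts J)%:R / 4)%:E <= frac_minor_density R J)%E.
  have G0 : (0 < nverts K2)%N by rewrite /nverts card_bool.
  have [r [rE dr ur _]] := Vol_finite J0 G0.
  have [E r0] := ratio K2 r dr.
  apply: (@le_trans _ _ ((density R K2)%:E / Vol R J K2)%E); last first.
    by apply: ereal_sup_ubound; exists K2.
  rewrite rE E lee_fin; have rp : 0 < r.
    rewrite lt0r r0 andbT; apply: contraTneq dr => ->; rewrite mulr0 density_K2 -ltNge; lra.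
  rewrite ler_pdivlMr // density_K2; move: ur; rewrite /nverts card_bool; clear; lra.
have [c cE] : exists c, frac_minor_density R J = c%:E.
  by move: up low; case: (frac_minor_density R J) => [c| |] //; exists c.
rewrite cE !lee_fin in up low; exists c; split=> // G G0 xi xi0.
have [r [rE dr _ adh]] := Vol_finite J0 G0; have [E r0] := ratio G r dr.
have c0 : 0 < c by apply: lt_le_trans low; rewrite divr_gt0.
have dcr : density R G <= c * r.
  have [re|rn0] := eqVneq r 0; first by move: dr; rewrite re !mulr0.
  have : ((density R G)%:E / Vol R J G <= c%:E)%E by rewrite -cE; apply: ereal_sup_ubound; exists G.
  by rewrite rE E lee_fin ler_pdivrMr // lt0r rn0.
have [|n [alpha [mu [fp lt]]]] := adh (r - xi / c); first by rewrite ltrBlDr ltrDl divr_gt0.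
exists n, alpha, mu; split=> //.
have := ltW lt; rewrite -(ler_pM2l c0) mulrBr mulrCA divff ?gt_eqF // mulr1 => h.
by move: dcr h; clear; lra.
Qed.

End FractionalDensity.

(** * Proof of the theorem *)

Section Assembly.
Variable R : realType.
Local Open Scope ring_scope.

(** The required excess is (s+1) k for the parts of the pieces used up by links, and one more [k]
    for the error of [dense_minor] with [eta] equal to 1. *)
Lemma linked_pieces_minor (s M : nat) : exists th : nat, forall C : nat, exists k0 : nat,
  forall (J H G : sgraph) (c : R) (k l : nat) (P : 'I_s.+1 -> {set G}) (F : {set {set H}}),
  (nverts J <= C)%N -> 0 < c -> c <= 2 * C%:R -> frac_bound J c ->
  (k0 <= k)%N -> rconn [set: G] k ->
  (forall i, [/\ rconn (P i) k, k.+2 <= #|P i| & #|P i| <= M * k])%N ->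
  (forall i j, i != j -> [disjoint P i & P j]) ->
  F \subset edges H -> (th * #|F| <= k)%N -> is_subgraph (del_edges F) (copies l J) ->
  l%:R * c + s.+2%:R * k%:R <= \sum_i (arcs (P i))%:R / (2 * #|P i|%:R) ->
  is_minor H G.
Proof.
pose X0 := (8 * s.+1 * (6 * M).+3)%N.
have X0p : (0 < X0)%N by [].
have [th0 dense] := @dense_minor R (s.+1 * M * (3 * X0))%N s.+1 1 ltr01.
exists (th0 * (3 * X0))%N => C; have [k0 {}dense] := dense C.
exists (X0 * k0.+2)%N => J H G c k l P F JC c0 cC fb kk rG hP dP FE Fk sub sumP.
(* Linking lowers the connectivity from [k] to q - 1, still at least k / (3 X0); hence the constant
   given to [dense_minor]. *)
pose q := (k %/ X0)%N.
have qk : (X0 * q <= k)%N by rewrite mulnC leq_divM.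
have q2 : (k0.+2 <= q)%N by rewrite leq_divRL // mulnC.
have q0 : (0 < q)%N by apply: leq_trans q2.
have kq : (k <= 3 * X0 * q.-1)%N.
  have h1 : (k < q.+1 * X0)%N by apply: ltn_ceil.
  have h2 : (q.+1 <= 3 * q.-1)%N by move: q2; clear; lia.
  have h3 : (q.+1 * X0 <= 3 * q.-1 * X0)%N by rewrite leq_mul2r h2 orbT.
  by rewrite mulnAC (leq_trans (ltnW h1)).
have sqk : (s * q <= k)%N.
  apply: leq_trans qk; rewrite leq_mul2r; apply/orP; right; rewrite /X0; clear; nia.
have [G2 [V [mG2 dV rG2 /andP[qG2 G2k] VP]]] := link_pieces q0 qk sqk rG hP dP.
apply: minor_trans mG2; apply: (dense J H G2 c q.-1 l V F) => //.
- by move: q2; clear; lia.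
- apply: leq_trans G2k _; rewrite -[X in (_ <= X)%N]mulnA leq_mul2l; apply/orP; right.
  exact: kq.
- by rewrite prednK.
- have h : (3 * X0 * (th0 * #|F|) <= 3 * X0 * q.-1)%N.
    by apply: leq_trans kq; rewrite mulnCA mulnA.
  by rewrite leq_pmul2l // muln_gt0 in h.
have lossy i : (arcs (P i))%:R / (2 * #|P i|%:R) - k%:R <= (arcs (V i))%:R / (2 * #|V i|%:R) :> R.
  have [Y [Yk aY cY]] := VP i; rewrite -cY.
  apply: (@le_trans _ _ ((arcs (P i :\: Y))%:R / (2 * #|P i :\: Y|%:R))); last first.
    by rewrite ler_wpM2r ?ler_nat // invr_ge0 mulr_ge0.
  apply: le_trans (arcsD_density R (P i) Y); rewrite lerD2l lerN2 ler_nat.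
  by move: Yk; clear; lia.
have : \sum_(i < s.+1) ((arcs (P i))%:R / (2 * #|P i|%:R) - k%:R)
    <= \sum_i (arcs (V i))%:R / (2 * #|V i|%:R) :> R by apply: ler_sum => i _; apply: lossy.
rewrite sumrB; have -> : \sum_(i < s.+1) k%:R = s.+1%:R * k%:R :> R.
  by rewrite sumr_const card_ord mulr_natl.
have q1k : q.-1%:R <= k%:R :> R.
  by rewrite ler_nat; apply: leq_trans (leq_pred q) (leq_div k X0).
have e : s.+2%:R = s.+1%:R + 1 :> R by rewrite -addn1 natrD.
move: sumP; rewrite e mulrDl; set A := \sum_i _ / _; set B := \sum_i _ / _.
by move: q1k; clear; lra.
Qed.

(** Case of one piece: two factors 1 - a are lost in finding the dense subgraph and one in making it
    highly connected; 2 k is the excess asked for by [linked_pieces_minor] with s = 0. *)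
Lemma slack (a x k : R) : 0 < a -> a <= 1 / 8 -> 0 <= x -> k <= a * a * ((1 + 8 * a) * x) / 4 ->
  x + 2 * k <= (1 + 8 * a) * x * (1 - a) ^+ 2 * (1 - a).
Proof.
move=> a0 a8 x0 hk.
have p : 0 <= (1 + 8 * a) * (1 - a) ^+ 2 * (1 - a) - 1 - a * a * (1 + 8 * a) / 2.
  have h1 : 0 <= a * (1 / 8 - a) by rewrite mulr_ge0 ?subr_ge0 // ltW.
  have h2 : 0 <= a * a * (1 / 8 - a) by rewrite !mulr_ge0 ?subr_ge0 // ltW.
  have h3 : 0 <= a * a * a * (1 / 8 - a) by rewrite !mulr_ge0 ?subr_ge0 // ltW.
  have h4 : 0 < a * a * a by rewrite !mulr_gt0.
  have -> : (1 + 8 * a) * (1 - a) ^+ 2 * (1 - a) - 1 - a * a * (1 + 8 * a) / 2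
     = 5 * a - 43 / 2 * (a * a) + 19 * (a * a * a) - 8 * (a * a * a * a) by field.
  have e1 : a * (1 / 8 - a) = a / 8 - a * a by ring.
  have e3 : a * a * a * (1 / 8 - a) = a * a * a / 8 - a * a * a * a by ring.
  by rewrite e1 in h1; rewrite e3 in h3; lra.
have h := mulr_ge0 p x0.
have e : ((1 + 8 * a) * (1 - a) ^+ 2 * (1 - a) - 1 - a * a * (1 + 8 * a) / 2) * x
   = (1 + 8 * a) * x * (1 - a) ^+ 2 * (1 - a) - x - 2 * (a * a * ((1 + 8 * a) * x) / 4) by field.
by rewrite e in h; move: h hk; clear; lra.
Qed.

(** Either alternative of [pieces_or_dense] is made highly connected by [rich_sub] and handed to
    [linked_pieces_minor], with one piece or with [s]. The factor 4 in the bound on [F] reflects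
    v(H) <= l v(J) <= 4 l c. *)
Lemma dense_graph_minor (a : R) : 0 < a -> a <= 1 / 8 -> exists2 delta : R, 0 < delta &
  forall C : nat, exists L : nat, forall (J H G : sgraph) (c : R) (l : nat) (F : {set {set H}}),
  (0 < nverts J <= C)%N -> (nverts J)%:R / 4 <= c -> c <= 2 * C%:R -> frac_bound J c ->
  (L <= l)%N -> (0 < nverts G)%N -> (1 + 8 * a) * (l%:R * c) < density R G ->
  F \subset edges H -> #|F|%:R <= delta * (4 * ((1 + 8 * a) * (l%:R * c))) ->
  is_subgraph (del_edges F) (copies l J) -> is_minor H G.
Proof.
move=> a0 a8; have aa0 : 0 < a * a by rewrite mulr_gt0.
(* A piece will have density about a D / 4, so about 10 / a of them reach well over 2 D, enough for
   l c and all losses. *)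
pose s' := Num.truncn (10 / a); pose s := s'.+1.
have ta0 : 0 <= 10 / a by rewrite divr_ge0 // ltW.
have /andP[s_le s_gt] := truncn_itv ta0; rewrite -/s' in s_le s_gt.
have s_up : s%:R * a <= 11.
  have : s'%:R * a <= 10 by rewrite -ler_pdivlMr.
  have e : s%:R = s'%:R + 1 :> R by rewrite -natr1.
  by rewrite e mulrDl mul1r; lra.
have s_dn : 10 <= s%:R * a by rewrite -ler_pdivrMr // ltW.
(* K2 D bounds 2 (sig + w) for w = 8 D s and sig about w / a, hence the size of the dense
   subgraph. *)
pose K2 := 16 * s%:R / a + 16 * s%:R + 2 : R.
have sa0 : 0 <= 16 * s%:R / a by rewrite divr_ge0 ?mulr_ge0 // ltW.
have s1 : 1 <= s%:R :> R by rewrite ler1n.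
have K20 : 8 <= K2 by rewrite /K2; lra.
pose M := (Num.truncn (8 * K2 / (a * a))).+1.
have M_big : 8 * K2 <= M%:R * (a * a).
  have h0 : 0 <= 8 * K2 / (a * a) by rewrite divr_ge0 ?(ltW aa0) //; lra.
  by rewrite -ler_pdivrMr //; have /andP[_ /ltW] := truncn_itv h0.
have [th1 link1] := linked_pieces_minor 0 M.
have [th2 link2] := linked_pieces_minor s' M.
pose th := (th1 + th2)%N.
have th0 : 0 < (th.+1)%:R :> R by rewrite ltr0n.
(* With |F| <= 4 delta D this gives th |F| <= a a D / 8 <= k. *)
exists (a * a / (32 * th.+1%:R)); first by rewrite divr_gt0 // mulr_gt0.
move=> C; have [k1 {}link1] := link1 C; have [k2 {}link2] := link2 C.
(* Collects the lower bounds needed on [D]. Since c >= 1/4, l >= 4 B forces D >= B. *)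
pose B := (4 * (k1 + k2)%:R + 8) / (a * a) + 3 + 8 / a : R.
have aB0 : 0 <= (4 * (k1 + k2)%:R + 8) / (a * a) by rewrite divr_ge0 ?(ltW aa0) // addr_ge0 ?mulr_ge0.
have a80 : 0 <= 8 / a by rewrite divr_ge0 // ltW.
exists (Num.truncn (4 * B)).+1 => J H G c l F /andP[J0 JC] cJ cC fb Ll G0 dG FE Fd sub.
have v1 : 1 <= (nverts J)%:R :> R by rewrite ler1n.
have c0 : 0 < c by apply: lt_le_trans cJ; rewrite divr_gt0 // ltr0n.
set x := l%:R * c in dG Fd; set D := (1 + 8 * a) * x in dG Fd.
have x0 : 0 <= x by rewrite mulr_ge0 // ltW.
have xD : x <= D.
  by rewrite /D mulrDl mul1r lerDl; apply: mulr_ge0 => //; rewrite mulr_ge0 // ltW.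
have BD : B <= D.
  have h0 : 0 <= 4 * B by rewrite /B; lra.
  have /andP[_ h1] := truncn_itv h0.
  have h2 : 4 * B <= l%:R by apply: le_trans (ltW h1) _; rewrite ler_nat.
  have h3 : l%:R / 4 <= x by rewrite /x ler_wpM2l //; lra.
  by apply: le_trans xD; move: h2 h3; clear; lra.
have D3 : 3 <= D by apply: le_trans BD; rewrite /B; lra.
have D0 : 0 < D by lra.
have aD8 : 8 <= a * D.
  by rewrite mulrC -ler_pdivrMr //; apply: le_trans BD; rewrite /B; lra.
have aaD : 4 * (k1 + k2)%:R + 8 <= a * a * D.
  by rewrite [X in _ <= X]mulrC -ler_pdivrMr //; apply: le_trans BD; rewrite /B; lra.
have rG : rich D a [set: G].
  have n0 : 0 < #|G|%:R :> R by rewrite ltr0n.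
  have EG : 2 * D * #|G|%:R < (arcs [set: G])%:R.
    by move: dG; rewrite densityE ltr_pdivlMr ?mulr_gt0 ?ltr0n // /nverts mulrCA mulrA.
  rewrite /rich cardsT; split; last first.
    by apply: le_lt_trans EG; apply: ler_wpM2l; [rewrite mulr_ge0 // ltW|rewrite gerBl mulr_ge0 // ltW].
  have : 2 * D * #|G|%:R <= #|G|%:R * #|G|%:R.
    apply: le_trans (ltW EG) _; rewrite -natrM ler_nat -cardsT (leq_trans (arcs_le _)) //.
    by rewrite leq_mul2l leq_pred orbT.
  by rewrite ler_pM2r //; lra.
have a2 : a <= 1 / 2 by lra.
have [G' [mG' [DG' EG'] [deg conn] codeg aG]] := minimal_minor D3 (ltW a0) a2 rG.
rewrite cardsT in DG' EG'.
apply: minor_trans mG'.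
have aaD4 : 0 <= a * a * D / 4 by rewrite divr_ge0 // mulr_ge0 // ltW.
(* This is a times a D / 4, the connectivity that [rich_sub] guarantees for the sparse pieces; the
   whole graph and the dense subgraph have at least as much. *)
pose k := Num.truncn (a * a * D / 4).
have /andP[k_le k_gt] := truncn_itv aaD4; rewrite -/k in k_le k_gt.
have k_gt' : a * a * D / 4 < k%:R + 1 by rewrite natr1.
have k_dn : a * a * D / 8 <= k%:R by move: k_gt' aaD (ler0n R (k1 + k2)); clear; lra.
have kk : (k1 + k2 <= k)%N.
  by rewrite -(ler_nat R); move: k_gt' aaD (ler0n R (k1 + k2)); clear; lra.
have aaaD : a * a * D <= a * D / 8.
  have : 0 <= a * D * (1 / 8 - a) by rewrite mulr_ge0 ?subr_ge0 // ltW // mulr_gt0.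
  have -> : a * D * (1 / 8 - a) = a * D / 8 - a * a * D by ring.
  by rewrite subr_ge0.
have aDD : a * D <= D / 8 by rewrite mulrC ler_pM2l //; lra.
have Mk : K2 * D <= M%:R * k%:R.
  have h1 : M%:R * (a * a * D / 8) <= M%:R * k%:R by rewrite ler_wpM2l.
  have h2 : 8 * K2 * D <= M%:R * (a * a) * D by rewrite ler_pM2r.
  by move: h1 h2; clear; lra.
have thF : (th * #|F| <= k)%N.
  rewrite -(ler_nat R) natrM.
  have h1 : th.+1%:R * #|F|%:R <= th.+1%:R * (a * a / (32 * th.+1%:R) * (4 * D)) by rewrite ler_pM2l.
  have h2 : th.+1%:R * (a * a / (32 * th.+1%:R) * (4 * D)) = a * a * D / 8.
    by field; rewrite gt_eqF // addrC natr1.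
  have h3 : th%:R * #|F|%:R <= th.+1%:R * #|F|%:R :> R by rewrite ler_wpM2r // ler_nat.
  by apply: le_trans h3 _; apply: le_trans h1 _; rewrite h2.
have rG' : rconn [set: G'] k.
  by apply: conn; apply: le_trans k_le _; move: aaaD aD8; clear; lra.
pose w := 8 * D * s%:R; pose sig := (Num.truncn (w / a)).+1.
have w0 : 0 <= w by apply: mulr_ge0 => //; rewrite mulr_ge0 // ltW.
have wa0 : 0 <= w / a by rewrite divr_ge0 // ltW.
have /andP[sig_le sig_gt] := truncn_itv wa0.
have wsig : w <= a * sig%:R by rewrite mulrC -ler_pdivrMr // ltW.
have sig_up : sig%:R <= w / a + 1 by rewrite -natr1 lerD2r.
have K2D : 2 * (sig%:R + w) <= K2 * D.
  have e : K2 * D = 2 * (w / a + w + D) by rewrite /K2 /w; field; rewrite gt_eqF.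
  by rewrite e; move: sig_up D3; clear; lra.
have alt : (exists U : {set G'}, [/\ (0 < #|U|)%N, #|U|%:R <= K2 * D &
     2 * (D * (1 - a) ^+ 2) * #|U|%:R <= (arcs U)%:R]) \/
  exists Q : 'I_s -> {set G'}, (forall i j, i != j -> [disjoint Q i & Q j]) /\
    forall i, [/\ (0 < #|Q i|)%N, #|Q i|%:R <= 8 * D &
      forall y, y \in Q i -> a * D - 1 < #|nbrs (Q i) y|%:R].
  (* A graph too small for the search for pieces serves as the dense subgraph itself, its density
     coming from richness. *)
  have [big|small] := leP (2 * (sig%:R + w)) #|G'|%:R.
    have a1 : a <= 1 by lra.
    have [[U [sU Uw EU]]|] := @pieces_or_dense R G' D a s w sig D0 a0 a1 deg codeg aG (lexx _) wsig big.
      left; exists U; split=> //; first exact: leq_trans sU.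
      by apply: le_trans Uw _; move: K2D w0 (ler0n R sig); clear; lra.
    by right.
  left; exists [set: G']; rewrite cardsT; split.
  - by rewrite -(ltr_nat R); apply: lt_le_trans D0 DG'.
  - by apply: le_trans (ltW small) K2D.
  apply: le_trans (ltW EG').
  have h1 : a * D <= a * #|G'|%:R by rewrite ler_pM2l.
  have h2 : 0 <= a * (1 - a) * #|G'|%:R.
    by apply: mulr_ge0 => //; apply: mulr_ge0; [exact: ltW|rewrite subr_ge0; lra].
  have h3 : (1 - a) ^+ 2 * #|G'|%:R <= #|G'|%:R - a * D.
    have -> : (1 - a) ^+ 2 * #|G'|%:R = #|G'|%:R - a * #|G'|%:R - a * (1 - a) * #|G'|%:R by ring.
    by move: h1 h2; clear; lra.
  by rewrite mulrA -(mulrA (2 * D)); apply: ler_wpM2l h3; rewrite mulr_ge0 // ltW.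
case: alt => [[U [U0 UK EU]]|[Q [dQ QP]]].
  pose D1 := D * (1 - a) ^+ 2.
  have D1D : D / 4 <= D1.
    rewrite ler_pM2l // expr2; have : 0 <= (1 - a - 1 / 2) * (1 - a + 1 / 2) by rewrite mulr_ge0 //; lra.
    by lra.
  have D10 : 0 < D1 by lra.
  have [P [PU dens Pbig Pconn]] := rich_sub D10 a0 a2 U0 EU.
  have aD1 : a * (D / 4) <= a * D1 by rewrite ler_pM2l.
  apply: (link1 J H G' c k l (fun _ => P) F) => //.
  - by apply: leq_trans (leq_addr _ _) kk.
  - move=> _; split.
    + by apply: Pconn; apply: le_trans k_le _; move: aD1 aaaD aD8; clear; lra.
    + rewrite -(ler_nat R); apply: le_trans (ltW Pbig).
      rewrite -2!natr1; move: k_le aaaD aDD D1D aD8; clear; lra.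
    + rewrite -(ler_nat R) natrM; apply: le_trans Mk; apply: le_trans UK.
      by rewrite ler_nat subset_leq_card.
  - by move=> i j; rewrite !ord1 eqxx.
  - by apply: leq_trans thF; rewrite leq_mul2r leq_addr orbT.
  rewrite big_ord1; apply: le_trans dens; rewrite /D1 /D.
  exact: slack.
have sumk : s.+1%:R * k%:R <= D / 2.
  have h1 : s.+1%:R * k%:R <= s.+1%:R * (a * a * D / 4) by rewrite ler_wpM2l.
  have h2 : s.+1%:R * a <= 12 by rewrite -natr1 mulrDl mul1r; lra.
  have h3 : s.+1%:R * a * (a * D) <= 12 * (a * D) by rewrite ler_pM2r // mulr_gt0.
  have e : s.+1%:R * (a * a * D / 4) = s.+1%:R * a * (a * D) / 4 by ring.
  by rewrite e in h1; move: h1 h3 aDD D0; clear; lra.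
(* Minimum degree above a D - 1 gives density at least (a D - 1) / 2, which exceeds a D / 4 since a
   D >= 8. *)
pose d2 := a * D / 4.
have d20 : 0 < d2 by rewrite divr_gt0 // mulr_gt0.
have /fin_all_exists[P PP] i : exists P : {set G'}, [/\ P \subset Q i,
    d2 * (1 - a) <= (arcs P)%:R / (2 * #|P|%:R), d2 + 1 < #|P|%:R
    & forall k', k'%:R <= a * d2 -> rconn P k'].
  have [Q0 Q8 Qd] := QP i; apply: rich_sub => //.
  apply: (@le_trans _ _ (\sum_(y in Q i) (a * D - 1))); last first.
    by rewrite /arcs natr_sum; apply: ler_sum => y /Qd/ltW.
  rewrite sumr_const -[X in _ <= X]mulr_natr ler_wpM2r // /d2.
  by move: aD8; clear; lra.
apply: (link2 J H G' c k l P F) => //.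
- by apply: leq_trans (leq_addl _ _) kk.
- move=> i; have [PQ dens Pbig Pconn] := PP i; have [_ Q8 _] := QP i; split.
  + by apply: Pconn; apply: le_trans k_le _; rewrite /d2; move: (lexx (a * a * D)); clear; lra.
  + rewrite -(ler_nat R); apply: le_trans (ltW Pbig).
    rewrite -2!natr1 /d2; move: k_le aaaD aD8; clear; lra.
  + rewrite -(ler_nat R) natrM; apply: le_trans Mk; apply: le_trans (_ : 8 * D <= _).
      by apply: le_trans Q8; rewrite ler_nat subset_leq_card.
    by rewrite ler_pM2r.
- move=> i j /dQ; have [Pi _ _ _] := PP i; have [Pj _ _ _] := PP j.
  by move=> d; apply: disjointWl Pi (disjointWr Pj d).
- by apply: leq_trans thF; rewrite leq_mul2r leq_addl orbT.
have : \sum_(i < s) d2 * (1 - a) <= \sum_i (arcs (P i))%:R / (2 * #|P i|%:R).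
  by apply: ler_sum => i _; have [] := PP i.
apply: le_trans.
have -> : \sum_(i < s) d2 * (1 - a) = s%:R * a * D * (1 - a) / 4.
  by rewrite sumr_const card_ord -[X in X = _]mulr_natl /d2; ring.
have h1 : 10 * (D * (1 - a)) <= s%:R * a * (D * (1 - a)).
  by apply: ler_wpM2r => //; apply: mulr_ge0; [exact: ltW|rewrite subr_ge0; lra].
have e : s%:R * a * D * (1 - a) / 4 = s%:R * a * (D * (1 - a)) / 4 by ring.
rewrite e -/x; have : x + s.+1%:R * k%:R <= x + D / 2 by rewrite lerD2l.
by move/le_trans; apply; move: h1 xD aDD D0; clear; lra.
Qed.

End Assembly.
Local Open Scope ring_scope.

Theorem theorem6p6 (R : realType) :
  forall eps : R, 0 < eps ->
  exists2 delta : R, 0 < delta &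
  forall C : R, 0 < C ->
  exists L : nat,
  forall (J : sgraph) (l : nat) (H : sgraph),
    (nverts J)%:R <= C ->
    (L <= l)%N ->
    (2 <= nverts H)%N ->
    (exists F : {set {set H}},
       [/\ F \subset edges H,
           #|F|%:R <= delta * (nverts H)%:R &
           is_subgraph (del_edges F) (copies l J)]) ->
    (minor_density R H <= ((1 + eps) * l%:R)%:E * frac_minor_density R J)%E.
Proof.
(* The factor 1 + 8 a must not exceed 1 + eps, and the estimates need a <= 1/8. *)
move=> eps eps0; pose a : R := Num.min eps 1 / 8.
have a0 : 0 < a by rewrite divr_gt0 // lt_min eps0 ltr01.
have a8 : a <= 1 / 8 by rewrite ler_pM2r // ge_min lexx orbT.
have a_eps : 8 * a <= eps.
  have -> : 8 * a = Num.min eps 1 by rewrite /a; field.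
  by rewrite ge_min lexx.
have [delta delta0 main] := dense_graph_minor a0 a8.
exists delta => // C C0; pose N := (Num.truncn C).+1.
have [L {}main] := main N; exists L => J l H JC Ll H2 [F [FE Fd sub]].
have JN : (nverts J <= N)%N.
  have /andP[_ lt] := truncn_itv (ltW C0).
  by rewrite -(ler_nat R); apply: le_trans JC (ltW lt).
have HJ : (nverts H <= l * nverts J)%N.
  have [f fI _] := sub; rewrite /nverts -[l in (l * _)%N]card_ord -card_prod.
  exact: (leq_card f fI).
(* [H] has at least two vertices and embeds in copies of [J], so [J] is not null; this rules out the
   infinite volume. *)
have J0 : (0 < nverts J)%N.
  by case: (nverts J) HJ => //; rewrite muln0 leqn0 => /eqP h; move: H2; rewrite h.
have [c [-> cJ cC fb]] := frac_minor_density_finite R J0.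
have v0 : 0 < (nverts J)%:R :> R by rewrite ltr0n.
have c0 : 0 < c by apply: lt_le_trans cJ; rewrite divr_gt0.
have lc0 : 0 <= l%:R * c by rewrite mulr_ge0 // ltW.
rewrite -EFinM; apply/ereal_supP => _ [G [G0 nH ->]]; rewrite lee_fin leNgt.
apply/negP => dG; apply: nH; apply: (main J H G c l F) => //.
- by rewrite J0.
- by apply: le_trans cC _; rewrite ler_pM2l // ler_nat.
- apply: le_lt_trans dG; rewrite -mulrA ler_wpM2r //; lra.
apply: le_trans Fd _; rewrite ler_pM2l //.
have h1 : (nverts H)%:R <= l%:R * (nverts J)%:R :> R by rewrite -natrM ler_nat.
have h2 : l%:R * ((nverts J)%:R / 4) <= l%:R * c by rewrite ler_wpM2l.
have h3 : l%:R * c <= (1 + 8 * a) * (l%:R * c).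
  by rewrite mulrDl mul1r lerDl; apply: mulr_ge0 => //; rewrite mulr_ge0 // ltW.
by move: h1 h2 h3; clear; lra.
Qed.
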